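(* Let $\tau\in(3,4)$ and $\tilde\beta\in\mathbb R$. For $p\in[0,1]$ define $$I_E(p)=(\tau-1)\int_0^\infty\Big(\frac{e^{\theta^*v}(1-e^{-pv})}{e^{\theta^*v}(1-e^{-v})+e^{-v}}-pv\Big)\frac{dv}{v^{\tau-1}}.$$ Then, for every $\varepsilon>0$, as $u\to\infty$, $$\mathbb P\Big(\sup_{p\in[0,1]}\big|\mathcal S_{pu}-u^{\tau-2}I_E(p)\big|\le u^{\tau-2}\varepsilon\;\Big|\;H_1(0)>u\Big)=1-o(1).$$
   Context: Put $\alpha=1/(\tau-1)$ and $c_i=i^{-\alpha}$. Let $(T_i)_{i\ge 2}$ be independent exponential random variables with $\mathbb E[T_i]=i^{\alpha}$, let $\mathcal I_i(t)=\mathbf 1_{\{T_i\le t\}}$, and $$\mathcal S_t=1+\tilde\beta t+\sum_{i=2}^\infty c_i[\mathcal I_i(t)-c_it],\qquad t\ge 0,\qquad H_1(0)=\inf\{t\ge0:\mathcal S_t=0\}.$$ For $x>0$ let $$f(x;\vartheta)=\log\big(1+e^{-x^{-\alpha}}(e^{-\vartheta x^{-\alpha}}-1)\big)+\vartheta x^{-\alpha}-\vartheta x^{-2\alpha},\qquad \Lambda(\vartheta)=\int_0^\infty f(x;\vartheta)\,dx.$$ The constant $\theta^*>0$ is the (unique) value of $\vartheta$ at which $\vartheta\mapsto\Lambda(\vartheta)$ is minimal. *)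

(* Defs.v *)
From HB Require Import structures.
From mathcomp Require Import all_boot all_order all_algebra.
From mathcomp Require Import all_classical all_reals all_analysis.

Set Implicit Arguments.
Unset Strict Implicit.
Unset Printing Implicit Defensive.
Import Order.TTheory GRing.Theory Num.Theory.
Import numFieldNormedType.Exports.

Local Open Scope classical_set_scope.
Local Open Scope ring_scope.

Section constants.
Context {R : realType}.
Implicit Types (tau x th p v : R) (i : nat).

Definition alpha tau : R := 1 / (tau - 1).

Definition c_ tau i : R := i%:R `^ (- alpha tau).

Definition f_ tau x th : R :=
  ln (1 + expR (- x `^ (- alpha tau)) * (expR (- th * x `^ (- alpha tau)) - 1))
  + th * x `^ (- alpha tau) - th * x `^ (- 2 * alpha tau).

(* For 3 < tau < 4 the integrand is Lebesgue integrable for every real th, so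
   the default value of the real-valued integral is never used. *)
Definition Lambda tau th : R :=
  \int[lebesgue_measure]_(x in `]0, +oo[) f_ tau x th.

(* Lambda is strictly convex when 3 < tau < 4, so at most one th satisfies
   this; uniqueness is a consequence, not part of the definition. *)
Definition is_theta_star tau th : Prop :=
  0 < th /\ forall th' : R, Lambda tau th <= Lambda tau th'.

Definition I_E tau theta p : R :=
  (tau - 1) *
  \int[lebesgue_measure]_(v in `]0, +oo[)
    ((expR (theta * v) * (1 - expR (- (p * v))) /
       (expR (theta * v) * (1 - expR (- v)) + expR (- v)) - p * v) /
     v `^ (tau - 1)).

End constants.

Section probability_notions.
Context {d : measure_display} {Omega : measurableType d} {R : realType}.
Variable P : probability Omega R.

Definition exponential_rv (X : {RV P >-> R}) : Prop :=
  exists2 r : R, 0 < r &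
    forall A : set R, measurable A -> distribution P X A = exponential_prob r A.

(* Mutual independence of the subfamily indexed by D. *)
Definition independent_rvs (D : set nat) (X : nat -> {RV P >-> R}) : Prop :=
  forall (J : seq nat) (B : nat -> set R),
    uniq J -> (forall i, i \in J -> D i) -> (forall i, measurable (B i)) ->
    P (\bigcap_(i in [set` J]) (X i @^-1` B i)) =
    (\prod_(i <- J) P (X i @^-1` B i))%E.

(* Omega is not assumed complete, and events that depend on a whole path of a
   process defined by an almost surely convergent series need only be
   measurable up to a P-null set.  The outer measure P^* extends P and is the
   completion of P on such events. *)
Definition cond_prob (A B : set Omega) : R :=
  fine ((P^*)%mu (A `&` B)) / fine ((P^*)%mu B).

Lemma cond_probE (A B : set Omega) : measurable A -> measurable B ->
  cond_prob A B = fine (P (A `&` B)) / fine (P B).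
Proof.
move=> mA mB; rewrite /cond_prob !measurable_mu_extE//.
exact: measurableI.
Qed.

End probability_notions.

Section process.
Context {R : realType} {Omega : Type}.
Variables (tau beta : R) (T : nat -> Omega -> R).

(* The series converges only conditionally: the sum is the limit of the partial
   sums over 2 <= i < n as n tends to infinity. For the T used in the theorem,
   outside a null set this limit exists for all t >= 0 simultaneously. *)
Definition S_proc (t : R) (w : Omega) : R :=
  1 + beta * t +
  limn (fun n : nat =>
    \sum_(2 <= i < n) c_ tau i * ((T i w <= t)%R%:R - c_ tau i * t)).

Definition H1 (w : Omega) : \bar R :=
  ereal_inf [set t%:E | t in [set t : R | 0 <= t /\ S_proc t w = 0]].

End process.

(* Main.v *)
Require Import Defs.
From HB Require Import structures.
From mathcomp Require Import all_boot all_order all_algebra.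
From mathcomp Require Import all_classical all_reals all_analysis.
From mathcomp Require Import measurable_realfun ring lra zify.

(** Survival up to time u has probability about exp (u^(tau-1) Lambda(theta)), and
    the path in the theorem is the one that the cheapest way of surviving imposes.

    Put v_i = u c_i.  Up to the terms u + beta p u^2, which are of lower order
    because tau > 3, the process u S at time p u is the compensated sum
    Y(p) = sum_i v_i (1(T_i <= p u) - p v_i).  As v_i is the value of
    x |-> x^(-alpha) at i / u^(tau-1), a sum over i of a function of v_i is
    u^(tau-1) times a Riemann sum ([riemann_jump]).  Tilt the law by the density
    exp (th Y(1)).  Its total mass is exp (u^(tau-1) Lambda(th)) to leading order,
    because the integrand of Lambda is the log-moment of one clock; and under the
    tilted law the mean of Y(p) is u^(tau-1) I_E(p) to leading order, with theta
    replaced by th ([I_E_drift_int]).  At p = 1 this is the derivative of Lambda at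
    th, so the minimality of theta says that the limit path ends at 0
    ([drift_int_theta_star]).

    Upper bound ([upper_bound]).  The process has no downward jumps, so if it
    survives, Y(1) is at least - o(u^(tau-1)) ([survival_end_ge0]).  There the
    density for th = theta is at least exp (- o(u^(tau-1))), so the probability
    of surviving and of straying from I_E is at most exp (u^(tau-1) Lambda(theta))
    times the tilted probability of straying, up to exp (o(u^(tau-1))).  The
    latter is exponentially small at speed u^(tau-1), by exponential moments at
    the times of a finite grid ([integral_grid_excess_le], [jump_sum_near_drift]).

    Lower bound ([lower_bound]).  Tilt by slightly more than theta.  The tilted path
    is concave and ends above 0, so it is positive, but near time 0 it does not
    dominate the fluctuations.  The clocks of index at most eta u^(tau-1), for a
    small eta, are therefore forced to ring early, which costs an arbitrarily
    small part of the exponent ([forced_path_positive], [forced_mass_ge]).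

    Only finitely many clocks are tilted, those of index at most K u^(tau-1).  The
    others are treated by dyadic blocks, with a tilt adapted to each block
    ([tail_control]); this yields the convergence of the series as well, uniformly
    in p.  The tilted law is not constructed: all estimates are integrals against
    its density [weight], computed by independence ([integral_weight_exp]).

    Both bounds concern measurable events, one contained in survival and the other
    containing survival off the path; their ratio is exponentially small, which
    gives the claim for the outer measure ([cond_prob_near1]). *)

Set Implicit Arguments.
Unset Strict Implicit.
Unset Printing Implicit Defensive.
Import Order.TTheory GRing.Theory Num.Theory.
Import numFieldNormedType.Exports.

Local Open Scope classical_set_scope.
Local Open Scope ring_scope.

(** * Tilting a single exponential clock *)

Section exponential_inequalities.
Context {R : realType}.
Implicit Types (q y v p th x : R).

(** Convexity of the exponential: for a Bernoulli variable of mean [q], Jensen's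
    inequality for the exponential moment at [y]. *)
Lemma expR_mul_le_mix q y : 0 <= q <= 1 ->
  expR (q * y) <= 1 + q * (expR y - 1).
Proof.
move=> /andP[q0 q1].
have h1 : 1 + (1 - q) * y <= expR ((1 - q) * y) by exact: expR_ge1Dx.
have h2 : 1 + (- (q * y)) <= expR (- (q * y)) by exact: expR_ge1Dx.
have E0 := expR_ge0 (q * y).
have -> : expR y = expR (q * y) * expR ((1 - q) * y).
  by rewrite -expRD; congr expR; ring.
have E1 : expR (q * y) * expR (- (q * y)) = 1 by rewrite -expRD subrr expR0.
set E := expR (q * y) in E0 E1 *.
have h3 : q * (E * (1 + (1 - q) * y)) <= q * (E * expR ((1 - q) * y)).
  by rewrite !ler_wpM2l.
have h4 : (1 - q) * (E * (1 - q * y)) <= (1 - q) * 1.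
  rewrite ler_wpM2l ?subr_ge0//.
  by rewrite -[leRHS]E1 ler_wpM2l.
move: h3 h4; lra.
Qed.

Lemma expR_le_quad y : y <= 2^-1 -> expR y <= 1 + y + 2 * y ^+ 2.
Proof.
move=> yh.
have h : 1 - y <= expR (- y) by exact: expR_ge1Dx.
have E0 := expR_ge0 y.
have E1 : expR y * expR (- y) = 1 by rewrite -expRD subrr expR0.
have h2 : expR y * (1 - y) <= 1 by rewrite -[leRHS]E1 ler_wpM2l.
have h3 : (1 + y + 2 * y ^+ 2) * (1 - y) >= 1.
  have : 0 <= y ^+ 2 * (1 - 2 * y) by rewrite mulr_ge0 ?sqr_ge0//; lra.
  lra.
have y1 : 0 < 1 - y by lra.
by rewrite -(ler_pM2r y1); apply: le_trans h3.
Qed.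

(** The second-order term keeps the factor [q]: for a jump of size [v], [q] is of
    order [v] and [y] of order [v], so that the error is of third order. *)
Lemma mix_le_expR q y : 0 <= q <= 1 -> `|y| <= 2^-1 ->
  1 + q * (expR y - 1) <= expR (q * y + 2 * q * y ^+ 2).
Proof.
move=> /andP[q0 q1]; rewrite ler_norml => /andP[_ yh].
have h : q * (expR y - 1) <= q * (y + 2 * y ^+ 2).
  by rewrite ler_wpM2l// lerBlDl addrA expR_le_quad.
have := expR_ge1Dx (q * y + 2 * q * y ^+ 2).
lra.
Qed.

(** For large [y] the trivial bound by [expR y] is already enough.  There is no
    factor [q] in the error; it serves the jumps larger than 1, for which [q] is
    not small. *)
Lemma mix_le_expR_sq q y : 0 <= q <= 1 ->
  1 + q * (expR y - 1) <= expR (q * y + 2 * y ^+ 2).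
Proof.
move=> /andP[q0 q1]; have y2 := sqr_ge0 y.
have [yh|yh] := lerP y 2^-1.
  have h : q * (expR y - 1) <= q * (y + 2 * y ^+ 2).
    by rewrite ler_wpM2l// lerBlDl addrA expR_le_quad.
  have := expR_ge1Dx (q * y + 2 * y ^+ 2).
  have : q * (2 * y ^+ 2) <= 1 * (2 * y ^+ 2) by rewrite ler_wpM2r//; lra.
  lra.
have e1 : 1 <= expR y by rewrite -expR0 ler_expR; lra.
apply: (@le_trans _ _ (expR y)).
  have : q * (expR y - 1) <= 1 * (expR y - 1) by rewrite ler_wpM2r//; lra.
  lra.
have : 0 <= q * y by rewrite mulr_ge0//; lra.
rewrite ler_expR; have : 0 <= y * (2 * y - 1) by rewrite mulr_ge0//; lra.
lra.
Qed.

Lemma onem_expRN_ge x : 0 <= x -> x * (1 - x) <= 1 - expR (- x).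
Proof.
move=> x0; have h := expR_ge1Dx x; have E0 := expR_gt0 (- x).
have E1 : expR x * expR (- x) = 1 by rewrite -expRD subrr expR0.
have h2 : (1 + x) * expR (- x) <= 1 by rewrite -[leRHS]E1 ler_wpM2r// ltW.
have x1 : 0 < 1 + x by lra.
rewrite -(ler_pM2r x1).
have : 0 <= x ^+ 3 by rewrite exprn_ge0.
lra.
Qed.

Lemma onem_expRN_le x : 1 - expR (- x) <= x.
Proof. by have := expR_ge1Dx (- x); lra. Qed.

Lemma onem_expRN_ge_half x : 1 <= x -> 2^-1 <= 1 - expR (- x).
Proof.
move=> x1; have h := expR_ge1Dx x; have E0 := expR_gt0 (- x).
have E1 : expR x * expR (- x) = 1 by rewrite -expRD subrr expR0.
have h2 : (1 + x) * expR (- x) <= 1 by rewrite -[leRHS]E1 ler_wpM2r// ltW.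
have : 2 * expR (- x) <= (1 + x) * expR (- x) by rewrite ler_wpM2r ?(ltW E0)//; lra.
lra.
Qed.

Lemma expRB1_le x : expR x - 1 <= x * expR x.
Proof.
have h : 1 - x <= expR (- x) by exact: expR_ge1Dx.
have E1 : expR x * expR (- x) = 1 by rewrite -expRD subrr expR0.
have : expR x * (1 - x) <= 1 by rewrite -[leRHS]E1 ler_wpM2l// expR_ge0.
lra.
Qed.

End exponential_inequalities.

Section tilted_jump.
Context {R : realType}.
Implicit Types (q y v p th x lam : R).

(** Let X be exponential and v the product of its rate and of the time horizon u.
    Then [tilt_mass th v] is the mean of exp (th v 1(X <= u)), [tilt_cdf th p v]
    is the probability of X <= p u under the law with this density (normalised),
    [tilt_drift th p v] is the mean, under that law, of the compensated jump
    v (1(X <= p u) - p v), and [tilt_rate th v] is the logarithm of the mean of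
    the exponential of th times the compensated jump at p = 1. *)
Definition tilt_mass th v := expR (th * v) * (1 - expR (- v)) + expR (- v).

Definition tilt_cdf th p v :=
  expR (th * v) * (1 - expR (- (p * v))) / tilt_mass th v.

Definition tilt_drift th p v := v * (tilt_cdf th p v - p * v).

Definition tilt_rate th v := ln (tilt_mass th v) - th * v ^+ 2.

(** The common order of magnitude of the drifts and rates: third order for
    v <= 1, where a jump of size v occurs with probability of order v and its
    first-order effect is compensated; second order for v >= 1. *)
Definition min23 v := Num.min (v ^+ 2) (v ^+ 3).

Lemma min23_ge0 v : 0 <= v -> 0 <= min23 v.
Proof. by move=> v0; rewrite /min23 le_min !exprn_ge0. Qed.

Lemma min23_lt1 v : 0 <= v -> v <= 1 -> min23 v = v ^+ 3.
Proof.
move=> v0 v1; rewrite /min23 min_r//; have := sqr_ge0 v; rewrite exprS => v2.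
by rewrite ler_piMl.
Qed.

Lemma min23_ge1 v : 1 <= v -> min23 v = v ^+ 2.
Proof.
move=> v1; rewrite /min23 min_l//; have := sqr_ge0 v; rewrite [leRHS]exprS => v2.
by rewrite ler_peMl.
Qed.

Lemma expRN_le1 v : 0 <= v -> expR (- v) <= 1.
Proof. by move=> v0; rewrite -expR0 ler_expR oppr_le0. Qed.

Lemma expRN_lt1 v : 0 < v -> expR (- v) < 1.
Proof. by move=> v0; rewrite -expR0 ltr_expR oppr_lt0. Qed.

Lemma tilt_mass_ge1 th v : 0 <= th -> 0 <= v -> 1 <= tilt_mass th v.
Proof.
move=> th0 v0; have h1 := expRN_le1 v0; rewrite /tilt_mass.
have h2 : 1 <= expR (th * v) by rewrite -expR0 ler_expR mulr_ge0.
have : 0 <= (expR (th * v) - 1) * (1 - expR (- v)) by rewrite mulr_ge0// subr_ge0.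
lra.
Qed.

Lemma tilt_mass_gt0 th v : 0 <= v -> 0 < tilt_mass th v.
Proof.
move=> v0; have h1 := expRN_le1 v0; rewrite /tilt_mass.
have : 0 <= expR (th * v) * (1 - expR (- v)).
  by rewrite mulr_ge0 ?expR_ge0// subr_ge0.
have := expR_gt0 (- v); lra.
Qed.

Lemma tilt_mass_le th v : 0 <= th -> 0 <= v -> tilt_mass th v <= expR (th * v).
Proof.
move=> th0 v0; rewrite /tilt_mass.
have h2 : 1 <= expR (th * v) by rewrite -expR0 ler_expR mulr_ge0.
have : 0 <= (expR (th * v) - 1) * expR (- v) by rewrite mulr_ge0 ?expR_ge0// subr_ge0.
lra.
Qed.

Lemma tilt_cdf_ge0 th p v : 0 <= p -> 0 <= v -> 0 <= tilt_cdf th p v.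
Proof.
move=> p0 v0; rewrite /tilt_cdf mulr_ge0 ?invr_ge0 ?(ltW (tilt_mass_gt0 _ _))//.
by rewrite mulr_ge0 ?expR_ge0// subr_ge0 expRN_le1// mulr_ge0.
Qed.

Lemma tilt_cdf_le1 th p v : 0 <= p <= 1 -> 0 <= v -> tilt_cdf th p v <= 1.
Proof.
move=> /andP[p0 p1] v0; rewrite /tilt_cdf ler_pdivrMr ?tilt_mass_gt0// mul1r.
rewrite /tilt_mass.
have : expR (th * v) * (1 - expR (- (p * v))) <= expR (th * v) * (1 - expR (- v)).
  by rewrite ler_wpM2l ?expR_ge0// lerD2l lerN2 ler_expR lerN2 ler_piMl.
have := expR_ge0 (- v); lra.
Qed.

Lemma tilt_cdf_range th p v : 0 <= p <= 1 -> 0 <= v ->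
  0 <= tilt_cdf th p v <= 1.
Proof. by move=> /[dup]/andP[? ?] ? ?; rewrite tilt_cdf_ge0// tilt_cdf_le1. Qed.

Lemma tilt_cdf_le th p v : 0 <= th -> 0 <= p -> 0 <= v <= 1 ->
  tilt_cdf th p v <= expR (th * v) * (p * v).
Proof.
move=> th0 p0 /andP[v0 v1]; rewrite /tilt_cdf.
have Z1 := tilt_mass_ge1 th0 v0.
rewrite ler_pdivrMr ?tilt_mass_gt0//.
apply: (@le_trans _ _ (expR (th * v) * (p * v))).
  by rewrite ler_wpM2l ?expR_ge0// onem_expRN_le.
by rewrite ler_peMr// mulr_ge0 ?expR_ge0// mulr_ge0.
Qed.

Lemma tilt_cdf_le_linear th p v : 0 <= th -> 0 <= p -> 0 <= v <= 1 ->
  tilt_cdf th p v <= expR th * (p * v).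
Proof.
move=> th0 p0 /[dup] v01 /andP[v0 v1]; apply: le_trans (tilt_cdf_le th0 p0 v01) _.
by rewrite ler_wpM2r ?mulr_ge0// ler_expR ler_piMr.
Qed.

Lemma tilt_cdf_le_far th p v : 0 <= th -> 0 <= p -> 1 <= v ->
  tilt_cdf th p v <= 2 * (p * v).
Proof.
move=> th0 p0 v1; rewrite /tilt_cdf; have v0 : 0 <= v by lra.
rewrite ler_pdivrMr ?tilt_mass_gt0//.
have h : expR (th * v) <= 2 * tilt_mass th v.
  rewrite /tilt_mass; have := onem_expRN_ge_half v1; have := expR_ge0 (- v).
  move=> h1 h2.
  have : expR (th * v) * 2^-1 <= expR (th * v) * (1 - expR (- v)).
    by rewrite ler_wpM2l ?expR_ge0.
  lra.
apply: (@le_trans _ _ (expR (th * v) * (p * v))).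
  by rewrite ler_wpM2l ?expR_ge0// onem_expRN_le.
by rewrite mulrAC; rewrite ler_wpM2r// mulr_ge0.
Qed.

Lemma tilt_cdf_ge th p v : 0 <= th -> 0 <= p -> 0 <= v ->
  1 - expR (- (p * v)) <= tilt_cdf th p v.
Proof.
move=> th0 p0 v0; rewrite /tilt_cdf ler_pdivlMr ?tilt_mass_gt0// mulrC.
by rewrite ler_wpM2r ?tilt_mass_le// subr_ge0 expRN_le1// mulr_ge0.
Qed.

Definition drift_cst th := 1 + (1 + th) * expR th.

Lemma drift_cst_ge1 th : 0 <= th -> 1 <= drift_cst th.
Proof.
by move=> th0; rewrite /drift_cst lerDl mulr_ge0 ?expR_ge0//; lra.
Qed.

(** For v <= 1 the tilted probability is p v + O(p v^2), hence a drift O(p v^3);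
    for v >= 1 it is O(p v), hence O(p v^2).  The factor [p] matters because the
    Lipschitz estimate applies this bound to the length of a time interval. *)
Lemma norm_tilt_drift_le th p v : 0 <= th -> 0 <= p <= 1 -> 0 <= v ->
  `|tilt_drift th p v| <= drift_cst th * p * min23 v.
Proof.
move=> th0 /andP[p0 p1] v0; rewrite /tilt_drift normrM ger0_norm//.
have C1 := drift_cst_ge1 th0.
have [v1|v1] := lerP v 1.
- rewrite min23_lt1// exprS mulrCA ler_wpM2l//.
  have v01 : 0 <= v <= 1 by rewrite v0.
  have h1 := tilt_cdf_le th0 p0 v01; have h2 := tilt_cdf_ge th0 p0 v0.
  have pv0 : 0 <= p * v by rewrite mulr_ge0.
  have h3 := onem_expRN_ge pv0.
  have h4 : expR (th * v) - 1 <= v * (th * expR th).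
    apply: le_trans (expRB1_le _) _.
    rewrite mulrAC mulrC ler_wpM2l// ler_wpM2l// ler_expR ler_piMr//.
  have h5 : expR (th * v) * (p * v) <= (1 + v * (th * expR th)) * (p * v).
    by rewrite ler_wpM2r//; lra.
  have pv2 : 0 <= p * v ^+ 2 by rewrite mulr_ge0// sqr_ge0.
  have h6 : p * v * (p * v) <= p * v ^+ 2.
    have : p * (p * v ^+ 2) <= 1 * (p * v ^+ 2) by rewrite ler_wpM2r.
    lra.
  have h7 : 1 * (p * v ^+ 2) <= drift_cst th * (p * v ^+ 2) by rewrite ler_wpM2r.
  have h8 : th * expR th * (p * v ^+ 2) <= drift_cst th * (p * v ^+ 2).
    by rewrite ler_wpM2r// /drift_cst; have := expR_ge0 th; lra.
  rewrite ler_norml; apply/andP; split; lra.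
- rewrite min23_ge1 ?(ltW v1)// expr2 mulrA (mulrC (drift_cst th * p * v)) ler_wpM2l//.
  have h1 := tilt_cdf_le_far th0 p0 (ltW v1).
  have h2 := tilt_cdf_ge0 th p0 v0.
  have pv0 : 0 <= p * v by rewrite mulr_ge0.
  have : 1 * (p * v) <= drift_cst th * (p * v) by rewrite ler_wpM2r.
  by rewrite ler_norml => ?; apply/andP; split; lra.
Qed.

(** The tilt acts on each clock only through the event that it rings before the
    horizon, so the tilted law keeps the lack of memory before the horizon. *)
Lemma tilt_cdfB th p p' v :
  tilt_cdf th p' v - tilt_cdf th p v =
  expR (- (p * v)) * tilt_cdf th (p' - p) v.
Proof.
rewrite /tilt_cdf -mulrBl mulrA; congr (_ / _).
rewrite mulrCA -mulrBr; congr (_ * _).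
rewrite mulrBr mulr1 -expRD (_ : - (p * v) + - ((p' - p) * v) = - (p' * v)); last by ring.
ring.
Qed.

Lemma tilt_drift_lipschitz th p p' v : 0 <= th -> 0 <= p <= p' -> p' <= 1 ->
  0 <= v ->
  `|tilt_drift th p' v - tilt_drift th p v|
     <= 2 * drift_cst th * (p' - p) * min23 v.
Proof.
move=> th0 /andP[p0 pp'] p'1 v0; set dl := p' - p.
have dl01 : 0 <= dl <= 1 by rewrite /dl; lra.
have dl0 : 0 <= dl by case/andP: dl01.
have C1 := drift_cst_ge1 th0.
have pv0 : 0 <= p * v by rewrite mulr_ge0.
have -> : tilt_drift th p' v - tilt_drift th p v =
    tilt_drift th dl v - v * ((1 - expR (- (p * v))) * tilt_cdf th dl v).
  rewrite /tilt_drift; have := tilt_cdfB th p p' v; rewrite -/dl => h.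
  have -> : tilt_cdf th p' v =
     tilt_cdf th p v + expR (- (p * v)) * tilt_cdf th dl v by rewrite -h; ring.
  rewrite /dl; ring.
have h1 := norm_tilt_drift_le th0 dl01 v0.
apply: le_trans (ler_normB _ _) _.
suff h2 : `|v * ((1 - expR (- (p * v))) * tilt_cdf th dl v)|
    <= drift_cst th * dl * min23 v by lra.
rewrite normrM (ger0_norm v0) ger0_norm; last first.
  by rewrite mulr_ge0 ?tilt_cdf_ge0// subr_ge0 expRN_le1.
have h3 := onem_expRN_le (p * v); have h4 : 0 <= 1 - expR (- (p * v)).
  by rewrite subr_ge0 expRN_le1.
have h5 := tilt_cdf_ge0 th dl0 v0.
have [v1|v1] := lerP v 1.
- rewrite min23_lt1// exprS [leRHS]mulrCA ler_wpM2l//.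
  have h6 : tilt_cdf th dl v <= expR th * (dl * v).
    by rewrite tilt_cdf_le_linear// v0.
  apply: (@le_trans _ _ (v * (expR th * (dl * v)))).
    apply: ler_pM => //; apply: le_trans h3 _; rewrite ler_piMl//; lra.
  rewrite (_ : _ * _ = expR th * (dl * v ^+ 2)); last by ring.
  rewrite -mulrA ler_wpM2r ?mulr_ge0 ?sqr_ge0// /drift_cst.
  have := expR_ge0 th; have : 0 <= th * expR th by rewrite mulr_ge0 ?expR_ge0.
  lra.
- rewrite min23_ge1 ?(ltW v1)// expr2 mulrA (mulrC (drift_cst th * dl * v)) ler_wpM2l//.
  have h6 := tilt_cdf_le_far th0 dl0 (ltW v1).
  have h7 : (1 - expR (- (p * v))) * tilt_cdf th dl v <= 1 * (2 * (dl * v)).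
    by apply: ler_pM => //; have := expR_ge0 (- (p * v)); lra.
  apply: le_trans h7 _; rewrite mul1r -mulrA ler_wpM2r ?mulr_ge0// /drift_cst.
  have : 1 <= expR th by rewrite -expR0 ler_expR.
  have : 0 <= th * expR th by rewrite mulr_ge0 ?expR_ge0.
  lra.
Qed.

(** The drift is concave in [p] and vanishes at 0: it lies above its chord.  This
    is what keeps the tilted path positive on the whole of [0, 1] once its
    endpoint is positive. *)
Lemma tilt_drift_concave th p v : 0 <= p <= 1 -> 0 <= v ->
  p * tilt_drift th 1 v <= tilt_drift th p v.
Proof.
move=> p01 v0; rewrite /tilt_drift mulrCA ler_wpM2l// mulrBr mul1r lerD2r.
rewrite /tilt_cdf mul1r mulrA ler_wpM2r ?invr_ge0 ?(ltW (tilt_mass_gt0 _ _))//.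
rewrite mulrCA ler_wpM2l ?expR_ge0//.
by have := expR_mul_le_mix (- v) p01; rewrite mulrN; lra.
Qed.

(** Tilting twice is tilting once by the sum. *)
Lemma tilt_massD th lam v : 0 <= v ->
  tilt_mass (th + lam) v =
  tilt_mass th v * (1 + tilt_cdf th 1 v * (expR (lam * v) - 1)).
Proof.
move=> v0; have Z0 := lt0r_neq0 (tilt_mass_gt0 th v0).
rewrite /tilt_cdf mul1r; set A := expR _ * _; set B := expR (lam * v) - 1.
have -> : tilt_mass th v * (1 + A / tilt_mass th v * B) = tilt_mass th v + A * B.
  by field.
rewrite /tilt_mass /A /B mulrDl expRD; ring.
Qed.

(** The rate is convex in [th], with derivative [tilt_drift th 1]. *)
Lemma tilt_rate_tangent th lam v : 0 <= v ->
  tilt_rate th v + lam * tilt_drift th 1 v <= tilt_rate (th + lam) v.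
Proof.
move=> v0; have Z0 := tilt_mass_gt0 th v0.
rewrite /tilt_rate /tilt_drift mul1r tilt_massD//.
have q01 : 0 <= tilt_cdf th 1 v <= 1 by rewrite tilt_cdf_range// ler01/=.
have h := expR_mul_le_mix (lam * v) q01.
have h0 : 0 < 1 + tilt_cdf th 1 v * (expR (lam * v) - 1).
  exact: lt_le_trans (expR_gt0 _) h.
rewrite lnM ?posrE//.
have : tilt_cdf th 1 v * (lam * v) <= ln (1 + tilt_cdf th 1 v * (expR (lam * v) - 1)).
  by rewrite -[leLHS]expRK ler_ln ?posrE ?expR_gt0.
lra.
Qed.

(** The two bounds on a Bernoulli moment are combined: the one with the factor
    [q] for v <= 1, where [q] is at most [expR th * v], the other for v >= 1. *)
Lemma tilt_mix_le th p lam v : 0 <= th -> 0 <= p <= 1 -> 0 <= v ->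
  `|lam| <= 2^-1 ->
  1 + tilt_cdf th p v * (expR (lam * v) - 1) <=
  expR (lam * v * tilt_cdf th p v + 2 * expR th * lam ^+ 2 * min23 v).
Proof.
move=> th0 p01 v0 lamh; have q01 := tilt_cdf_range th p01 v0.
have [p0 p1] := andP p01.
have [v1|v1] := lerP v 1.
- apply: le_trans (mix_le_expR q01 _) _.
    by rewrite normrM (ger0_norm v0); apply: le_trans lamh; rewrite ler_piMr.
  rewrite ler_expR min23_lt1// mulrC lerD2l exprMn.
  have : tilt_cdf th p v <= expR th * (p * v).
    by rewrite tilt_cdf_le_linear// v0.
  have h : expR th * (p * v) <= expR th * v.
    by rewrite ler_wpM2l ?expR_ge0// ler_piMl.
  move=> /le_trans /(_ h) h2.
  have : 2 * (lam ^+ 2 * v ^+ 2) * tilt_cdf th p v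
      <= 2 * (lam ^+ 2 * v ^+ 2) * (expR th * v).
    by rewrite ler_wpM2l// mulr_ge0// mulr_ge0 ?sqr_ge0.
  lra.
- apply: le_trans (mix_le_expR_sq _ q01) _.
  rewrite ler_expR min23_ge1 ?(ltW v1)// mulrC lerD2l exprMn.
  have : 0 <= (expR th - 1) * (2 * (lam ^+ 2 * v ^+ 2)).
    rewrite mulr_ge0 ?subr_ge0//; first by rewrite -expR0 ler_expR.
    by rewrite mulr_ge0// mulr_ge0 ?sqr_ge0.
  lra.
Qed.

Lemma tilt_rate_quad th lam v : 0 <= th -> `|lam| <= 2^-1 -> 0 <= v ->
  tilt_rate (th + lam) v <=
  tilt_rate th v + lam * tilt_drift th 1 v + 2 * expR th * lam ^+ 2 * min23 v.
Proof.
move=> th0 lamh v0; have Z0 := tilt_mass_gt0 th v0.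
have p01 : 0 <= (1 : R) <= 1 by rewrite ler01/=.
rewrite /tilt_rate /tilt_drift mul1r tilt_massD//.
have h := tilt_mix_le th0 p01 v0 lamh.
have h0 : 0 < 1 + tilt_cdf th 1 v * (expR (lam * v) - 1).
  have := tilt_mass_gt0 (th + lam) v0; rewrite tilt_massD//.
  by rewrite pmulr_rgt0.
rewrite lnM ?posrE//.
have : ln (1 + tilt_cdf th 1 v * (expR (lam * v) - 1)) <=
   lam * v * tilt_cdf th 1 v + 2 * expR th * lam ^+ 2 * min23 v.
  by rewrite -[leRHS]expRK ler_ln ?posrE ?expR_gt0.
lra.
Qed.

Lemma tilt_rate0 v : tilt_rate 0 v = 0.
Proof.
by rewrite /tilt_rate /tilt_mass !mul0r expR0 mul1r subrK ln1 subrr.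
Qed.

(** The rate vanishes at [th = 0] and is convex in [th]; the tangents at 0 and
    at [th] enclose it. *)
Lemma norm_tilt_rate_le th v : 0 <= th -> 0 <= v ->
  `|tilt_rate th v| <= th * (2 + drift_cst th) * min23 v.
Proof.
move=> th0 v0.
have p01 : 0 <= (1 : R) <= 1 by rewrite ler01/=.
have h1 := tilt_rate_tangent 0 th v0; have h2 := tilt_rate_tangent th (- th) v0.
rewrite add0r tilt_rate0 add0r in h1; rewrite subrr tilt_rate0 in h2.
have h3 := norm_tilt_drift_le (lexx (0:R)) p01 v0.
have h4 := norm_tilt_drift_le th0 p01 v0.
rewrite {1}/drift_cst expR0 !mulr1 addr0 in h3; rewrite mulr1 in h4.
have m0 := min23_ge0 v0; have C1 := drift_cst_ge1 th0.
move: h3 h4; rewrite !ler_norml => /andP[h3 _] /andP[_ h4].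
have h5 : th * (- ((1 + 1) * min23 v)) <= th * tilt_drift 0 1 v by rewrite ler_wpM2l.
have h6 : th * tilt_drift th 1 v <= th * (drift_cst th * min23 v) by rewrite ler_wpM2l.
have h7 : 0 <= th * min23 v by rewrite mulr_ge0.
have h8 : 0 <= th * (drift_cst th * min23 v) by rewrite !mulr_ge0//; lra.
apply/andP; split; lra.
Qed.

Lemma tilt_drift_lt th th' v : th < th' -> 0 < v ->
  tilt_drift th 1 v < tilt_drift th' 1 v.
Proof.
move=> thth' v0; rewrite /tilt_drift ltr_pM2l// ltrD2r /tilt_cdf mul1r.
have Z := tilt_mass_gt0 th (ltW v0); have Z' := tilt_mass_gt0 th' (ltW v0).
rewrite ltr_pdivrMr// mulrAC ltr_pdivlMr//.
rewrite /tilt_mass; have h1 := expRN_lt1 v0; have h2 := expR_gt0 (- v).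
have h3 : expR (th * v) < expR (th' * v) by rewrite ltr_expR ltr_pM2r.
have : 0 < (expR (th' * v) - expR (th * v)) * (1 - expR (- v)) * expR (- v).
  by rewrite !mulr_gt0// subr_gt0.
lra.
Qed.

End tilted_jump.

(** * Independent exponential clocks *)

Section exponential_law.
Context {d : measure_display} {Omega : measurableType d} {R : realType}.
Variable P : probability Omega R.
Local Open Scope ereal_scope.

Lemma exponential_prob_itvNyc (rate t : R) : (0 < rate)%R -> (0 <= t)%R ->
  exponential_prob rate `]-oo, t] = (1 - expR (- rate * t))%:E.
Proof.
move=> r0 t0.
have -> : `]-oo, t]%classic = `]-oo, 0%R[%classic `|` `[0%R, t]%classic.
  by rewrite -itv_bndbnd_setU// bnd_simp.
rewrite /exponential_prob ge0_integral_setU//=; last 3 first.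
- apply/measurable_EFinP/measurable_funTS; exact: measurable_exponential_pdf.
- by move=> x _; rewrite lee_fin exponential_pdf_ge0// ltW.
- by apply: lt_disjoint => x y /=; rewrite !in_itv/= => x0 /andP[+ _];
    apply: lt_le_trans.
rewrite [X in X + _]integral0_eq ?add0e; last first.
  by move=> x /=; rewrite in_itv/= => x0; rewrite lt0_exponential_pdf.
move: t0; rewrite le_eqVlt => /predU1P[<-|t0].
  by rewrite set_itv1 integral_set1 mulr0 expR0 subrr.
by have := exponential_prob_itv0c rate t0; rewrite /exponential_prob => ->.
Qed.

Lemma integral_expRN_itv (rate : R) : (0 < rate)%R ->
  \int[lebesgue_measure]_(t in `[0%R, +oo[) (expR (- rate * t))%:E
  = (rate^-1)%:E.
Proof.
move=> r0.
have -> : (rate^-1)%:E = (rate^-1)%:E * \int[lebesgue_measure]_(t in `[0%R, +oo[)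
    (exponential_pdf rate t)%:E.
  rewrite integral_mkcond -[LHS]mule1 -(integral_exponential_pdf r0); congr (_ * _).
  apply: eq_integral => x _; rewrite !patchE; case: ifPn => // xN.
  rewrite /exponential_pdf patchE ifF//; exact/negbTE.
rewrite -ge0_integralZl//=; last 3 first.
- apply/measurable_EFinP/measurable_funTS; exact: measurable_exponential_pdf.
- by move=> x _; rewrite lee_fin exponential_pdf_ge0// ltW.
- by rewrite lee_fin invr_ge0 ltW.
apply: eq_integral => x; rewrite inE/= in_itv/= andbT => x0.
by rewrite exponential_pdfE// -EFinM mulKf// gt_eqF.
Qed.

(** The mean determines the rate: the variable is almost surely nonnegative, so
    its mean is the integral of its survival function. *)
Lemma exponential_rv_cdf (X : {RV P >-> R}) (m t : R) : (0 < m)%R ->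
  exponential_rv X -> 'E_P[X] = m%:E -> (0 <= t)%R ->
  P [set w | (X w <= t)%R] = (1 - expR (- (t / m)))%:E.
Proof.
move=> m0 [r r0 XE] EX t0.
have cdfE s : (0 <= s)%R -> P [set w | (X w <= s)%R] = (1 - expR (- r * s))%:E.
  move=> s0; rewrite -exponential_prob_itvNyc//.
  by rewrite -XE//; rewrite /distribution/= /pushforward/=.
suff -> : (m = r^-1)%R by rewrite invrK cdfE// mulNr mulrC.
apply: EFin_inj; rewrite -EX -integral_expRN_itv//.
(* X agrees almost surely with its positive part *)
pose Y : {RV P >-> R} := (X^\+)%R.
have YE w : Y w = Num.max (X w) 0%R by [].
have -> : 'E_P[X] = 'E_P[Y].
  rewrite !expectation_def; apply: ae_eq_integral => //.
  - exact/measurable_EFinP.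
  - exact/measurable_EFinP.
  exists [set w | (X w < 0)%R]; split.
  - rewrite (_ : [set w | _] = X @^-1` `]-oo, 0%R[%classic); last first.
      by apply/seteqP; split => w /=; rewrite in_itv.
    by rewrite -[X in measurable X]setTI; apply: measurable_funP.
  - rewrite (_ : [set w | _] = X @^-1` `]-oo, 0%R[%classic); last first.
      by apply/seteqP; split => w /=; rewrite in_itv.
    have := XE `]-oo, 0%R[%classic; rewrite /distribution/= /pushforward/= => -> //.
    rewrite /exponential_prob integral0_eq// => x /=; rewrite in_itv/= => x0.
    by rewrite lt0_exponential_pdf.
  - move=> w /=; apply: contra_notP => /negP; rewrite -leNgt => Xw _.
    by rewrite YE max_l.
rewrite ge0_expectation_ccdf; last by move=> w; rewrite YE le_max lexx orbT.
apply: eq_integral => s; rewrite inE/= in_itv/= andbT => s0.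
rewrite ccdf_1_cdf /cdf /distribution/= /pushforward/=.
rewrite (_ : _ @^-1` _ = [set w | (X w <= s)%R]) ?cdfE//.
  by rewrite EFinB oppeB// addeA subee// add0e.
apply/seteqP; split => w /=; rewrite in_itv/= YE.
  by rewrite ge_max => /andP[].
by rewrite ge_max => ->.
Qed.

End exponential_law.

Section product_expectation.
Context {d : measure_display} {Omega : measurableType d} {R : realType}.
Variable P : probability Omega R.
Variable T : nat -> {RV P >-> R}.
Hypothesis hindep : independent_rvs [set i : nat | (2 <= i)%N] T.
Local Open Scope ereal_scope.

Definition step_fun (l : seq (R * set R)) (x : R) : R :=
  (\sum_(aB <- l) aB.1 * \1_(aB.2) x)%R.

Definition step_seq (l : seq (R * set R)) :=
  forall aB, aB \in l -> (0 <= aB.1)%R /\ measurable aB.2.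

Definition pr_rv (i : nat) (B : set R) : R := fine (P (T i @^-1` B)).

Lemma measurable_rv_preimage i B : measurable B -> measurable (T i @^-1` B).
Proof. by move=> mB; rewrite -[X in measurable X]setTI; apply: measurable_funP. Qed.

Lemma measurable_step_fun l : step_seq l -> measurable_fun setT (step_fun l).
Proof.
move=> hl; rewrite /step_fun; elim: l hl => [|aB l IH] hl.
  by under eq_fun do rewrite big_nil; exact: measurable_cst.
under eq_fun do rewrite big_cons; apply: measurable_funD.
  apply: measurable_funM => //.
  by apply: measurable_indic; have [] := hl aB (mem_head _ _).
by apply: IH => x xl; apply: hl; rewrite inE xl orbT.
Qed.

Lemma step_fun_ge0 l x : step_seq l -> (0 <= step_fun l x)%R.
Proof.
move=> hl; rewrite /step_fun big_seq; apply: sumr_ge0 => aB /hl[a0 _].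
by rewrite mulr_ge0.
Qed.

(** Independence speaks of preimages only.  The simple functions are expanded one
    after the other, each of their indicators joining the second product; the
    sequence [J'] holds the indices that have been expanded already. *)
Lemma integral_prod_step_indic (J J' : seq nat) (l : nat -> seq (R * set R))
    (B : nat -> set R) :
  uniq (J ++ J') -> {in J ++ J', forall i, (2 <= i)%N} ->
  (forall i, step_seq (l i)) -> (forall i, measurable (B i)) ->
  \int[P]_w ((\prod_(i <- J) step_fun (l i) (T i w)) *
             \prod_(i <- J') \1_(B i) (T i w))%:E =
  ((\prod_(i <- J) \sum_(aB <- l i) aB.1 * pr_rv i aB.2) *
   \prod_(i <- J') pr_rv i (B i))%:E.
Proof.
elim: J J' B => [|j J IH] J' B uJ J2 hl mB.
  rewrite big_nil mul1r.
  transitivity (\int[P]_w (\1_(\bigcap_(i in [set` J']) (T i @^-1` B i)) w)%:E).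
    apply: eq_integral => w _; rewrite big_nil mul1r; congr EFin.
    rewrite indicE; case: (boolP (w \in _)) => [|wN].
      rewrite inE => wJ; rewrite big_seq big1// => i iJ'.
      by rewrite indicE mem_set//; exact: wJ.
    apply/eqP; rewrite prodf_seq_eq0.
    move: wN; rewrite notin_setE => /existsNP[i /not_implyP[iJ' nB]].
    by apply/hasP; exists i => //=; rewrite indicE memNset.
  rewrite integral_indic// ?setIT; last first.
    by apply: bigcap_measurableType => i _; exact: measurable_rv_preimage.
  transitivity (\prod_(i <- J') P (T i @^-1` B i)); first exact: hindep.
  elim: (J') => [|i s IHs]; first by rewrite !big_nil.
  by rewrite !big_cons IHs EFinM /pr_rv fineK// fin_num_measure//;
    exact: measurable_rv_preimage.
have jN : j \notin J' by move: uJ => /=; rewrite mem_cat negb_or => /andP[/andP[]].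
pose Bj (C : set R) i := if i == j then C else B i.
have BjJ' (C : set R) (F : nat -> set R -> R) :
    (\prod_(i <- j :: J') F i (Bj C i) = F j C * \prod_(i <- J') F i (B i))%R.
  rewrite big_cons {1}/Bj eqxx; congr (_ * _)%R.
  rewrite big_seq [RHS]big_seq; apply: eq_bigr => i iJ'.
  by rewrite /Bj; case: eqP => // ij; move: jN; rewrite -ij iJ'.
transitivity (\int[P]_w (\sum_(aB <- l j) (aB.1)%:E *
    ((\prod_(i <- J) step_fun (l i) (T i w)) *
      \prod_(i <- j :: J') \1_(Bj aB.2 i) (T i w))%:E)).
  apply: eq_integral => w _.
  rewrite [RHS](_ : _ = (\sum_(aB <- l j) aB.1 *
    ((\prod_(i <- J) step_fun (l i) (T i w)) *
      \prod_(i <- j :: J') \1_(Bj aB.2 i) (T i w)))%R%:E); last by rewrite -sumEFin.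
  congr EFin.
  rewrite big_cons /step_fun -/(step_fun _ _) !mulr_suml; apply: eq_bigr => aB _.
  by rewrite (BjJ' _ (fun i C => \1_C (T i w))); ring.
have uJ' : uniq (J ++ j :: J') by rewrite -[j :: J']cat1s uniq_catCA.
have J2' : {in J ++ j :: J', forall i, (2 <= i)%N}.
  by move=> i iJ; apply: J2; move: iJ; rewrite cat_cons !mem_cat !inE mem_cat orbCA.
have mterm (C : nat -> set R) (mC : forall i, measurable (C i)) (K K' : seq nat) :
    measurable_fun setT (fun w => (\prod_(i <- K) step_fun (l i) (T i w)) *
      \prod_(i <- K') \1_(C i) (T i w))%R.
  apply: measurable_funM; apply: measurable_prod => i _.
    by apply: measurableT_comp => //; exact: measurable_step_fun.
  by apply: measurableT_comp => //; exact: measurable_indic.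
have mBj C : measurable C -> forall i, measurable (Bj C i).
  by move=> mC i; rewrite /Bj; case: ifP.
under eq_integral do rewrite (big_nth (0%R, set0)) big_mkord.
have hk (k : 'I_(size (l j))) : let aB := nth (0%R, set0) (l j) k in
  (0 <= aB.1)%R /\ measurable aB.2 by apply: hl; exact: mem_nth.
rewrite ge0_integral_sum//=; last 2 first.
- by move=> k; have [a0 mk] := hk k; apply: measurable_funeM;
    apply/measurable_EFinP; apply: mterm; exact: mBj.
- move=> k w _; have [a0 mk] := hk k; rewrite mule_ge0// lee_fin mulr_ge0//.
    by apply: prodr_ge0 => i _; exact: step_fun_ge0.
  by apply: prodr_ge0 => i _.
rewrite (eq_bigr (fun k : 'I_(size (l j)) => let aB := nth (0%R, set0) (l j) k in
    (aB.1 * ((\prod_(i <- J) \sum_(aB <- l i) aB.1 * pr_rv i aB.2) *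
    (pr_rv j aB.2 * \prod_(i <- J') pr_rv i (B i))))%:E)); last first.
  move=> k _; have [a0 mk] := hk k.
  rewrite ge0_integralZl//=; last 2 first.
  - by apply/measurable_EFinP; apply: mterm; exact: mBj.
  - move=> w _; rewrite lee_fin mulr_ge0//.
      by apply: prodr_ge0 => i _; exact: step_fun_ge0.
    by apply: prodr_ge0 => i _.
  - by rewrite IH//; [rewrite -EFinM BjJ'|exact: mBj].
rewrite sumEFin; congr EFin.
rewrite -(big_mkord xpredT (fun k => (nth (0%R, set0) (l j) k).1 *
   ((\prod_(i <- J) \sum_(aB <- l i) aB.1 * pr_rv i aB.2) *
    (pr_rv j (nth (0%R, set0) (l j) k).2 * \prod_(i <- J') pr_rv i (B i)))))%R.
rewrite -(big_nth (0%R, set0) xpredT (fun aB => aB.1 *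
   ((\prod_(i <- J) \sum_(aB <- l i) aB.1 * pr_rv i aB.2) *
    (pr_rv j aB.2 * \prod_(i <- J') pr_rv i (B i)))))%R.
rewrite big_cons -mulrA mulr_suml; apply: eq_bigr => aB _; ring.
Qed.


End product_expectation.

Section two_level_product.
Context {d : measure_display} {Omega : measurableType d} {R : realType}.
Variable P : probability Omega R.
Variables (tau : R) (T : nat -> {RV P >-> R}).
Hypothesis hexp : forall i : nat, (2 <= i)%N -> exponential_rv (T i).
Hypothesis hmean : forall i : nat, (2 <= i)%N ->
  ('E_P[T i] = (i%:R `^ alpha tau)%:E)%E.
Hypothesis hindep : independent_rvs [set i : nat | (2 <= i)%N] T.

Definition two_level_mean (v s : R) (h : bool -> bool -> R) : R :=
  h true true * (1 - expR (- (s * v))) +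
  h false true * (expR (- (s * v)) - expR (- v)) +
  h false false * expR (- v).

Lemma measurable_rv_le i (t : R) : measurable [set w | (T i w <= t)%R].
Proof.
rewrite (_ : [set w | _] = T i @^-1` `]-oo, t]%classic).
  exact: measurable_rv_preimage.
by apply/seteqP; split => w /=; rewrite in_itv.
Qed.

Lemma rv_cdf i (t : R) : (2 <= i)%N -> 0 <= t ->
  P [set w | (T i w <= t)%R] = (1 - expR (- (c_ tau i * t)))%:E.
Proof.
move=> i2 t0.
have i0 : 0 < i%:R :> R by rewrite ltr0n; apply: leq_trans i2.
have m0 : 0 < i%:R `^ alpha tau by exact: powR_gt0.
rewrite (exponential_rv_cdf m0 (hexp i2) (hmean i2) t0).
by rewrite /c_ powRN mulrC.
Qed.

(** A function of the two indicators 1(T_i <= s_i u) and 1(T_i <= u) is a simple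
    function of T_i with three levels. *)
Lemma integral_prod_two_level (J : seq nat) (u : R) (s : nat -> R)
    (h : nat -> bool -> bool -> R) :
  uniq J -> {in J, forall i, (2 <= i)%N} -> 0 < u ->
  (forall i, 0 <= s i <= 1) -> (forall i b1 b2, 0 <= h i b1 b2) ->
  (\int[P]_w (\prod_(i <- J)
      h i (T i w <= s i * u)%R (T i w <= u)%R)%:E =
   (\prod_(i <- J) two_level_mean (u * c_ tau i) (s i) (h i))%:E)%E.
Proof.
move=> uJ J2 u0 s01 h0.
have su i : s i * u <= u by have /andP[? ?] := s01 i; rewrite ler_piMl// ltW.
have su0 i : 0 <= s i * u by have /andP[? ?] := s01 i; rewrite mulr_ge0// ltW.
pose l i := [:: (h i true true, `]-oo, s i * u]%classic : set R);
   (h i false true, `]s i * u, u]%classic : set R);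
   (h i false false, `]u, +oo[%classic : set R)].
have hl i : step_seq (l i).
  by move=> aB; rewrite !inE => /or3P[]/eqP->; split => //=.
have lE i x : step_fun (l i) x = h i (x <= s i * u) (x <= u).
  rewrite /step_fun !big_cons big_nil/= !indicE !mem_setE !in_itv/= andbT.
  have [xsu|xsu] := leP x (s i * u).
    by rewrite (le_trans xsu (su i))/= ltNge (le_trans xsu (su i))/= !mulr0 mulr1 !addr0.
  have [xu|xu] := leP x u; rewrite !(mulr0, mulr1) !(addr0, add0r)//.
have := @integral_prod_step_indic _ _ _ P T hindep J [::] l (fun=> setT).
rewrite cats0 big_nil mulr1 => /(_ uJ J2 hl (fun=> measurableT)) H.
transitivity (\int[P]_w ((\prod_(i <- J) step_fun (l i) (T i w)) *
    \prod_(i <- [::]) \1_(setT : set R) (T i w))%:E)%E.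
  apply: eq_integral => w _; rewrite big_nil mulr1; congr EFin.
  by apply: eq_bigr => i _; rewrite lE.
rewrite H; congr EFin; rewrite big_seq [RHS]big_seq.
apply: eq_bigr => i iJ; have i2 := J2 _ iJ.
have F1 := rv_cdf i2 (su0 i); have F2 := rv_cdf i2 (ltW u0).
rewrite !big_cons big_nil addr0 /pr_rv /two_level_mean/= addrA.
have e1 : T i @^-1` `]-oo, s i * u] = [set w | (T i w <= s i * u)%R].
  by apply/seteqP; split => w /=; rewrite in_itv.
have e2 : T i @^-1` `]s i * u, u] =
    [set w | (T i w <= u)%R] `\` [set w | (T i w <= s i * u)%R].
  apply/seteqP; split => w /=; rewrite in_itv/=.
    by move=> /andP[h1 h2]; split => //; apply/negP; rewrite -ltNge.
  by move=> [-> /negP]; rewrite -ltNge => ->.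
have e3 : T i @^-1` `]u, +oo[ = ~` [set w | (T i w <= u)%R].
  apply/seteqP; split => w /=; rewrite in_itv/= andbT.
    by move=> h1; apply/negP; rewrite -ltNge.
  by move=> /negP; rewrite -ltNge.
have f1 : c_ tau i * (s i * u) = s i * (u * c_ tau i) by ring.
have f2 : c_ tau i * u = u * c_ tau i by ring.
have mD : (P ([set w | (T i w <= u)%R] `\` [set w | (T i w <= s i * u)%R]) =
    P [set w | (T i w <= u)%R] - P [set w | (T i w <= s i * u)%R])%E.
  rewrite measureD; last 3 first.
  - exact: measurable_rv_le.
  - exact: measurable_rv_le.
  - by rewrite ltey_eq fin_num_measure//; exact: measurable_rv_le.
  rewrite (_ : _ `&` _ = [set w | (T i w <= s i * u)%R])//.
  by apply/seteqP; split => w /= => [[]//|h1]; split => //; exact: le_trans (su i).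
rewrite e1 e2 e3 mD probability_setC; last exact: measurable_rv_le.
by rewrite F1 F2 f1 f2 -!EFinB/=; ring.
Qed.

End two_level_product.

Section tilted_expectation.
Context {d : measure_display} {Omega : measurableType d} {R : realType}.
Variable P : probability Omega R.
Variables (tau : R) (T : nat -> {RV P >-> R}).
Hypothesis hexp : forall i : nat, (2 <= i)%N -> exponential_rv (T i).
Hypothesis hmean : forall i : nat, (2 <= i)%N ->
  ('E_P[T i] = (i%:R `^ alpha tau)%:E)%E.
Hypothesis hindep : independent_rvs [set i : nat | (2 <= i)%N] T.

(** Multiplying the process by u turns the i-th jump c_i into v = u c_i, which is
    both the size of the jump and the rate of the clock times the horizon. *)
Definition jump (u : R) (i : nat) : R := u * c_ tau i.

Definition jump_sum (u : R) (m n : nat) (p : R) (w : Omega) : R :=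
  \sum_(m <= i < n) jump u i * ((T i w <= p * u)%R%:R - p * jump u i).

(** The unnormalised density of the change of measure.  The clocks before [m0] are
    required to ring before [sig i * u], those between [m0] and [N] are tilted
    by [th], and the others are left alone.  Integrating against this density
    replaces the construction of the tilted law; [weight_mass] is its total
    mass. *)
Definition weight (th u : R) (sig : nat -> R) (m0 N : nat) (w : Omega) : R :=
  (\prod_(2 <= i < m0) (T i w <= sig i * u)%R%:R) *
  \prod_(m0 <= i < N) expR (th * jump u i * (T i w <= u)%R%:R).

Definition weight_mass (th u : R) (sig : nat -> R) (m0 N : nat) : R :=
  (\prod_(2 <= i < m0) (1 - expR (- (sig i * jump u i)))) *
  \prod_(m0 <= i < N) tilt_mass th (jump u i).

Lemma jump_ge0 u i : 0 <= u -> 0 <= jump u i.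
Proof. by move=> u0; rewrite mulr_ge0// powR_ge0. Qed.

Lemma expR_jump_sum lam u m n p w :
  expR (lam * jump_sum u m n p w) =
  \prod_(m <= i < n) expR (lam * jump u i * ((T i w <= p * u)%R%:R - p * jump u i)).
Proof.
rewrite /jump_sum mulr_sumr expR_sum; apply: eq_bigr => i _.
by rewrite mulrA.
Qed.

(** Everything factorises over the clocks: a compensated sum over the tilted
    indices contributes its tilted exponential moment, and one over later indices
    its original exponential moment. *)
Lemma integral_weight_exp (th u : R) (sig : nat -> R) (m0 N m n : nat)
    (lam p lam' p' : R) :
  (2 <= m0 <= N)%N -> (N <= m)%N -> 0 < u ->
  (forall i, 0 <= sig i <= 1) -> 0 <= p <= 1 -> 0 <= p' <= 1 ->
  (\int[P]_w (weight th u sig m0 N w * expR (lam * jump_sum u m0 N p w)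
      * expR (lam' * jump_sum u m n p' w))%:E =
  (weight_mass th u sig m0 N *
   (\prod_(m0 <= i < N) ((1 + tilt_cdf th p (jump u i) * (expR (lam * jump u i) - 1))
      * expR (- (lam * (p * jump u i ^+ 2))))) *
   (\prod_(m <= i < n) ((1 + (1 - expR (- (p' * jump u i))) *
      (expR (lam' * jump u i) - 1)) * expR (- (lam' * (p' * jump u i ^+ 2)))))%R)%:E)%E.
Proof.
move=> /andP[m02 m0N] Nm u0 sig01 p01 p'01.
pose J := index_iota 2 m0 ++ index_iota m0 N ++ index_iota m n.
pose s i := if (i < m0)%N then sig i else if (i < N)%N then p else p'.
pose h i (b1 b2 : bool) : R := if (i < m0)%N then b1%:R else
  if (i < N)%N then expR (th * jump u i * b2%:R) *
     expR (lam * jump u i * (b1%:R - p * jump u i))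
  else expR (lam' * jump u i * (b1%:R - p' * jump u i)).
have uJ : uniq J.
  rewrite !cat_uniq !iota_uniq !andbT/=; apply/andP; split.
    apply/hasPn => i; rewrite mem_cat !mem_index_iota => /orP[]/andP[h1 h2].
      by rewrite negb_and -!leqNgt h1 orbT.
    by rewrite negb_and -!leqNgt (leq_trans m0N (leq_trans Nm h1)) orbT.
  apply/hasPn => i; rewrite !mem_index_iota => /andP[h1 h2].
  by rewrite negb_and -!leqNgt (leq_trans Nm) ?orbT.
have J2 : {in J, forall i, (2 <= i)%N}.
  move=> i; rewrite !mem_cat !mem_index_iota => /or3P[]/andP[h1 h2] //.
    exact: leq_trans h1.
  by apply: leq_trans h1; apply: leq_trans Nm; apply: leq_trans m0N.
have s01 i : 0 <= s i <= 1 by rewrite /s; do 2 case: ifP => // _.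
have h0 i b1 b2 : 0 <= h i b1 b2.
  by rewrite /h; do 2 case: ifP => // _; rewrite ?mulr_ge0 ?expR_ge0.
have H := integral_prod_two_level hexp hmean hindep uJ J2 u0 s01 h0.
transitivity (\int[P]_w (\prod_(i <- J) h i (T i w <= s i * u)%R (T i w <= u)%R)%:E)%E.
  apply: eq_integral => w _; congr EFin.
  rewrite !expR_jump_sum /J !big_cat/= /weight -!mulrA; congr (_ * _); last first.
    rewrite mulrA; congr (_ * _).
      rewrite -big_split/= big_nat [RHS]big_nat; apply: eq_bigr => i /andP[h1 h2].
      by rewrite /h /s ltnNge h1/= h2.
    rewrite big_nat [RHS]big_nat; apply: eq_bigr => i /andP[h1 h2].
    rewrite /h /s ltnNge (leq_trans m0N (leq_trans Nm h1))/=.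
    by rewrite ltnNge (leq_trans Nm h1).
  by rewrite big_nat [RHS]big_nat; apply: eq_bigr => i /andP[h1 h2]; rewrite /h /s h2.
rewrite H; congr EFin; rewrite /J !big_cat/= /weight_mass -!mulrA; congr (_ * _).
  rewrite big_nat [RHS]big_nat; apply: eq_bigr => i /andP[h1 h2].
  by rewrite /two_level_mean /h /s h2 mul1r !mul0r !addr0.
rewrite mulrA; congr (_ * _).
  rewrite -big_split/= big_nat [RHS]big_nat; apply: eq_bigr => i /andP[h1 h2].
  rewrite /two_level_mean /h /s ltnNge h1/= h2 -/(jump u i).
  set v := jump u i; have v0 : 0 <= v by rewrite jump_ge0// ltW.
  have Z0 := lt0r_neq0 (tilt_mass_gt0 th v0).
  rewrite /tilt_cdf.
  set A := expR (th * v) * (1 - expR (- (p * v))).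
  have E B C : tilt_mass th v * ((1 + A / tilt_mass th v * B) * C) =
    (tilt_mass th v + A * B) * C by field.
  rewrite E.
  rewrite !mulr1 !mulr0 expR0 mul1r.
  have -> : lam * v * (1 - p * v) = lam * v + - (lam * (p * v ^+ 2)) by ring.
  have -> : lam * v * (0 - p * v) = - (lam * (p * v ^+ 2)) by ring.
  rewrite expRD /tilt_mass /A; ring.
rewrite big_nat [RHS]big_nat; apply: eq_bigr => i /andP[h1 h2].
rewrite /two_level_mean /h /s ltnNge (leq_trans m0N (leq_trans Nm h1))/=.
rewrite ltnNge (leq_trans Nm h1)/= -/(jump u i); set v := jump u i.
have -> : lam' * v * (1 - p' * v) = lam' * v + - (lam' * (p' * v ^+ 2)) by ring.
have -> : lam' * v * (0 - p' * v) = - (lam' * (p' * v ^+ 2)) by ring.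
rewrite expRD; ring.
Qed.

Lemma measurable_jump_sum u m n p : measurable_fun setT (jump_sum u m n p).
Proof.
apply: measurable_sum => i; apply: measurable_funM => //.
apply: measurable_funB => //.
rewrite (_ : (fun w => _) = \1_[set w | (T i w <= p * u)%R]).
  by apply: measurable_indic; exact: measurable_rv_le.
by apply/funext => w; rewrite indicE mem_setE.
Qed.

Lemma measurable_weight th u sig m0 N : measurable_fun setT (weight th u sig m0 N).
Proof.
have mi i t : measurable_fun setT (fun w => (T i w <= t)%R%:R : R).
  rewrite (_ : (fun w => _) = \1_[set w | (T i w <= t)%R]).
    by apply: measurable_indic; exact: measurable_rv_le.
  by apply/funext => w; rewrite indicE mem_setE.
apply: measurable_funM; apply: measurable_prod => i _ //.
by apply: measurableT_comp => //; apply: measurable_funM.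
Qed.

Lemma weight_ge0 th u sig m0 N w : 0 <= weight th u sig m0 N w.
Proof.
rewrite /weight mulr_ge0//; apply: prodr_ge0 => i _; rewrite ?expR_ge0//.
Qed.

Lemma weight_mass_ge0 th u sig m0 N : 0 <= u -> (forall i, 0 <= sig i) ->
  0 <= weight_mass th u sig m0 N.
Proof.
move=> u0 s0; rewrite /weight_mass mulr_ge0//; apply: prodr_ge0 => i _.
  by rewrite subr_ge0 expRN_le1// mulr_ge0// jump_ge0.
by rewrite ltW// tilt_mass_gt0// jump_ge0.
Qed.

End tilted_expectation.

(** * Powers and the scale of the problem *)

Section powers.
Context {R : realType}.
Implicit Types (x y b c s M : R).

Lemma powR_powD x b c : 0 < x -> x `^ b * x `^ c = x `^ (b + c).
Proof. by move=> x0; rewrite powRD// (gt_eqF x0) implybT. Qed.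

Lemma powR_invN x b : 0 <= x -> x^-1 `^ (- b) = x `^ b.
Proof. by move=> x0; rewrite -(powR_inv1 x0) -powRrM mulN1r opprK. Qed.

Lemma powR_exprn x b n : 0 <= x -> (x ^+ n) `^ b = (x `^ b) ^+ n.
Proof.
move=> x0; rewrite -(powR_mulrn n x0) -(powR_mulrn n (powR_ge0 x b)) -!powRrM.
by rewrite mulrC.
Qed.

Lemma powR_ge_eventually b M : 0 < b ->
  exists2 x0 : R, 1 <= x0 & forall x, x0 <= x -> M <= x `^ b.
Proof.
move=> b0; exists (Num.max 1 (Num.max 1 M `^ b^-1)); first by rewrite le_max lexx.
move=> x; rewrite ge_max => /andP[x1 xM].
have m1 : 0 <= Num.max 1 M `^ b^-1 by exact: powR_ge0.
apply: (@le_trans _ _ ((Num.max 1 M `^ b^-1) `^ b)).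
  rewrite -powRrM mulVf ?gt_eqF// powRr1 ?le_max ?lexx ?orbT//.
  by rewrite ler01.
by rewrite ge0_ler_powR ?nnegrE ?(ltW b0)//; exact: le_trans m1 xM.
Qed.

(** Since ln x <= (2 / b) x^(b/2), the exponent s ln x is of smaller order than
    x^b. *)
Lemma powR_le_expR_eventually s b c : 0 < b -> 0 < c ->
  exists2 x0 : R, 1 <= x0 & forall x, x0 <= x -> x `^ s <= expR (c * x `^ b).
Proof.
move=> b0 c0; have b20 : 0 < b / 2 by rewrite divr_gt0.
have [x0 x01 hx0] := powR_ge_eventually (2 * `|s| / (b * c)) b20.
exists x0 => // x xx0; have x1 : 1 <= x by exact: le_trans xx0.
have xp : 0 < x by exact: lt_le_trans x1.
have lnx0 : 0 <= ln x by rewrite ln_ge0.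
set y := x `^ (b / 2); have yp : 0 < y by exact: powR_gt0.
have h1 : b / 2 * ln x <= y.
  rewrite -ln_powR -/y; have := expR_ge1Dx (ln y); rewrite lnK ?posrE//; lra.
have h2 : 2 * `|s| / (b * c) <= y by exact: hx0.
have xb : x `^ b = y * y.
  by rewrite /y powR_powD//; congr powR; lra.
rewrite xb /powR gt_eqF// ler_expR.
have bc0 : 0 < b * c by rewrite mulr_gt0.
have h3 : 2 * `|s| <= y * (b * c) by rewrite -ler_pdivrMr.
have h4 : s * ln x <= `|s| * ln x by rewrite ler_wpM2r// ler_norm.
have h5 : 2 * `|s| * (b / 2 * ln x) <= y * (b * c) * y.
  by apply: ler_pM => //; rewrite mulr_ge0 ?(ltW b20).
have h6 : b * (`|s| * ln x) <= b * (c * (y * y)) by lra.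
by apply: le_trans h4 _; rewrite -(ler_pM2l b0).
Qed.

Lemma powRN_le x y b : 0 <= b -> 0 < x -> x <= y -> y `^ (- b) <= x `^ (- b).
Proof.
move=> b0 x0 xy; rewrite !powRN lef_pV2 ?posrE ?powR_gt0//; last first.
  exact: lt_le_trans xy.
by rewrite ge0_ler_powR// ?nnegrE ltW//; exact: lt_le_trans xy.
Qed.

Lemma powR_ge1 x b : 1 <= x -> 0 <= b -> 1 <= x `^ b.
Proof. by move=> x1 b0; rewrite -(powRr0 x) ler_powR. Qed.

Lemma powRN_le1 x b : 1 <= x -> 0 <= b -> x `^ (- b) <= 1.
Proof. by move=> x1 b0; rewrite -(powRr0 x) ler_powR// oppr_le0. Qed.

End powers.

Section scaling.
Context {R : realType}.
Variable tau : R.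
Hypothesis htau : 3 < tau < 4.
Implicit Types (u : R) (i b : nat).

(** The number of indices whose rescaled jump is at least 1, which is also the
    speed of the large deviations. *)
Definition scale u := u `^ (tau - 1).

Lemma alpha_gt0 : 0 < alpha tau.
Proof. by rewrite /alpha mul1r invr_gt0; case/andP: htau; lra. Qed.

Lemma alpha_lt_half : alpha tau < 2^-1.
Proof.
have /andP[h1 h2] := htau; rewrite /alpha mul1r ltf_pV2 ?posrE; lra.
Qed.

Lemma alpha_gt_third : 3^-1 < alpha tau.
Proof.
have /andP[h1 h2] := htau; rewrite /alpha mul1r ltf_pV2 ?posrE; lra.
Qed.

Lemma alphaK : (tau - 1) * alpha tau = 1.
Proof.
by have /andP[h1 h2] := htau; rewrite /alpha mul1r divff// gt_eqF//; lra.
Qed.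

Lemma scale_gt0 u : 0 < u -> 0 < scale u.
Proof. exact: powR_gt0. Qed.

Lemma scale_alpha u : 0 <= u -> scale u `^ alpha tau = u.
Proof. by move=> u0; rewrite /scale -powRrM alphaK powRr1. Qed.

Lemma scaleE u : 0 < u -> scale u = u * u `^ (tau - 2).
Proof.
move=> u0; rewrite -[X in X * _](powRr1 (ltW u0)) powR_powD// /scale.
by congr (_ `^ _); ring.
Qed.

Lemma scale_sqE u : 0 < u -> scale u = u ^+ 2 * u `^ (tau - 3).
Proof.
move=> u0; rewrite -(powR_mulrn 2 (ltW u0)) powR_powD// /scale.
by congr (_ `^ _); ring.
Qed.

Lemma scale_ge1 u : 1 <= u -> 1 <= scale u.
Proof. by move=> u1; apply: powR_ge1 => //; case/andP: htau; lra. Qed.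

Lemma jumpE u i : 0 < u ->
  jump tau u i = (i%:R / scale u) `^ (- alpha tau).
Proof.
move=> u0; have r0 := scale_gt0 u0.
rewrite /jump /c_ powRM ?ler0n ?invr_ge0 ?(ltW r0)// mulrC; congr (_ * _).
by rewrite powR_invN ?(ltW r0)// scale_alpha// ltW.
Qed.

Lemma jump_le u i b : 0 < u -> (0 < b)%N -> (b <= i)%N ->
  jump tau u i <= (b%:R / scale u) `^ (- alpha tau).
Proof.
move=> u0 b0 bi; rewrite jumpE//; have r0 := scale_gt0 u0.
apply: powRN_le; rewrite ?(ltW alpha_gt0)//.
  by rewrite divr_gt0// ltr0n.
by rewrite ler_pM2r ?invr_gt0// ler_nat.
Qed.

Lemma scale_ge_eventually (M : R) :
  exists2 u0 : R, 1 <= u0 & forall u, u0 <= u -> M <= scale u.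
Proof. by apply: powR_ge_eventually; case/andP: htau; lra. Qed.

End scaling.

Section moment_factors.
Context {R : realType}.
Implicit Types (lam p v th : R).

(** The clock rings before the time p with probability about p v, so that the
    compensated jump has variance about p v^3.  The first-order terms cancel up to
    an error |lam| p v^3, which is absorbed into the variance term because
    |lam| >= 1. *)
Lemma free_factor_le lam p v : 0 <= p <= 1 -> 0 <= v -> 1 <= `|lam| ->
  `|lam| * v <= 2^-1 ->
  (1 + (1 - expR (- (p * v))) * (expR (lam * v) - 1))
    * expR (- (lam * (p * v ^+ 2)))
  <= expR (4 * lam ^+ 2 * (p * v ^+ 3)).
Proof.
move=> /andP[p0 p1] v0 lam1 lamv.
set x := (1 - expR (- (p * v))) * (expR (lam * v) - 1).
apply: (@le_trans _ _ (expR x * expR (- (lam * (p * v ^+ 2))))).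
  by rewrite ler_wpM2r ?expR_ge0// expR_ge1Dx.
rewrite -expRD ler_expR.
have pv0 : 0 <= p * v by rewrite mulr_ge0.
have l0 : 0 <= 1 - expR (- (p * v)) by rewrite subr_ge0 expRN_le1.
have l1 := onem_expRN_le (p * v).
have l2 := onem_expRN_ge pv0.
have v2 : 0 <= v ^+ 2 by rewrite sqr_ge0.
have v3 : 0 <= p * v ^+ 3 by rewrite mulr_ge0// exprn_ge0.
have lam2 : 0 <= lam ^+ 2 by rewrite sqr_ge0.
have ll : `|lam| <= lam ^+ 2.
  by rewrite -(ger0_norm lam2) normrX expr2 ler_peMr//; exact: le_trans lam1.
have vh : v <= 2^-1 by apply: le_trans lamv; rewrite ler_peMl.
have [lam0|lam0] := leP 0 lam.
- rewrite ger0_norm// in lam1 lamv ll.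
  have h1 := expR_le_quad lamv.
  have lv0 : 0 <= lam * v by rewrite mulr_ge0.
  have h2 : x <= p * v * (lam * v + 2 * (lam * v) ^+ 2).
    have e1 : 0 <= expR (lam * v) - 1 by rewrite subr_ge0 -[leLHS]expR0 ler_expR.
    have e2 : expR (lam * v) - 1 <= lam * v + 2 * (lam * v) ^+ 2 by lra.
    exact: ler_pM.
  have : 0 <= lam ^+ 2 * (p * v ^+ 3) by rewrite mulr_ge0.
  rewrite exprMn in h2; lra.
- rewrite ltr0_norm// in lam1 lamv ll.
  have h1 : expR (lam * v) <= 1 + lam * v + 2 * (lam * v) ^+ 2.
    have lv : 0 <= - lam * v by rewrite mulr_ge0//; lra.
    by apply: expR_le_quad; lra.
  have h2 : - lam * v * (1 - 2 * (- lam * v)) <= - (expR (lam * v) - 1).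
    by rewrite exprMn in h1; lra.
  have lv0 : 0 <= - lam * v by rewrite mulr_ge0//; lra.
  have h3 : p * v * (1 - p * v) * (- lam * v * (1 - 2 * (- lam * v))) <= - x.
    have -> : - x = (1 - expR (- (p * v))) * - (expR (lam * v) - 1).
      by rewrite /x; ring.
    apply: ler_pM => //; last by rewrite mulr_ge0//; lra.
    rewrite mulr_ge0// subr_ge0; have : p * v <= v by rewrite ler_piMl.
    lra.
  have h4 : 0 <= (lam ^+ 2 - - lam) * (p * v ^+ 3) by rewrite mulr_ge0//; lra.
  have h5 : 0 <= p * (1 - p) * (- lam * v ^+ 3).
    rewrite mulr_ge0//; first by rewrite mulr_ge0//; lra.
    by rewrite mulr_ge0 ?exprn_ge0//; lra.
  have h6 : 0 <= p ^+ 2 * lam ^+ 2 * v ^+ 4.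
    apply: mulr_ge0; last exact: exprn_ge0.
    by apply: mulr_ge0 => //; exact: exprn_ge0.
  have h8 : 0 <= lam ^+ 2 * (p * v ^+ 3) by rewrite mulr_ge0.
  have h7 : p * v * (- lam) * v <= - x + 3 * (lam ^+ 2 * (p * v ^+ 3)).
    have h9 : p * v * (1 - p * v) * (- lam * v * (1 - 2 * (- lam * v))) =
      - lam * (p * v ^+ 2) - 2 * (lam ^+ 2 * (p * v ^+ 3))
      - (- lam) * (p ^+ 2 * v ^+ 3) + 2 * (p ^+ 2 * lam ^+ 2 * v ^+ 4) by ring.
    rewrite h9 in h3; lra.
  lra.
Qed.

Lemma tilt_factor_le th lam p v : 0 <= th -> 0 <= p <= 1 -> 0 <= v ->
  `|lam| <= 2^-1 ->
  (1 + tilt_cdf th p v * (expR (lam * v) - 1)) * expR (- (lam * (p * v ^+ 2)))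
  <= expR (lam * tilt_drift th p v + 2 * expR th * lam ^+ 2 * min23 v).
Proof.
move=> th0 p01 v0 lamh; have h := tilt_mix_le th0 p01 v0 lamh.
apply: le_trans (ler_wpM2r (expR_ge0 _) h) _.
rewrite -expRD ler_expR /tilt_drift; lra.
Qed.

End moment_factors.

(** * Exponential moments of one dyadic block *)

Section finite_sums.
Context {d : measure_display} {Omega : measurableType d} {R : realType}.
Variable P : probability Omega R.

Lemma le_sum_seq (I : eqType) (s : seq I) (f : I -> R) (x : I) :
  (forall y, 0 <= f y) -> x \in s -> f x <= \sum_(y <- s) f y.
Proof. by move=> f0 xs; rewrite (big_rem x)//= lerDl sumr_ge0. Qed.

Lemma integral_sum_seq_le (I : eqType) (s : seq I) (f : I -> Omega -> R) (B : R) :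
  (forall x, measurable_fun setT (f x)) -> (forall x w, 0 <= f x w) ->
  (forall x, x \in s -> (\int[P]_w (f x w)%:E <= B%:E)%E) ->
  (\int[P]_w (\sum_(x <- s) f x w)%:E <= ((size s)%:R * B)%:E)%E.
Proof.
move=> mf f0; elim: s => [|x s IH] fB.
  by under eq_integral do rewrite big_nil; rewrite integral0 mul0r.
under eq_integral do rewrite big_cons EFinD.
rewrite ge0_integralD//=; last 4 first.
- by move=> w _; rewrite lee_fin.
- exact/measurable_EFinP.
- by move=> w _; rewrite lee_fin sumr_ge0.
- by apply/measurable_EFinP; exact: measurable_sum.
rewrite -[(size s).+1]addn1 natrD mulrDl mul1r addrC EFinD leeD//.
  by apply: IH => y ys; apply: fB; rewrite inE ys orbT.
by apply: fB; exact: mem_head.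
Qed.

Lemma grid_cell (G : nat) (x : R) : (0 < G)%N -> 0 <= x <= 1 ->
  exists2 j, (j < G)%N & j%:R / G%:R <= x <= j.+1%:R / G%:R.
Proof.
move=> G0 /andP[x0 x1]; have g0 : 0 < G%:R :> R by rewrite ltr0n.
have [xlt1|xge1] := ltP x 1.
  have xG0 : 0 <= x * G%:R by rewrite mulr_ge0// ltW.
  have /andP[h1 h2] := truncn_itv xG0.
  exists (Num.truncn (x * G%:R)); last by rewrite ler_pdivrMr// h1 ler_pdivlMr// ltW.
  by rewrite -(ltr_nat R); apply: le_lt_trans h1 _; rewrite gtr_pMl.
have -> : x = 1 by apply/eqP; rewrite eq_le x1.
exists G.-1; first by rewrite prednK.
by rewrite prednK// divff ?gt_eqF// lexx andbT ler_pdivrMr// mul1r ler_nat leq_pred.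
Qed.

End finite_sums.

Section jump_sum_paths.
Context {d : measure_display} {Omega : measurableType d} {R : realType}.
Variable P : probability Omega R.
Variables (tau : R) (T : nat -> {RV P >-> R}).
Implicit Types (u p : R) (m n k : nat) (w : Omega).

Lemma jump_sum_cat u m n k p w : (m <= n <= k)%N ->
  jump_sum tau T u m k p w = jump_sum tau T u m n p w + jump_sum tau T u n k p w.
Proof. by move=> /andP[mn nk]; rewrite /jump_sum (big_cat_nat mn nk). Qed.

(** The indicators are nondecreasing in [p]; only the compensator decreases. *)
Lemma jump_sum_lipschitz u m n p p' w : 0 <= u -> p <= p' ->
  jump_sum tau T u m n p w - (p' - p) * (\sum_(m <= i < n) jump tau u i ^+ 2)
    <= jump_sum tau T u m n p' w.
Proof.
move=> u0 pp'; rewrite /jump_sum mulr_sumr -sumrB; apply: ler_sum => i _.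
have v0 := jump_ge0 tau i u0.
have h : ((T i w <= p * u)%R%:R : R) <= (T i w <= p' * u)%R%:R.
  case: (leP (T i w) (p * u)) => // h.
  by rewrite (le_trans h)// ler_wpM2r.
have : jump tau u i * (T i w <= p * u)%R%:R <= jump tau u i * (T i w <= p' * u)%R%:R.
  by rewrite ler_wpM2l.
lra.
Qed.

Lemma norm_jump_sum_between u m n p1 p2 p e w : 0 <= u -> p1 <= p <= p2 ->
  `|jump_sum tau T u m n p1 w| <= e -> `|jump_sum tau T u m n p2 w| <= e ->
  `|jump_sum tau T u m n p w|
    <= e + (p2 - p1) * (\sum_(m <= i < n) jump tau u i ^+ 2).
Proof.
move=> u0 /andP[h1 h2]; rewrite !ler_norml => /andP[a1 a2] /andP[b1 b2].
have c1 := jump_sum_lipschitz m n w u0 h1; have c2 := jump_sum_lipschitz m n w u0 h2.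
set S := \sum_(m <= i < n) _ in c1 c2 *.
have S0 : 0 <= S by apply: sumr_ge0 => i _; exact: sqr_ge0.
have d1 : 0 <= (p2 - p) * S by rewrite mulr_ge0//; lra.
have d2 : 0 <= (p - p1) * S by rewrite mulr_ge0//; lra.
by apply/andP; split; lra.
Qed.

End jump_sum_paths.

Section tail_blocks.
Context {d : measure_display} {Omega : measurableType d} {R : realType}.
Variable P : probability Omega R.
Variables (tau : R) (T : nat -> {RV P >-> R}).
Hypothesis htau : 3 < tau < 4.
Hypothesis hexp : forall i : nat, (2 <= i)%N -> exponential_rv (T i).
Hypothesis hmean : forall i : nat, (2 <= i)%N ->
  ('E_P[T i] = (i%:R `^ alpha tau)%:E)%E.
Hypothesis hindep : independent_rvs [set i : nat | (2 <= i)%N] T.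

(** With R = b / scale, the sum over the block from b to 2b has a variance of
    order p0 * scale * R^(1 - 3 alpha), and jumps of size at most R^(-alpha).  The
    exponent gap = (3 alpha - 1) / 2 is such that the tilt R^gap turns this
    variance into one of order p0 * scale, while remaining small compared with
    the inverse of the jumps.  The deviation R^(-gap/2) admitted for the block
    then costs exp (- R^(gap/2) p0 scale), and is summable over dyadic blocks. *)
Definition gap : R := (3 * alpha tau - 1) / 2.

Definition block_ratio (u : R) (b : nat) : R := b%:R / scale tau u.

Definition block_tilt u b : R := block_ratio u b `^ gap.

Definition block_err u b : R := block_ratio u b `^ (- (gap / 2)).

(** A deviation is tested at every end of the sum inside the block, at every time
    of a grid with b cells, and in both directions. *)
Definition block_index (b : nat) : seq (nat * nat * bool) :=
  allpairs pair (allpairs pair (index_iota b (2 * b).+1) (iota 0 b.+1)) [:: true; false].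

(** The Chernoff bound for one test: the term is at least 1 as soon as the tested
    deviation exceeds [block_err] times [p0 * scale tau u]. *)
Definition block_term (u p0 : R) (b : nat) (x : nat * nat * bool) (w : Omega) : R :=
  expR ((-1) ^+ x.2 * block_tilt u b * jump_sum tau T u b x.1.1 (x.1.2%:R / b%:R * p0) w)
  * expR (- (block_tilt u b * block_err u b * (p0 * scale tau u))).

Definition block_excess u p0 b w : R :=
  \sum_(x <- block_index b) block_term u p0 b x w.

Lemma gap_gt0 : 0 < gap.
Proof. by rewrite /gap; have := alpha_gt_third htau; lra. Qed.

Lemma gap_lt : gap < alpha tau.
Proof. by rewrite /gap; have := alpha_lt_half htau; lra. Qed.

Lemma block_ratio_gt0 u b : 0 < u -> (0 < b)%N -> 0 < block_ratio u b.
Proof. by move=> u0 b0; rewrite divr_gt0 ?scale_gt0// ltr0n. Qed.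

Lemma size_block_index b : size (block_index b) = (b.+1 * b.+1 * 2)%N.
Proof.
rewrite !size_allpairs size_iota/= size_iota; congr (_ * _ * _)%N; lia.
Qed.

Lemma mem_block_index b n j s : (b <= n <= 2 * b)%N -> (j <= b)%N ->
  (n, j, s) \in block_index b.
Proof.
move=> /andP[h1 h2] jb.
apply: (@allpairs_f _ _ _ pair); last by case: s; rewrite !inE.
apply: (@allpairs_f _ _ _ pair); first by rewrite mem_index_iota h1 ltnS.
by rewrite mem_iota add0n ltnS.
Qed.

Lemma block_indexP b x : x \in block_index b ->
  [/\ (b <= x.1.1)%N, (x.1.1 <= 2 * b)%N & (x.1.2 <= b)%N].
Proof.
rewrite /block_index => /allpairsP[[y s]] [/allpairsP[[n j]] [nb jb ->] _ ->].
by move: nb jb; rewrite mem_index_iota mem_iota add0n !ltnS => /andP[-> ->].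
Qed.

Lemma measurable_block_term u p0 b x : measurable_fun setT (block_term u p0 b x).
Proof.
apply: measurable_funM => //; apply: measurableT_comp => //.
by apply: measurable_funM => //; exact: measurable_jump_sum.
Qed.

Lemma block_term_ge0 u p0 b x w : 0 <= block_term u p0 b x w.
Proof. by rewrite mulr_ge0 ?expR_ge0. Qed.

(** There are at most b terms, each at most R^(-3 alpha), and b = R * scale. *)
Lemma sum_jump_cube_le u b n : 0 < u -> (0 < b)%N -> (b <= n <= 2 * b)%N ->
  \sum_(b <= i < n) jump tau u i ^+ 3
    <= scale tau u * block_ratio u b `^ (1 - 3 * alpha tau).
Proof.
move=> u0 b0 /andP[bn n2b]; have r0 := scale_gt0 tau u0.
have R0 := block_ratio_gt0 u0 b0.
apply: (@le_trans _ _ (\sum_(b <= i < n) (block_ratio u b `^ (- alpha tau)) ^+ 3)).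
  rewrite big_nat [leRHS]big_nat; apply: ler_sum => i /andP[bi _].
  by rewrite lerXn2r ?nnegrE ?powR_ge0 ?jump_ge0 ?jump_le// ltW.
rewrite big_const_nat iter_addr_0 -[leLHS]mulr_natl.
rewrite -powR_mulrn ?powR_ge0// -powRrM.
have -> : 1 - 3 * alpha tau = 1 + - alpha tau * 3 by ring.
rewrite -powR_powD// powRr1 ?(ltW R0)// mulrA ler_wpM2r ?powR_ge0//.
rewrite /block_ratio mulrC divfK ?gt_eqF// ler_nat; lia.
Qed.

Lemma sum_jump_sq_le u b n : 0 < u -> (0 < b)%N -> (b <= n <= 2 * b)%N ->
  \sum_(b <= i < n) jump tau u i ^+ 2
    <= b%:R * block_ratio u b `^ (- alpha tau) ^+ 2.
Proof.
move=> u0 b0 /andP[bn n2b].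
apply: (@le_trans _ _ (\sum_(b <= i < n) (block_ratio u b `^ (- alpha tau)) ^+ 2)).
  rewrite big_nat [leRHS]big_nat; apply: ler_sum => i /andP[bi _].
  by rewrite lerXn2r ?nnegrE ?powR_ge0 ?jump_ge0 ?jump_le// ltW.
rewrite big_const_nat iter_addr_0 -[leLHS]mulr_natl ler_wpM2r ?sqr_ge0// ler_nat; lia.
Qed.

(** The block lies beyond the tilted indices, so its exponential moments are those
    of the original law. *)
Lemma integral_block_excess_le (th u p0 : R) (sig : nat -> R) (m0 N b : nat) :
  0 <= th -> 0 < u -> 0 < p0 <= 1 -> (2 <= m0 <= N)%N -> (N <= b)%N ->
  (forall i, 0 <= sig i <= 1) -> 1 <= block_ratio u b ->
  2 <= block_ratio u b `^ (alpha tau - gap) ->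
  (\int[P]_w (weight tau T th u sig m0 N w * block_excess u p0 b w)%:E <=
    ((b.+1 * b.+1 * 2)%:R * (weight_mass tau th u sig m0 N *
      expR (p0 * scale tau u * (4 - block_ratio u b `^ (gap / 2)))))%:E)%E.
Proof.
move=> th0 u0 /andP[p00 p01] m02 Nb sig01 R1 R2.
have b2 : (2 <= b)%N by case/andP: m02 => h1 h2; exact: leq_trans h1 (leq_trans h2 Nb).
have b0 : (0 < b)%N by exact: leq_trans b2.
have r0 := scale_gt0 tau u0; have R0 := block_ratio_gt0 u0 b0.
rewrite -size_block_index.
rewrite (eq_integral (fun w => (\sum_(x <- block_index b)
    (weight tau T th u sig m0 N w * block_term u p0 b x w))%:E)); last first.
  by move=> w _; rewrite /block_excess mulr_sumr.
apply: integral_sum_seq_le.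
- by move=> x; apply: measurable_funM;
    [exact: measurable_weight|exact: measurable_block_term].
- by move=> x w; rewrite mulr_ge0 ?weight_ge0// block_term_ge0.
move=> [[n j] s] /block_indexP[/= bn n2b jb].
set p := j%:R / b%:R * p0; set lam := (-1) ^+ s * block_tilt u b.
have p01' : 0 <= p <= 1.
  have h : j%:R / b%:R <= 1 :> R by rewrite ler_pdivrMr ?ltr0n// mul1r ler_nat.
  have h0 : 0 <= j%:R / b%:R :> R by rewrite divr_ge0.
  by rewrite /p mulr_ge0 ?(ltW p00)//= mulr_ile1 ?(ltW p00).
have pp0 : p <= p0.
  by rewrite /p ler_piMl ?(ltW p00)// ler_pdivrMr ?ltr0n// mul1r ler_nat.
have lamN : `|lam| = block_tilt u b.
  by rewrite /lam normrM normrX normrN1 expr1n mul1r ger0_norm// powR_ge0.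
have lam1 : 1 <= `|lam| by rewrite lamN powR_ge1// ltW// gap_gt0.
have lamv i : (b <= i)%N -> `|lam| * jump tau u i <= 2^-1.
  move=> bi; rewrite lamN.
  apply: (@le_trans _ _ (block_tilt u b * block_ratio u b `^ (- alpha tau))).
    by rewrite ler_wpM2l ?powR_ge0// jump_le.
  rewrite /block_tilt powR_powD// -opprB powRN lef_pV2// posrE//.
  exact: lt_le_trans R2.
under eq_integral do rewrite /block_term/= mulrA EFinM muleC.
rewrite ge0_integralZl//=; last 2 first.
- apply/measurable_EFinP/measurable_funM; first exact: measurable_weight.
  by apply: measurableT_comp => //; apply: measurable_funM => //;
    exact: measurable_jump_sum.
- by move=> w _; rewrite lee_fin mulr_ge0 ?weight_ge0 ?expR_ge0.
have z01 : 0 <= (0 : R) <= 1 by rewrite lexx ler01.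
have /= H := integral_weight_exp hexp hmean hindep th n 0 lam m02 Nb u0 sig01 z01 p01'.
rewrite (eq_integral (fun w => (weight tau T th u sig m0 N w *
    expR (0 * jump_sum tau T u m0 N 0 w) *
    expR (lam * jump_sum tau T u b n p w))%:E)); last first.
  by move=> w _; rewrite mul0r expR0 mulr1.
rewrite H.
rewrite [\prod_(m0 <= i < N) _]big1 ?mulr1; last first.
  by move=> i _; rewrite !mul0r expR0 subrr mulr0 addr0 oppr0 expR0 mul1r.
rewrite -EFinM lee_fin mulrCA ler_wpM2l//.
  by apply: weight_mass_ge0; [exact: ltW|move=> i; case/andP: (sig01 i)].
have h1 : \prod_(b <= i < n) ((1 + (1 - expR (- (p * jump tau u i))) *
      (expR (lam * jump tau u i) - 1)) * expR (- (lam * (p * jump tau u i ^+ 2))))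
   <= expR (4 * lam ^+ 2 * (p * \sum_(b <= i < n) jump tau u i ^+ 3)).
  rewrite !mulr_sumr expR_sum big_nat [leRHS]big_nat; apply: ler_prod => i /andP[bi _].
  rewrite free_factor_le ?lamv ?jump_ge0 ?(ltW u0)// andbT.
  rewrite mulr_ge0 ?expR_ge0//.
  have v0 := jump_ge0 tau i (ltW u0).
  have [p'0 p'1] := andP p01'.
  have e1 : expR (- (p * jump tau u i)) <= 1 by rewrite expRN_le1// mulr_ge0.
  have : 0 <= expR (- (p * jump tau u i)) by exact: expR_ge0.
  have : 0 <= (1 - expR (- (p * jump tau u i))) * expR (lam * jump tau u i).
    by rewrite mulr_ge0 ?expR_ge0// subr_ge0.
  lra.
apply: le_trans (ler_wpM2l (expR_ge0 _) h1) _.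
rewrite -expRD ler_expR -mulrA.
have h2 := @sum_jump_cube_le u b n u0 b0; rewrite bn n2b in h2; have {}h2 := h2 isT.
have -> : block_tilt u b * (block_err u b * (p0 * scale tau u)) =
    block_ratio u b `^ (gap / 2) * (p0 * scale tau u).
  rewrite mulrA /block_tilt /block_err powR_powD//; congr (_ `^ _ * _); lra.
have lam2 : lam ^+ 2 = block_ratio u b `^ (3 * alpha tau - 1).
  rewrite -[lam ^+ 2]ger0_norm ?sqr_ge0// normrX lamN expr2 powR_powD//.
  by congr powR; rewrite /gap; field.
have h3 : lam ^+ 2 * (p * \sum_(b <= i < n) jump tau u i ^+ 3) <= p0 * scale tau u.
  apply: (@le_trans _ _ (lam ^+ 2 * (p0 * (scale tau u *
      block_ratio u b `^ (1 - 3 * alpha tau))))).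
    rewrite ler_wpM2l ?sqr_ge0//; case/andP: p01' => p'0 _; apply: ler_pM => //.
    by apply: sumr_ge0 => i _; rewrite exprn_ge0// jump_ge0// ltW.
  have -> : lam ^+ 2 * (p0 * (scale tau u * block_ratio u b `^ (1 - 3 * alpha tau)))
    = p0 * scale tau u * (lam ^+ 2 * block_ratio u b `^ (1 - 3 * alpha tau)) by ring.
  rewrite lam2 powR_powD// (_ : _ + _ = 0); last by ring.
  by rewrite powRr0 mulr1.
lra.
Qed.

End tail_blocks.

(** * The tail of the series *)

Section tail_control.
Context {d : measure_display} {Omega : measurableType d} {R : realType}.
Variable P : probability Omega R.
Variables (tau : R) (T : nat -> {RV P >-> R}).
Hypothesis htau : 3 < tau < 4.
Hypothesis hexp : forall i : nat, (2 <= i)%N -> exponential_rv (T i).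
Hypothesis hmean : forall i : nat, (2 <= i)%N ->
  ('E_P[T i] = (i%:R `^ alpha tau)%:E)%E.
Hypothesis hindep : independent_rvs [set i : nat | (2 <= i)%N] T.

(** Between two times of the grid the compensator moves by at most
    p0 / b * sum of v^2 <= p0 R^(-2 alpha), which is below the admitted deviation
    since gap < alpha. *)
Lemma block_excess_lt1 (u p0 : R) (b n : nat) (p : R) (w : Omega) :
  0 < u -> 1 <= scale tau u -> 0 < p0 -> (0 < b)%N -> 1 <= block_ratio tau u b ->
  block_excess tau T u p0 b w < 1 -> (b <= n <= 2 * b)%N -> 0 <= p <= p0 ->
  `|jump_sum tau T u b n p w| <= 2 * block_err tau u b * (p0 * scale tau u).
Proof.
move=> u0 r1 p00 b0 R1 ex bn /andP[pp0 pp1].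
have bg : 0 < b%:R :> R by rewrite ltr0n.
have lam1 : 0 < block_tilt tau u b by rewrite powR_gt0//; exact: lt_le_trans R1.
have grid j : (j <= b)%N ->
    `|jump_sum tau T u b n (j%:R / b%:R * p0) w| <= block_err tau u b * (p0 * scale tau u).
  move=> jb.
  have key (s : bool) : (-1) ^+ s * jump_sum tau T u b n (j%:R / b%:R * p0) w <=
      block_err tau u b * (p0 * scale tau u).
    have xb := mem_block_index s bn jb.
    have := le_sum_seq (fun y => block_term_ge0 tau T u p0 b y w) xb.
    move=> /le_lt_trans/(_ ex); rewrite /block_term/= -expRD -expR0 ltr_expR.
    rewrite subr_lt0 (mulrC _ (block_tilt _ _ _)) -!mulrA ltr_pM2l//.
    exact: ltW.
  have := key false; have := key true; rewrite expr0 expr1 mul1r mulN1r => h1 h2.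
  by rewrite ler_norml; apply/andP; split; lra.
have pb : 0 <= p / p0 <= 1.
  by rewrite divr_ge0 ?(ltW p00)//= ler_pdivrMr// mul1r.
have [j jb /andP[h1 h2]] := grid_cell b0 pb.
rewrite ler_pdivlMr// in h1; rewrite ler_pdivrMr// in h2.
have hp : j%:R / b%:R * p0 <= p <= j.+1%:R / b%:R * p0 by rewrite h1 h2.
apply: le_trans (norm_jump_sum_between (ltW u0) hp (grid _ (ltnW jb)) (grid _ jb)) _.
have h3 := sum_jump_sq_le htau u0 b0 bn.
have R0 := block_ratio_gt0 tau u0 b0.
have -> : j.+1%:R / b%:R * p0 - j%:R / b%:R * p0 = p0 / b%:R.
  by rewrite -mulrBl -mulrBl -natrB// subSnn mul1r mulrC.
suff h4 : p0 / b%:R * \sum_(b <= i < n) jump tau u i ^+ 2 <=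
    block_err tau u b * (p0 * scale tau u) by lra.
apply: (@le_trans _ _ (p0 / b%:R * (b%:R * block_ratio tau u b `^ (- alpha tau) ^+ 2))).
  by rewrite ler_wpM2l// divr_ge0 ?(ltW p00).
have -> : p0 / b%:R * (b%:R * block_ratio tau u b `^ (- alpha tau) ^+ 2) =
    block_ratio tau u b `^ (- alpha tau) ^+ 2 * p0 by field; rewrite gt_eqF.
apply: (@le_trans _ _ (block_err tau u b * p0)); last first.
  by rewrite ler_wpM2l ?powR_ge0// ler_peMr// ltW.
rewrite ler_wpM2r ?(ltW p00)// expr2 powR_powD// ler_powR//.
by have := gap_lt htau; have := gap_gt0 htau; lra.
Qed.

Definition err_decay : R := 2 `^ (- (gap tau / 2)).

Lemma err_decay_ge0 : 0 <= err_decay. Proof. exact: powR_ge0. Qed.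

Lemma err_decay_lt1 : err_decay < 1.
Proof.
have g0 := gap_gt0 htau.
rewrite /err_decay powRN invf_lt1 ?powR_gt0//.
rewrite -[ltLHS](powRr0 2) /powR pnatr_eq0/= ltr_expR mul0r.
by rewrite mulr_gt0 ?ln_gt0 ?ltr1n// divr_gt0.
Qed.

Lemma block_ratioM u N k :
  block_ratio tau u (N * 2 ^ k) = block_ratio tau u N * 2 ^+ k.
Proof. by rewrite /block_ratio natrM natrX mulrAC. Qed.

Lemma block_errM u N k : 0 < u ->
  block_err tau u (N * 2 ^ k) = block_err tau u N * err_decay ^+ k.
Proof.
move=> u0; have r0 := scale_gt0 tau u0.
rewrite /block_err block_ratioM powRM; last 2 first.
- by rewrite /block_ratio divr_ge0 ?(ltW r0).
- by rewrite exprn_ge0.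
by congr (_ * _); rewrite /err_decay powR_exprn.
Qed.

Definition tail_cst : R := 2 / (1 - err_decay).

Lemma tail_cst_gt0 : 0 < tail_cst.
Proof. by rewrite divr_gt0// subr_gt0 err_decay_lt1. Qed.

Section good_path.
Variables (u p0 : R) (N : nat) (w : Omega).
Hypothesis u0 : 0 < u.
Hypothesis r1 : 1 <= scale tau u.
Hypothesis p00 : 0 < p0.
Hypothesis N0 : (0 < N)%N.
Hypothesis R1 : 1 <= block_ratio tau u N.
Hypothesis ex : forall k, block_excess tau T u p0 (N * 2 ^ k) w < 1.

(** The admitted deviations of the successive dyadic blocks form a geometric
    series of ratio [err_decay]. *)
Lemma norm_tail_sum_le (k n : nat) (p : R) : 0 <= p <= p0 -> (N * 2 ^ k <= n)%N ->
  `|jump_sum tau T u (N * 2 ^ k) n p w|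
    <= tail_cst * block_err tau u (N * 2 ^ k) * (p0 * scale tau u).
Proof.
move=> pp0; have [m nm] := ubnP (n - N * 2 ^ k); elim: m k nm => // m IH k nm kn.
have b0 : (0 < N * 2 ^ k)%N by rewrite muln_gt0 N0 expn_gt0.
have R1k : 1 <= block_ratio tau u (N * 2 ^ k).
  rewrite block_ratioM; apply: (le_trans R1); rewrite ler_peMr ?(le_trans _ R1)//.
  by rewrite exprn_ege1// ler1n.
have d0 := err_decay_ge0; have d1 := err_decay_lt1.
have e0 : 0 <= block_err tau u (N * 2 ^ k) by exact: powR_ge0.
set A := p0 * scale tau u; have A0 : 0 <= A.
  by rewrite mulr_ge0 ?(ltW p00)// (le_trans _ r1).
have C2 : 2 <= tail_cst.
  rewrite /tail_cst ler_pdivlMr ?subr_gt0//; lra.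
have [n2|n2] := leqP n (2 * (N * 2 ^ k)).
  have bn : (N * 2 ^ k <= n <= 2 * (N * 2 ^ k))%N by rewrite kn n2.
  apply: le_trans (block_excess_lt1 u0 r1 p00 b0 R1k (ex k) bn pp0) _.
  rewrite -/A; have : 0 <= (tail_cst - 2) * (block_err tau u (N * 2 ^ k) * A).
    by rewrite mulr_ge0 ?subr_ge0// mulr_ge0.
  lra.
have kS : (N * 2 ^ k.+1 = 2 * (N * 2 ^ k))%N by rewrite expnS mulnCA.
have kb : (N * 2 ^ k <= N * 2 ^ k.+1 <= n)%N.
  by rewrite kS (ltnW n2) andbT -[leqLHS]mul1n leq_mul2r orbT.
rewrite (jump_sum_cat tau T u p w kb); apply: le_trans (ler_normD _ _) _.
have bn : (N * 2 ^ k <= N * 2 ^ k.+1 <= 2 * (N * 2 ^ k))%N.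
  by rewrite -kS leqnn andbT; case/andP: kb.
have h1 := block_excess_lt1 u0 r1 p00 b0 R1k (ex k) bn pp0.
have h2 : `|jump_sum tau T u (N * 2 ^ k.+1) n p w|
    <= tail_cst * block_err tau u (N * 2 ^ k.+1) * A.
  apply: IH; last by case/andP: kb.
  rewrite kS; move: nm kn n2 b0; set b := (N * 2 ^ k)%N; clear; lia.
have h3 : block_err tau u (N * 2 ^ k.+1) = block_err tau u (N * 2 ^ k) * err_decay.
  by rewrite !block_errM// exprSr mulrA.
rewrite h3 in h2; rewrite -/A in h1.
have h4 : tail_cst = 2 + tail_cst * err_decay.
  by rewrite /tail_cst; field; rewrite gt_eqF// subr_gt0.
apply: le_trans (lerD h1 h2) _; rewrite [in leRHS]h4; lra.
Qed.

Lemma tail_sum_dist (k n m : nat) (p : R) : 0 <= p <= p0 ->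
  (N * 2 ^ k <= n)%N -> (N * 2 ^ k <= m)%N ->
  `|jump_sum tau T u N n p w - jump_sum tau T u N m p w|
    <= 2 * tail_cst * block_err tau u (N * 2 ^ k) * (p0 * scale tau u).
Proof.
move=> pp0 kn km; have Nk : (N <= N * 2 ^ k)%N by rewrite leq_pmulr// expn_gt0.
have hn : (N <= N * 2 ^ k <= n)%N by rewrite Nk.
have hm : (N <= N * 2 ^ k <= m)%N by rewrite Nk.
rewrite (jump_sum_cat tau T u p w hn) (jump_sum_cat tau T u p w hm).
have h1 := norm_tail_sum_le pp0 kn; have h2 := norm_tail_sum_le pp0 km.
rewrite opprD addrACA subrr add0r; apply: le_trans (ler_normB _ _) _; lra.
Qed.

Lemma block_err_small (e : R) : 0 < e -> exists k,
  2 * tail_cst * block_err tau u (N * 2 ^ k) * (p0 * scale tau u) < e.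
Proof.
move=> e0; pose C := 2 * tail_cst * block_err tau u N * (p0 * scale tau u).
have h : err_decay ^+ k @[k --> \oo] --> 0.
  by apply: cvg_expr; rewrite ger0_norm ?err_decay_ge0 ?err_decay_lt1.
have C1 : 0 < e / (`|C| + 1) by rewrite divr_gt0// ltr_pwDr.
have /cvgrPdist_lt /(_ _ C1) [k _ /(_ k (leqnn k))] := h.
rewrite sub0r normrN ger0_norm ?exprn_ge0 ?err_decay_ge0// => hk.
exists k; rewrite block_errM//.
have -> : 2 * tail_cst * (block_err tau u N * err_decay ^+ k) * (p0 * scale tau u)
  = C * err_decay ^+ k by rewrite /C; ring.
have d0 : 0 <= err_decay ^+ k by rewrite exprn_ge0 ?err_decay_ge0.
rewrite ltr_pdivlMr in hk; last by rewrite ltr_pwDr.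
apply: le_lt_trans hk; rewrite mulrC ler_wpM2l//; have := ler_norm C; lra.
Qed.

Lemma tail_sum_cvg (p : R) : 0 <= p <= p0 ->
  cvgn (fun n => jump_sum tau T u N n p w).
Proof.
move=> pp0; apply/cauchy_cvgP/cauchy_ballP => e e0; near_simpl.
have [k hk] := block_err_small e0.
near=> n m => /=; rewrite /ball/=; apply: le_lt_trans hk.
by apply: tail_sum_dist => //; [near: n|near: m]; exact: nbhs_infty_ge.
Unshelve. all: by end_near. Qed.

Lemma norm_tail_lim_le (k n : nat) (p : R) : 0 <= p <= p0 -> (N * 2 ^ k <= n)%N ->
  `|limn (fun n => jump_sum tau T u N n p w) - jump_sum tau T u N n p w|
    <= 2 * tail_cst * block_err tau u (N * 2 ^ k) * (p0 * scale tau u).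
Proof.
move=> pp0 kn; have h := tail_sum_cvg pp0.
have h' : `|jump_sum tau T u N m p w - jump_sum tau T u N n p w| @[m --> \oo] -->
   `|limn (fun n => jump_sum tau T u N n p w) - jump_sum tau T u N n p w|.
  by apply: cvg_norm; apply: cvgB => //; exact: cvg_cst.
rewrite -(cvg_lim _ h')//; apply: limr_le; first exact: cvgP h'.
near=> m.
by apply: tail_sum_dist => //; near: m; exact: nbhs_infty_ge.
Unshelve. all: by end_near. Qed.

End good_path.

(** The 2 (b + 1)^2 tests of a block are paid by exp (- p0 scale R^(gap/2)): this
    beats R^3 because R is large, and scale^2 because p0 scale >= u is a positive
    power of scale.  The factor 2^-(k+1) makes the blocks summable. *)
Lemma block_bounds_eventually (M e : R) : 0 < e ->
  exists2 K, 1 <= K & exists2 u0, 1 <= u0 &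
  forall u p0 N k, u0 <= u -> 0 < p0 -> u <= p0 * scale tau u ->
    K * scale tau u <= N%:R -> let b := (N * 2 ^ k)%N in
  [/\ 1 <= block_ratio tau u b,
      2 <= block_ratio tau u b `^ (alpha tau - gap tau),
      tail_cst * block_err tau u b <= e &
      (b.+1 * b.+1 * 2)%:R * expR (p0 * scale tau u * (4 - block_ratio tau u b `^ (gap tau / 2)))
       <= expR (- M * (p0 * scale tau u)) / (2 ^ k.+1)%:R].
Proof.
move=> e0; have g0 := gap_gt0 htau; have ga := gap_lt htau.
have g20 : 0 < gap tau / 2 by rewrite divr_gt0.
have ag : 0 < alpha tau - gap tau by lra.
have C0 := tail_cst_gt0; have a0 := alpha_gt0 htau.
have q4 : 0 < 4^-1 :> R by rewrite invr_gt0.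
have [K1 K11 hK1] := powR_ge_eventually 2 ag.
have [K2 K21 hK2] := powR_ge_eventually (tail_cst / e) g20.
have [K3 K31 hK3] := powR_le_expR_eventually 3 g20 q4.
have [K4 K41 hK4] := powR_ge_eventually (2 * (`|M| + 5)) g20.
(* K1 keeps the tilt below half the inverse of the jumps, K2 makes the admitted
   deviations small, K3 pays for R^3 and K4 for the price M *)
pose K := Num.max (Num.max K1 K2) (Num.max K3 K4).
have tau1 : 0 < tau - 1 by case/andP: htau; lra.
have [r1 r11 hr1] := @powR_le_expR_eventually R (2 + alpha tau) _ _ a0 ltr01.
have [u1 u11 hu1] := scale_ge_eventually htau (Num.max r1 16 `^ (alpha tau)^-1).
exists K; first by rewrite /K !le_max K11.
exists u1 => // u p0 N k uu1 p00 up0 KN b.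
have u1' : 1 <= u by exact: le_trans uu1.
have u0 : 0 < u by exact: lt_le_trans u1'.
have r0 := scale_gt0 tau u0; have rge1 := scale_ge1 htau u1'.
set r := scale tau u in r0 rge1 up0 KN *.
have R0K : K <= block_ratio tau u N by rewrite /block_ratio -/r ler_pdivlMr.
set Rb := block_ratio tau u b.
have K1' : 1 <= K by rewrite /K !le_max K11.
have two_k : 1 <= 2 ^+ k :> R by rewrite exprn_ege1// ler1n.
have RK : K <= Rb.
  rewrite /Rb block_ratioM; apply: (le_trans R0K); rewrite ler_peMr//.
  by apply: le_trans R0K; exact: le_trans K1'.
have R1 : 1 <= Rb by exact: le_trans RK.
have R0 : 0 < Rb by exact: lt_le_trans R1.
have R2k : 2 ^+ k <= Rb.
  rewrite /Rb block_ratioM ler_peMl//; exact: le_trans R0K.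
have hK : [/\ K1 <= Rb, K2 <= Rb, K3 <= Rb & K4 <= Rb].
  by split; apply: le_trans RK; rewrite /K !le_max lexx ?orbT.
have [k1 k2 k3 k4] := hK.
split => //; first exact: hK1.
  rewrite /block_err -/Rb powRN -/(_ / _) ler_pdivrMr ?powR_gt0// mulrC -ler_pdivrMr//.
  exact: hK2.
have bE : b%:R = Rb * r by rewrite /Rb /block_ratio -/r divfK// gt_eqF.
have b1 : 1 <= b%:R :> R.
  by rewrite bE; have := ler_pM ler01 ler01 R1 rge1; rewrite mulr1.
set A := p0 * r in up0 *; set X := Rb `^ (gap tau / 2).
have A1 : 1 <= A by exact: le_trans up0.
have hX3 : Rb ^+ 3 <= expR (4^-1 * X).
  by rewrite -powR_mulrn ?(ltW R0)//; exact: hK3.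
have hX4 : 2 * (`|M| + 5) <= X by exact: hK4.
have ru : r `^ alpha tau = u by rewrite /r scale_alpha// ltW.
have hr : 16 * r ^+ 2 <= expR A.
  have rm : Num.max r1 16 `^ (alpha tau)^-1 <= r by exact: hu1.
  have m0 : 0 <= Num.max r1 16 by rewrite le_max; apply/orP; right.
  have um : Num.max r1 16 <= u.
    rewrite -ru; apply: (@le_trans _ _ ((Num.max r1 16 `^ (alpha tau)^-1) `^ alpha tau)).
      by rewrite -powRrM mulVf ?gt_eqF// powRr1.
    by rewrite ge0_ler_powR ?nnegrE ?powR_ge0 ?(ltW a0) ?(ltW r0).
  have r1r : r1 <= r.
    apply: (@le_trans _ _ u); first by apply: le_trans um; rewrite le_max lexx.
    by rewrite -ru; apply: ler1_powR => //; have := alpha_lt_half htau; lra.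
  have := hr1 _ r1r; rewrite mul1r ru -(powR_powD 2 (alpha tau) r0) (powR_mulrn 2 (ltW r0)) ru => h.
  apply: (@le_trans _ _ (expR u)); last by rewrite ler_expR.
  apply: le_trans h; rewrite mulrC ler_wpM2l ?sqr_ge0//.
  by apply: le_trans um; rewrite le_max lexx orbT.
have b22 : (b.+1 * b.+1 * 2)%:R <= 8 * (Rb * r) ^+ 2.
  have sq n : (n.+1 * n.+1 * 2)%:R = 2 * (n%:R + 1) ^+ 2 :> R.
    by rewrite !natrM -natr1; ring.
  rewrite sq.
  rewrite -bE.
  have : 0 <= (3 * b%:R + 1) * (b%:R - 1 : R) by rewrite mulr_ge0 ?subr_ge0 ?addr_ge0 ?mulr_ge0.
  lra.
rewrite ler_pdivlMr; last by rewrite ltr0n expn_gt0.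
rewrite natrX exprS.
apply: (@le_trans _ _ (8 * (Rb * r) ^+ 2 * expR (A * (4 - X)) * (2 * Rb))).
  apply: ler_pM => //; rewrite ?mulr_ge0 ?expR_ge0 ?exprn_ge0//; last first.
    by rewrite ler_wpM2l.
  by rewrite ler_wpM2r ?expR_ge0.
have -> : 8 * (Rb * r) ^+ 2 * expR (A * (4 - X)) * (2 * Rb) =
   Rb ^+ 3 * (16 * r ^+ 2) * expR (A * (4 - X)) by ring.
apply: (@le_trans _ _ (expR (4^-1 * X) * expR A * expR (A * (4 - X)))).
  rewrite ler_wpM2r ?expR_ge0//; apply: ler_pM => //.
    by rewrite exprn_ge0// ltW.
  by rewrite mulr_ge0// sqr_ge0.
rewrite -!expRD ler_expR.
have X0 : 0 <= X by exact: powR_ge0.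
have h1 : 4^-1 * X <= A * (4^-1 * X) by rewrite ler_peMl// mulr_ge0.
have h2 : 0 <= A * (3 / 4 * X - (M + 5)).
  by rewrite mulr_ge0//; [lra|have := ler_norm M; lra].
lra.
Qed.

(** [Phi] is the sum of the excesses of all dyadic blocks beyond [N]; where it is
    less than 1 no test fails, and the series converges uniformly with a small
    sum.  A large [K] makes the price [M] of a failure as large as wanted.  The
    bound is proportional to the length [p0] of the time interval, because the
    process has to be controlled near time 0 as well. *)
Lemma tail_control (M e : R) : 0 < e ->
  exists2 K, 1 <= K & exists2 u0, 1 <= u0 & forall u p0 N, u0 <= u ->
  0 < p0 <= 1 -> u <= p0 * scale tau u -> K * scale tau u <= N%:R ->
  exists Phi : Omega -> \bar R, [/\ measurable_fun setT Phi,
    forall w, (0 <= Phi w)%E,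
    forall th sig m0, 0 <= th -> (2 <= m0 <= N)%N -> (forall i, 0 <= sig i <= 1) ->
      (\int[P]_w ((weight tau T th u sig m0 N w)%:E * Phi w) <=
        (weight_mass tau th u sig m0 N * expR (- M * (p0 * scale tau u)))%:E)%E &
    forall w, (Phi w < 1)%E ->
     [/\ forall p, 0 <= p <= p0 -> cvgn (fun n => jump_sum tau T u N n p w),
         forall p, 0 <= p <= p0 ->
           `|limn (fun n => jump_sum tau T u N n p w)| <= e * (p0 * scale tau u) &
         forall dl, 0 < dl -> exists2 n, (N <= n)%N & forall p, 0 <= p <= p0 ->
           `|limn (fun n => jump_sum tau T u N n p w) - jump_sum tau T u N n p w| <= dl]].
Proof.
move=> e0; have e20 : 0 < e / 2 by rewrite divr_gt0.
have [K K1 [u0 u01 H]] := block_bounds_eventually M e20.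
exists K => //; exists u0 => // u p0 N uu0 /andP[p00 p01] up0 KN.
have u1 : 1 <= u by exact: le_trans uu0.
have ugt0 : 0 < u by exact: lt_le_trans u1.
have r1 := scale_ge1 htau u1; have r0 := scale_gt0 tau ugt0.
have {}H k := H u p0 N k uu0 p00 up0 KN.
have N0 : (0 < N)%N.
  by rewrite -(ltr0n R); apply: lt_le_trans KN; rewrite mulr_gt0//; exact: lt_le_trans K1.
have R1 : 1 <= block_ratio tau u N by case: (H 0%N) => /=; rewrite expn0 muln1.
have ex0 k w : 0 <= block_excess tau T u p0 (N * 2 ^ k) w.
  by apply: sumr_ge0 => x _; exact: block_term_ge0.
have mex k : measurable_fun setT (block_excess tau T u p0 (N * 2 ^ k)).
  by apply: measurable_sum => x; exact: measurable_block_term.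
exists (fun w => \sum_(k <oo) (block_excess tau T u p0 (N * 2 ^ k) w)%:E)%E; split.
- apply: ge0_emeasurable_sum => // [k w _ _|k _]; first by rewrite lee_fin.
  exact/measurable_EFinP.
- by move=> w; apply: nneseries_ge0 => k _ _; rewrite lee_fin.
- move=> th sig m0 th0 m0N sig01.
  rewrite (eq_integral (fun w => \sum_(k <oo) (weight tau T th u sig m0 N w *
    block_excess tau T u p0 (N * 2 ^ k) w)%:E))%E; last first.
    move=> w _; rewrite -nneseriesZl; last by move=> k _; rewrite lee_fin.
    by apply: eq_eseriesr => k _; rewrite EFinM.
  rewrite integral_nneseries//; last 2 first.
  + move=> k; apply/measurable_EFinP/measurable_funM => //; exact: measurable_weight.
  + by move=> k w _; rewrite lee_fin mulr_ge0// weight_ge0.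
  have W0 : 0 <= weight_mass tau th u sig m0 N.
    by apply: weight_mass_ge0; [exact: ltW|move=> i; case/andP: (sig01 i)].
  set B := (weight_mass _ _ _ _ _ _ * _)%R.
  have B0 : 0 <= B by rewrite mulr_ge0 ?expR_ge0.
  apply: le_trans (epsilon_trick0 xpredT B0).
  apply: lee_nneseries => // k _.
    by move=> _; apply: integral_ge0 => w _; rewrite lee_fin mulr_ge0// weight_ge0.
  have [h1 h2 _ h3] := H k.
  have Nb : (N <= N * 2 ^ k)%N by rewrite leq_pmulr// expn_gt0.
  have p0b : 0 < p0 <= 1 by rewrite p00.
  apply: le_trans (integral_block_excess_le htau hexp hmean hindep th0 ugt0 p0b m0N
    Nb sig01 h1 h2) _.
  rewrite lee_fin mulrCA /B -[leRHS]mulrA.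
  by rewrite ler_wpM2l.
move=> w Phi1.
have ex k : block_excess tau T u p0 (N * 2 ^ k) w < 1.
  rewrite -lte_fin; apply: le_lt_trans Phi1.
  have f0 j : (0 <= j)%N -> true -> (0 <= (block_excess tau T u p0 (N * 2 ^ j) w)%:E)%E.
    by rewrite lee_fin.
  apply: le_trans (nneseries_lim_ge k.+1 f0).
  rewrite big_nat_recr//= leeDr//.
  by apply: sume_ge0 => j _; rewrite lee_fin.
split.
- by move=> p pp0; exact: (tail_sum_cvg ugt0 r1 p00 N0 R1 ex pp0).
- move=> p pp0; have /= := norm_tail_lim_le ugt0 r1 p00 N0 R1 ex (k := 0) pp0.
  rewrite expn0 muln1 => /(_ N (leqnn N)).
  rewrite {2}/jump_sum big_geq// subr0 => /le_trans; apply.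
  have [_ _ + _] := H 0%N; rewrite /= expn0 muln1 => h.
  by rewrite ler_wpM2r ?mulr_ge0 ?(ltW p00) ?(ltW r0)//; lra.
- move=> dl dl0; have [k hk] := block_err_small p0 N ugt0 dl0.
  exists (N * 2 ^ k)%N; first by rewrite leq_pmulr// expn_gt0.
  move=> p pp0; apply: le_trans (ltW hk).
  exact: (norm_tail_lim_le ugt0 r1 p00 N0 R1 ex pp0 (leqnn _)).
Qed.

End tail_control.

(** * Integrals over the half-line *)

Section half_line_integrals.
Context {R : realType}.
Notation mu := (@lebesgue_measure R).
Implicit Types (f : R -> R) (x y s c a b : R).

(** Compact intervals that exhaust the open half-line; x |-> x^(-c) maps those of
    exponent 1 onto those of exponent [c]. *)
Definition exhaust c (n : nat) : set R :=
  `[n.+1%:R `^ (- c), n.+1%:R `^ c]%classic.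

Lemma exhaust_gt0 c n x : exhaust c n x -> 0 < x.
Proof.
by rewrite /exhaust/= in_itv/= => /andP[+ _]; apply: lt_le_trans; rewrite powR_gt0.
Qed.

Lemma nondecreasing_exhaust c : 0 <= c -> nondecreasing_seq (exhaust c).
Proof.
move=> c0 m n mn; apply/subsetPset => x; rewrite /exhaust/= !in_itv/= => /andP[h1 h2].
have mn' : m.+1%:R <= n.+1%:R :> R by rewrite ler_nat.
apply/andP; split.
  by apply: le_trans h1; apply: powRN_le => //; rewrite ltr0n.
by apply: le_trans h2 _; rewrite ge0_ler_powR ?nnegrE.
Qed.

Lemma bigcup_exhaust c : 0 < c -> \bigcup_n exhaust c n = `]0, +oo[%classic.
Proof.
move=> c0; apply/seteqP; split => [x [n _ /exhaust_gt0]|x].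
  by rewrite /= in_itv/= andbT.
rewrite /= in_itv/= andbT => x0.
have [y0 y01 hy0] := powR_ge_eventually (Num.max x x^-1) c0.
exists (Num.truncn y0) => //.
have h : Num.max x x^-1 <= (Num.truncn y0).+1%:R `^ c.
  by apply: hy0; apply: ltW; exact: truncnS_gt.
move: h; rewrite ge_max => /andP[h1 h2].
rewrite /exhaust/= in_itv/= h1 andbT powRN -[leRHS]invrK lef_pV2 ?posrE//.
by rewrite invr_gt0.
Qed.

Lemma cvg_integral_exhaust c (f : R -> \bar R) : 0 < c ->
  measurable_fun (`]0, +oo[%classic : set R) f -> (forall x, 0 < x -> (0 <= f x)%E) ->
  (\int[mu]_(x in exhaust c n) f x)%E @[n --> \oo] -->
    (\int[mu]_(x in `]0%R, +oo[) f x)%E.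
Proof.
move=> c0 mf f0; rewrite -(bigcup_exhaust c0).
apply: ge0_nondecreasing_set_cvg_integral => //.
- exact/nondecreasing_exhaust/ltW.
- by move=> n; exact: measurable_itv.
- move=> n; apply: measurable_funS mf => // x /exhaust_gt0.
  by rewrite /= in_itv/= andbT.
- by move=> n x /exhaust_gt0/f0.
Qed.

Lemma continuous_gt0_measurable f :
  (forall x, 0 < x -> {for x, continuous f}) ->
  measurable_fun (`]0, +oo[%classic : set R) f.
Proof.
move=> cf; apply: open_continuous_measurable_fun; first exact: interval_open.
by move=> x; rewrite inE/= in_itv/= andbT => /cf.
Qed.

Lemma continuous_within_gt0 f a b : 0 < a ->
  (forall x, 0 < x -> {for x, continuous f}) -> {within `[a, b], continuous f}.
Proof.
move=> a0 cf; apply: continuous_in_subspaceT => x.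
rewrite inE/= in_itv/= => /andP[ax _]; apply: cf; exact: lt_le_trans ax.
Qed.

Lemma continuous_powR_gt0 s x : 0 < x -> {for x, continuous (fun y : R => y `^ s)}.
Proof.
move=> x0; apply: differentiable_continuous; apply/derivable1_diffP.
by apply: derivable_powR; rewrite in_itv/= x0.
Qed.

Lemma integral_powR s a b : s != 1 -> 0 < a -> a < b ->
  (\int[mu]_(x in `[a, b]) (x `^ (- s))%:E =
    ((b `^ (1 - s) - a `^ (1 - s)) / (1 - s))%:E)%E.
Proof.
move=> s1 a0 ab; pose F x := x `^ (1 - s) / (1 - s).
have s1' : 1 - s != 0 by rewrite subr_eq0 eq_sym.
have dF x : 0 < x -> is_derive x 1 F (x `^ (- s)).
  move=> x0; have dx := is_derive1_powR (1 - s) x0.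
  rewrite /F (_ : (fun x => _) = (1 - s)^-1 \*: (fun y : R => y `^ (1 - s))); last first.
    by apply/funext => y /=; rewrite mulrC.
  apply: is_derive_eq; rewrite /GRing.scale/= (_ : 1 - s - 1 = - s); last by ring.
  by rewrite mulrA mulVf// mul1r.
rewrite (@continuous_FTC2 _ (fun x => x `^ (- s)) F)//.
- by rewrite -EFinB /F mulrBl.
- by apply: continuous_within_gt0 => // x; exact: continuous_powR_gt0.
- have cF x : 0 < x -> {for x, continuous F}.
    by move=> x0; apply: differentiable_continuous; apply/derivable1_diffP;
      have [] := dF x x0.
  split.
  + move=> x; rewrite in_itv/= => /andP[ax _].
    by have [] := dF x (lt_trans a0 ax).
  + by apply: cvg_at_right_filter; exact: cF.
  + by apply: cvg_at_left_filter; apply: cF; exact: lt_trans ab.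
- move=> x; rewrite in_itv/= => /andP[ax _]; rewrite derive1E.
  by have [_ ->] := dF x (lt_trans a0 ax).
Qed.

End half_line_integrals.

Section dominating_profile.
Context {R : realType}.
Variable tau : R.
Hypothesis htau : 3 < tau < 4.
Notation mu := (@lebesgue_measure R).

(** The rescaled i-th jump is the value of x |-> x^(-alpha) at i / scale, so this
    function dominates all the Riemann sums below. *)
Definition profile (x : R) : R := min23 (x `^ (- alpha tau)).

Lemma profile_ge0 x : 0 <= profile x.
Proof. by rewrite min23_ge0// powR_ge0. Qed.

Lemma profile_le_near x : profile x <= x `^ (- (2 * alpha tau)).
Proof.
rewrite /profile /min23 ge_min; apply/orP; left.
by rewrite -powR_mulrn ?powR_ge0// -powRrM mulNr mulrC.
Qed.

Lemma profile_le_far x : profile x <= x `^ (- (3 * alpha tau)).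
Proof.
rewrite /profile /min23 ge_min; apply/orP; right.
by rewrite -powR_mulrn ?powR_ge0// -powRrM mulNr mulrC.
Qed.

Lemma profile_anti x y : 0 < x -> x <= y -> profile y <= profile x.
Proof.
move=> x0 xy; have h := powRN_le (ltW (alpha_gt0 htau)) x0 xy.
rewrite /profile /min23 le_min !ge_min; apply/andP; split; apply/orP; [left|right];
  by rewrite lerXn2r ?nnegrE ?powR_ge0.
Qed.

Lemma measurable_profile : measurable_fun (`]0, +oo[%classic : set R) profile.
Proof.
apply: measurable_funTS; apply: measurable_minr; apply: measurable_funX;
  exact: measurable_powR.
Qed.

(** Near 0 the profile is at most x^(-2 alpha), and at infinity x^(-3 alpha); for
    3 < tau < 4 one has 2 alpha < 1 < 3 alpha. *)
Lemma integral_profile_exhaust_le n : (0 < n)%N ->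
  (\int[mu]_(x in exhaust 1 n) (profile x)%:E <=
   ((1 - 2 * alpha tau)^-1 + (3 * alpha tau - 1)^-1)%:E)%E.
Proof.
move=> npos; have ah := alpha_lt_half htau; have at3 := alpha_gt_third htau.
have n1 : 1 < n.+1%:R :> R by rewrite ltr1n ltnS.
have n0 : 0 < n.+1%:R :> R by rewrite ltr0n.
set b := n.+1%:R in n1 n0.
have ab : b^-1 < 1 by rewrite invf_lt1.
rewrite /exhaust powRr1 ?(ltW n0)// powR_inv1 ?(ltW n0)//.
have -> : `[b^-1, b]%classic = `[b^-1, 1]%classic `|` `]1, b]%classic.
  by rewrite -itv_bndbnd_setU// bnd_simp ltW.
have mp (A : set R) : measurable A -> (forall x, A x -> 0 < x) ->
    measurable_fun A (EFin \o profile).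
  move=> mA A0; apply/measurable_EFinP; apply: measurable_funS measurable_profile => //.
  by move=> x /A0 x0; rewrite /= in_itv/= x0.
rewrite ge0_integral_setU//=; last 3 first.
- apply: mp; first exact: measurableU.
  move=> x [|] /=; rewrite in_itv/= => /andP[h1 _].
    by apply: lt_le_trans h1; rewrite invr_gt0.
  exact: lt_trans h1.
- by move=> x _; rewrite lee_fin profile_ge0.
- apply/disj_setPLR => x /=; rewrite !in_itv/= => /andP[_ x1].
  by apply/negP; rewrite negb_and -leNgt x1.
rewrite EFinD leeD//.
- have le1 : (\int[mu]_(x in `[b^-1%R, 1%R]) (profile x)%:E <=
      \int[mu]_(x in `[b^-1%R, 1%R]) (x `^ (- (2 * alpha tau)))%:E)%E.
    apply: ge0_le_integral => //=.
    + by move=> x _; rewrite lee_fin profile_ge0.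
    + apply: mp => // x /=; rewrite in_itv/= => /andP[h1 _].
      by apply: lt_le_trans h1; rewrite invr_gt0.
    + apply/measurable_EFinP; apply: measurable_funTS; exact: measurable_powR.
    + by move=> x _; rewrite lee_fin profile_le_near.
  apply: le_trans le1 _; rewrite integral_powR ?invr_gt0//; last by rewrite lt_eqF//; lra.
  rewrite lee_fin powR1 -[leRHS]mul1r ler_wpM2r ?invr_ge0//; first by lra.
  by rewrite gerBl powR_ge0.
- rewrite integral_itv_obnd_cbnd; last first.
    apply: mp => // x /=; rewrite in_itv/= => /andP[h1 _]; exact: lt_trans h1.
  have le1 : (\int[mu]_(x in `[1%R, b]) (profile x)%:E <=
      \int[mu]_(x in `[1%R, b]) (x `^ (- (3 * alpha tau)))%:E)%E.
    apply: ge0_le_integral => //=.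
    + by move=> x _; rewrite lee_fin profile_ge0.
    + apply: mp => // x /=; rewrite in_itv/= => /andP[h1 _].
      exact: lt_le_trans h1.
    + apply/measurable_EFinP; apply: measurable_funTS; exact: measurable_powR.
    + by move=> x _; rewrite lee_fin profile_le_far.
  apply: le_trans le1 _; rewrite integral_powR//; last by rewrite gt_eqF//; lra.
  rewrite lee_fin powR1 -opprB -[X in _ / X]opprB invrN mulrNN.
  rewrite -[leRHS]mul1r ler_wpM2r ?invr_ge0//; first by lra.
  by rewrite gerBl powR_ge0.
Qed.

Lemma integrable_profile : mu.-integrable `]0%R, +oo[ (EFin \o profile).
Proof.
apply/integrableP; split; first by apply/measurable_EFinP; exact: measurable_profile.
under eq_integral => x _ do rewrite /= ger0_norm ?profile_ge0//.
pose B : R := (1 - 2 * alpha tau)^-1 + (3 * alpha tau - 1)^-1.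
apply: (@le_lt_trans _ _ B%:E); last exact: ltry.
have h : (\int[mu]_(x in exhaust 1 n) (profile x)%:E)%E @[n --> \oo] -->
    (\int[mu]_(x in `]0%R, +oo[) (profile x)%:E)%E.
  apply: cvg_integral_exhaust => //.
    by apply/measurable_EFinP; exact: measurable_profile.
  by move=> x _; rewrite lee_fin profile_ge0.
rewrite -(cvg_lim _ h)//; apply: lime_le; first exact: cvgP h.
near=> n; apply: integral_profile_exhaust_le; near: n; exact: nbhs_infty_gt.
Unshelve. all: by end_near. Qed.

End dominating_profile.

(** * Substitution by a power, and Riemann sums *)

Section power_substitution.
Context {R : realType}.
Notation mu := (@lebesgue_measure R).
Implicit Types (G : R -> R) (c x : R).

(** The decreasing change of variables holds on compact intervals; both sides are
    limits along exhaustions that correspond to each other. *)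
Lemma ge0_integral_power_substitution c G : 0 < c ->
  (forall x, 0 < x -> {for x, continuous G}) -> (forall x, 0 <= G x) ->
  (\int[mu]_(x in `]0%R, +oo[) (G x)%:E =
   \int[mu]_(x in `]0%R, +oo[) (G (x `^ (- c)) * (c * x `^ (- c - 1)))%:E)%E.
Proof.
move=> c0 cG G0; pose F x := x `^ (- c).
have Fp x : 0 < x -> 0 < F x by exact: powR_gt0.
have cF x : 0 < x -> {for x, continuous F} by exact: continuous_powR_gt0.
have dF x : 0 < x -> derive1 F x = - (c * x `^ (- c - 1)).
  by move=> x0; rewrite derive1E; have [_ ->] := is_derive1_powR (- c) x0; rewrite mulNr.
pose k x := c * x `^ (- c - 1).
have ck x : 0 < x -> {for x, continuous k}.
  by move=> x0; apply: continuousM; [exact: cvg_cst|exact: continuous_powR_gt0].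
have cGF x : 0 < x -> {for x, continuous (fun x => G (F x) * k x)}.
  move=> x0; apply: continuousM; last exact: ck.
  by apply: continuous_comp; [exact: cF|exact/cG/Fp].
have mG : measurable_fun (`]0, +oo[%classic : set R) (EFin \o G).
  by apply/measurable_EFinP; exact: continuous_gt0_measurable.
have mGF : measurable_fun (`]0, +oo[%classic : set R)
    (EFin \o (fun x => G (F x) * k x)).
  by apply/measurable_EFinP; exact: continuous_gt0_measurable.
have hG := cvg_integral_exhaust c0 mG (fun x _ => G0 x).
have hGF := cvg_integral_exhaust ltr01 mGF _.
rewrite -(cvg_lim _ hG)// -(cvg_lim _ (hGF _))//; last first.
  by move=> x x0; rewrite lee_fin mulr_ge0// mulr_ge0 ?powR_ge0 ?(ltW c0).
congr (limn _); apply/funext => n.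
have n0 : 0 < n.+1%:R :> R by rewrite ltr0n.
set b := n.+1%:R in n0 *.
have b1 : 1 <= b by rewrite ler1n.
have bi0 : 0 < b^-1 by rewrite invr_gt0.
have bb : b^-1 <= b by apply: le_trans b1; rewrite invf_le1 // ler1n.
have gtb x : b^-1 < x -> 0 < x by exact: lt_trans.
have geb x : b^-1 <= x -> 0 < x by exact: lt_le_trans.
rewrite /exhaust -/b powRr1 ?(ltW n0)// powR_inv1 ?(ltW n0)//.
have Fb : b `^ (- c) = F b by [].
have Fbi : b `^ c = F b^-1.
  by rewrite /F -powR_inv1 ?(ltW n0)// -powRrM mulN1r opprK.
rewrite Fb Fbi (@integration_by_substitution_decreasing _ F G b^-1 b)//.
- apply: eq_integral => x; rewrite inE/= in_itv/= => /andP[/geb x0 _] /=.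
  have -> : (((G \o F) * - derive1 F) x = G (F x) * - derive1 F x)%R by [].
  by rewrite dF// opprK.
- move=> x y; rewrite !in_itv/= => /andP[/geb x0 _] /andP[/geb y0 _] xy.
  by rewrite /F !powRN ltf_pV2 ?posrE ?powR_gt0// gt0_ltr_powR ?nnegrE// ltW.
- move=> x; rewrite in_itv/= => /andP[/gtb x0 _].
  have h : {for x, continuous (fun x => - k x)} by apply: continuousN; exact: ck.
  rewrite /continuous_at dF//; apply: cvg_trans h; apply: near_eq_cvg.
  by near=> y; rewrite dF//; near: y; exact: lt_nbhsr.
- apply/cvg_ex; exists (- k b^-1).
  have h : - k x @[x --> b^-1^'+] --> - k b^-1.
    by apply: cvg_at_right_filter; apply: continuousN; exact: ck.
  apply: cvg_trans h; apply: near_eq_cvg; near=> y.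
  by rewrite dF//; apply: gtb; near: y; exact: nbhs_right_gt.
- apply/cvg_ex; exists (- k b).
  have h : - k x @[x --> b^'-] --> - k b.
    by apply: cvg_at_left_filter; apply: continuousN; exact: ck.
  apply: cvg_trans h; apply: near_eq_cvg; near=> y.
  by rewrite dF//; near: y; exact: nbhs_left_gt.
- split.
  + by move=> x; rewrite in_itv/= => /andP[/gtb x0 _]; have [] := is_derive1_powR (- c) x0.
  + by apply: cvg_at_right_filter; exact: cF.
  + by apply: cvg_at_left_filter; exact: cF.
- by apply: continuous_within_gt0 => //; exact: Fp.
Unshelve. all: by end_near. Qed.

Lemma integral_power_substitution c G : 0 < c ->
  (forall x, 0 < x -> {for x, continuous G}) ->
  (\int[mu]_(x in `]0%R, +oo[) (G x)%:E =
   \int[mu]_(x in `]0%R, +oo[) (G (x `^ (- c)) * (c * x `^ (- c - 1)))%:E)%E.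
Proof.
move=> c0 cG; rewrite integralE [RHS]integralE.
have k0 x : 0 <= c * x `^ (- c - 1) by rewrite mulr_ge0 ?powR_ge0 ?(ltW c0).
have pos (H : R -> R) : (forall x, 0 < x -> {for x, continuous H}) ->
  (\int[mu]_(x in `]0%R, +oo[) (Num.max (H x) 0)%:E =
   \int[mu]_(x in `]0%R, +oo[) (Num.max (H (x `^ (- c)) * (c * x `^ (- c - 1))) 0)%:E)%E.
  move=> cH; rewrite (ge0_integral_power_substitution c0).
  - apply: eq_integral => x _; congr EFin.
    by rewrite maxr_pMl// mul0r.
  - move=> x x0; apply: continuous_max; first exact: cH.
    exact: cvg_cst.
  - by move=> x; rewrite le_max lexx orbT.
congr (_ - _)%E.
  transitivity (\int[mu]_(x in `]0%R, +oo[) (Num.max (G x) 0)%:E)%E.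
    by apply: eq_integral => x _; rewrite funeposE EFin_max.
  by rewrite pos//; apply: eq_integral => x _; rewrite funeposE EFin_max.
transitivity (\int[mu]_(x in `]0%R, +oo[) (Num.max (- G x) 0)%:E)%E.
  by apply: eq_integral => x _; rewrite funenegE EFin_max.
rewrite (pos (fun x => - G x)); last by move=> x x0; apply: continuousN; exact: cG.
by apply: eq_integral => x _; rewrite funenegE EFin_max mulNr.
Qed.

End power_substitution.

Section riemann_sums.
Context {R : realType}.
Variable tau : R.
Hypothesis htau : 3 < tau < 4.
Notation mu := (@lebesgue_measure R).
Implicit Types (g : R -> R) (r x : R) (N : nat).

Definition cell r (i : nat) : set R := `[(i%:R - 1) / r, i%:R / r[%classic.

(** The Riemann sum of [g] at the right endpoints of cells of length 1/r, as a
    function on the half-line. *)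
Definition step_profile g r N x : R := \sum_(2 <= i < N) g (i%:R / r) * \1_(cell r i) x.

Lemma cell_index r i x : 0 < r -> 0 <= x -> (0 < i)%N ->
  (x \in cell r i) = (i == (Num.truncn (x * r)).+1).
Proof.
move=> r0 x0 i0; rewrite /cell mem_setE in_itv/= ler_pdivrMr// ltr_pdivlMr//.
have xr0 : 0 <= x * r by rewrite mulr_ge0// ltW.
case: i i0 => // i _; rewrite eqSS -natr1 addrK.
apply/idP/eqP => [/andP[h1 h2]|->].
  by apply/esym; apply: truncn_def; rewrite h1 -natr1.
by have := truncn_itv xr0; rewrite -natr1.
Qed.

Lemma step_profileE g r N x : 0 < r -> 0 <= x ->
  step_profile g r N x = let i := (Num.truncn (x * r)).+1 in
    if (2 <= i < N)%N then g (i%:R / r) else 0.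
Proof.
move=> r0 x0 /=; set k := (Num.truncn (x * r)).+1.
have h i : (2 <= i < N)%N -> g (i%:R / r) * \1_(cell r i) x =
    if i == k then g (k%:R / r) else 0.
  move=> /andP[i2 _]; rewrite indicE cell_index//; last exact: ltn_trans i2.
  by case: eqP => [->|_]; rewrite ?mulr1 ?mulr0.
rewrite /step_profile big_nat (eq_bigr _ h) -big_nat -big_mkcond/=.
case: ifPn => kN; first by rewrite big_nat1_eq kN.
by rewrite big_nat1_eq (negbTE kN).
Qed.

Lemma measurable_step_profile g r N (D : set R) : measurable_fun D (step_profile g r N).
Proof.
apply: measurable_funTS; apply: measurable_sum => i.
by apply: measurable_funM => //; apply: measurable_indic; exact: measurable_itv.
Qed.

Lemma integral_step_profile g r N : 0 < r ->
  (\int[mu]_(x in `]0%R, +oo[) (step_profile g r N x)%:E =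
   (r^-1 * \sum_(2 <= i < N) g (i%:R / r))%:E)%E.
Proof.
move=> r0; have ri : 0 < r^-1 by rewrite invr_gt0.
have mc i : measurable (cell r i) by exact: measurable_itv.
have sub i : (2 <= i)%N -> cell r i `<=` `]0, +oo[.
  move=> i2 x; rewrite /cell/= !in_itv/= andbT => /andP[h1 _].
  by apply: lt_le_trans h1; rewrite divr_gt0// subr_gt0 ltr1n.
have mcell i : (2 <= i)%N -> mu (cell r i) = (r^-1)%:E.
  move=> i2; rewrite lebesgue_measure_itv/= lte_fin ltr_pM2r// ltrBlDr ltrDl ltr01.
  by rewrite -EFinB -mulrBl opprB addrCA subrr addr0 mul1r.
transitivity (\int[mu]_(x in `]0%R, +oo[) (\sum_(i <- index_iota 2 N)
    (g (i%:R / r))%:E * (\1_(cell r i) x)%:E))%E.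
  by apply: eq_integral => x _; rewrite /step_profile -sumEFin.
have int1 i : mu.-integrable `]0%R, +oo[ (fun x => (\1_(cell r i) x)%:E).
  apply: (@integrableS _ _ _ _ setT) => //.
  exact: integrable_indic_itv.
rewrite integral_sum//; last by move=> i; apply: integrableZl.
rewrite mulr_sumr -sumEFin big_nat [RHS]big_nat; apply: eq_bigr => i /andP[i2 _].
have e : cell r i `&` `]0, +oo[ = cell r i.
  by apply/seteqP; split => x => [[]//|xc]; split => //; exact: sub xc.
rewrite integralZl// integral_indic//; last exact: mc.
rewrite [X in (_ * X)%E](_ : _ = (r^-1)%:E); first by rewrite -EFinM mulrC.
by rewrite e; exact: mcell.
Qed.

(** Dominated convergence: the profile is decreasing, so that its value at a point
    dominates the step function, which takes the value of [g] at the right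
    endpoint of the cell.  If the bound were not uniform in [r] and [N], a
    sequence of bad pairs with r and N / r tending to infinity would contradict
    it. *)
Lemma riemann_sum_cvg g (C e : R) : 0 <= C -> 0 < e ->
  (forall x, 0 < x -> {for x, continuous g}) ->
  (forall x, 0 < x -> `|g x| <= C * profile tau x) ->
  exists2 M, 1 <= M & forall r N, M <= r -> M * r <= N%:R ->
    `|r^-1 * (\sum_(2 <= i < N) g (i%:R / r)) - \int[mu]_(x in `]0, +oo[) g x| <= e.
Proof.
move=> C0 e0 cg gC; apply: contrapT => /forall2NP Hneg.
have /choice[rN rNP] : forall n : nat, exists rN : R * nat,
   [/\ n.+1%:R <= rN.1, n.+1%:R * rN.1 <= rN.2%:R &
    e < `|rN.1^-1 * (\sum_(2 <= i < rN.2) g (i%:R / rN.1))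
          - \int[mu]_(x in `]0, +oo[) g x| ].
  move=> n; have [] := Hneg n.+1%:R; first by rewrite ler1n.
  move=> /existsNP[r /existsNP[N /not_implyP[h1 /not_implyP[h2 /negP]]]].
  by rewrite -ltNge => h3; exists (r, N).
have r0 n : 0 < (rN n).1 by have [h _ _] := rNP n; apply: lt_le_trans h; rewrite ltr0n.
have r1 n : 1 <= (rN n).1 by have [h _ _] := rNP n; apply: le_trans h; rewrite ler1n.
have cell_gt n x : 0 <= x -> x < (Num.truncn (x * (rN n).1)).+1%:R / (rN n).1.
  by move=> x0; rewrite ltr_pdivlMr//; exact: truncnS_gt.
have cell_le n x : 0 <= x ->
    (Num.truncn (x * (rN n).1)).+1%:R / (rN n).1 <= x + n.+1%:R^-1.
  move=> x0; have [h _ _] := rNP n.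
  rewrite ler_pdivrMr// -natr1 mulrDl lerD//.
    by rewrite truncn_le// mulr_ge0// ltW.
  by rewrite mulrC ler_pdivlMr ?mul1r// ltr0n.
pose f n x := step_profile g (rN n).1 (rN n).2 x.
have := @dominated_convergence _ _ _ mu `]0%R, +oo[%classic _
  (fun n => EFin \o f n) (EFin \o g) (EFin \o (fun x => C * profile tau x)).
case=> //.
- by move=> n; apply/measurable_EFinP; exact: measurable_step_profile.
- by apply/measurable_EFinP; exact: continuous_gt0_measurable.
- apply: aeW => x /=; rewrite in_itv/= andbT => x0.
  apply: cvg_EFin; first exact: nearW.
  apply/cvgrPdist_lt => dl dl0.
  have := cg x x0; move=> /cvgrPdist_lt /(_ _ dl0) [eta /= eta0 Heta].
  near=> n.
  rewrite /f step_profileE ?(ltW x0)//=.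
  have hn1 : n.+1%:R^-1 < eta.
    by near: n; exact: near_infty_natSinv_lt (PosNum eta0).
  have hn2 : x + 2 <= n.+1%:R.
    apply: (@le_trans _ _ n%:R); last by rewrite ler_nat.
    by near: n; exact: nbhs_infty_ger.
  have hn3 : x^-1 <= n.+1%:R.
    apply: (@le_trans _ _ n%:R); last by rewrite ler_nat.
    by near: n; exact: nbhs_infty_ger.
  have [h1 h2 _] := rNP n; set r := (rN n).1 in h1 h2 *.
  have xr0 : 0 <= x * r by rewrite mulr_ge0 ?(ltW x0)// ltW// r0.
  have xr1 : 1 <= x * r.
    by rewrite mulrC -ler_pdivrMr// mul1r; exact: le_trans hn3 h1.
  have k2 : (2 <= (Num.truncn (x * r)).+1)%N by rewrite ltnS truncn_gt0.
  have kN : ((Num.truncn (x * r)).+1 < (rN n).2)%N.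
    rewrite -(ltr_nat R) -natr1; apply: (@lt_le_trans _ _ (n.+1%:R * r)) => //.
    apply: (@lt_le_trans _ _ ((x + 2) * r)); last by rewrite ler_wpM2r// ltW// r0.
    have := r1 n; rewrite -/r => r1'.
    have : (Num.truncn (x * r))%:R <= x * r by rewrite truncn_le.
    lra.
  rewrite k2 kN/=; apply: Heta; rewrite /ball_/=.
  have := cell_gt n x (ltW x0); have := cell_le n x (ltW x0); rewrite -/r => h3 h4.
  rewrite distrC ger0_norm; last by rewrite subr_ge0 ltW.
  by rewrite ltrBlDl; apply: le_lt_trans h3 _; rewrite ltrD2l.
- have /= := integrableZl _ C (integrable_profile htau); apply; exact: measurable_itv.
- apply: aeW => x n /=; rewrite in_itv/= andbT => x0; rewrite lee_fin.
  rewrite /f step_profileE ?(ltW x0)//=.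
  have p0 := profile_ge0 tau x.
  case: ifP => _; last by rewrite normr0 mulr_ge0.
  have := cell_gt n x (ltW x0); set y := _ / _ => xy.
  apply: le_trans (gC y _) _; first exact: lt_trans xy.
  by rewrite ler_wpM2l// profile_anti// ltW.
move=> ig _ hcvg.
have gE : (\int[mu]_(x in `]0%R, +oo[) (EFin \o g) x =
    (\int[mu]_(x in `]0%R, +oo[) g x)%:E)%E.
  by rewrite /Rintegral fineK// integrable_fin_num.
rewrite gE in hcvg.
have h : (fun n => fine (\int[mu]_(x in `]0%R, +oo[) (EFin \o f n) x)%E) n @[n --> \oo]
    --> \int[mu]_(x in `]0%R, +oo[) g x.
  exact: fine_cvg.
have /cvgrPdist_lt/(_ e e0)[n _ /(_ n (leqnn n))] := h.
rewrite /= integral_step_profile//= distrC => hlt.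
by have [_ _] := rNP n; rewrite ltNge (ltW hlt).
Unshelve. all: by end_near. Qed.

End riemann_sums.

(** * The limit functionals *)

Section limit_functionals.
Context {R : realType}.
Variable tau : R.
Hypothesis htau : 3 < tau < 4.
Notation mu := (@lebesgue_measure R).
Implicit Types (th p lam v x : R).

Definition rate_int th : R :=
  \int[mu]_(x in `]0, +oo[) tilt_rate th (x `^ (- alpha tau)).

(** The functional I_E in the variable x, where v = x^(-alpha). *)
Definition drift_int th p : R :=
  \int[mu]_(x in `]0, +oo[) tilt_drift th p (x `^ (- alpha tau)).

Definition profile_int : R := \int[mu]_(x in `]0, +oo[) profile tau x.

Let half_line_integrable (f : R -> R) := mu.-integrable `]0%R, +oo[ (EFin \o f).

Let integrable_scale (f : R -> R) C : half_line_integrable f ->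
  half_line_integrable (fun x => C * f x).
Proof. by move=> h; have /= := integrableZl _ C h; apply; exact: measurable_itv. Qed.

Let integrable_add (f g : R -> R) : half_line_integrable f ->
  half_line_integrable g -> half_line_integrable (fun x => f x + g x).
Proof. by move=> h1 h2; have /= := integrableD _ h1 h2; apply; exact: measurable_itv. Qed.

Let integrable_sub (f g : R -> R) : half_line_integrable f ->
  half_line_integrable g -> half_line_integrable (fun x => f x - g x).
Proof. by move=> h1 h2; have /= := integrableB _ h1 h2; apply; exact: measurable_itv. Qed.

Lemma f_E x th : 0 < x -> f_ tau x th = tilt_rate th (x `^ (- alpha tau)).
Proof.
move=> x0; rewrite /f_ /tilt_rate; set v := x `^ (- alpha tau).
have v0 : 0 < v by exact: powR_gt0.
have -> : x `^ (- 2 * alpha tau) = v ^+ 2.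
  by rewrite /v -powR_mulrn ?powR_ge0// -powRrM; congr (_ `^ _); ring.
congr (_ - _).
have ZE : tilt_mass th v = expR (th * v) * (1 + expR (- v) * (expR (- th * v) - 1)).
  have E : expR (th * v) * expR (- th * v) = 1.
    by rewrite -expRD mulNr subrr expR0.
  have -> : expR (th * v) * (1 + expR (- v) * (expR (- th * v) - 1)) =
    expR (th * v) * (1 - expR (- v)) + (expR (th * v) * expR (- th * v)) * expR (- v).
    by ring.
  by rewrite E mul1r.
have Z0 := tilt_mass_gt0 th (ltW v0).
have h0 : 0 < 1 + expR (- v) * (expR (- th * v) - 1).
  by rewrite ZE pmulr_rgt0 ?expR_gt0 in Z0.
by rewrite ZE lnM ?posrE ?expR_gt0// expRK addrC.
Qed.

Lemma Lambda_rate_int th : Lambda tau th = rate_int th.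
Proof.
apply: eq_Rintegral => x; rewrite inE/= in_itv/= andbT => x0.
by rewrite f_E.
Qed.

Lemma continuous_tilt_mass th v : {for v, continuous (tilt_mass th)}.
Proof.
apply: cvgD.
  apply: cvgM; first by apply: continuous_comp;
    [apply: cvgM; [exact: cvg_cst|exact: cvg_id]|exact: continuous_expR].
  apply: cvgB; first exact: cvg_cst.
  by apply: continuous_comp; [exact: cvgN|exact: continuous_expR].
by apply: continuous_comp; [exact: cvgN|exact: continuous_expR].
Qed.

Lemma continuous_tilt_cdf th p v : 0 <= v -> {for v, continuous (tilt_cdf th p)}.
Proof.
move=> v0; apply: cvgM.
  apply: cvgM; first by apply: continuous_comp;
    [apply: cvgM; [exact: cvg_cst|exact: cvg_id]|exact: continuous_expR].
  apply: cvgB; first exact: cvg_cst.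
  apply: continuous_comp; last exact: continuous_expR.
  by apply: cvgN; apply: cvgM; [exact: cvg_cst|exact: cvg_id].
apply: cvgV; first by rewrite gt_eqF// tilt_mass_gt0.
exact: continuous_tilt_mass.
Qed.

Lemma continuous_tilt_drift th p v : 0 <= v -> {for v, continuous (tilt_drift th p)}.
Proof.
move=> v0; apply: cvgM; first exact: cvg_id.
apply: cvgB; first exact: continuous_tilt_cdf.
by apply: cvgM; [exact: cvg_cst|exact: cvg_id].
Qed.

Lemma continuous_tilt_rate th v : 0 <= v -> {for v, continuous (tilt_rate th)}.
Proof.
move=> v0; apply: cvgB.
  apply: continuous_comp; first exact: continuous_tilt_mass.
  by apply: continuous_ln; exact: tilt_mass_gt0.
apply: cvgM; first exact: cvg_cst.
exact: exprn_continuous.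
Qed.

Lemma continuous_at_power (G : R -> R) x : 0 < x ->
  (forall v, 0 < v -> {for v, continuous G}) ->
  {for x, continuous (fun x => G (x `^ (- alpha tau)))}.
Proof.
move=> x0 cG; apply: continuous_comp; first exact: continuous_powR_gt0.
by apply: cG; exact: powR_gt0.
Qed.

Lemma integrable_profile_bound (G : R -> R) (C : R) :
  (forall v, 0 < v -> {for v, continuous G}) ->
  (forall v, 0 < v -> `|G v| <= C * min23 v) ->
  mu.-integrable `]0%R, +oo[ (EFin \o (fun x => G (x `^ (- alpha tau)))).
Proof.
move=> cG GC.
have hC := integrable_scale C (integrable_profile htau).
apply: le_integrable hC => //.
  apply/measurable_EFinP; apply: continuous_gt0_measurable => x x0.
  exact: continuous_at_power.
move=> x; rewrite /= in_itv/= andbT => x0.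
rewrite lee_fin; apply: le_trans (GC _ _) _; first exact: powR_gt0.
exact: ler_norm.
Qed.

Lemma integrable_tilt_drift th p : 0 <= th -> 0 <= p <= 1 ->
  mu.-integrable `]0%R, +oo[ (EFin \o (fun x => tilt_drift th p (x `^ (- alpha tau)))).
Proof.
move=> th0 p01; apply: (@integrable_profile_bound _ (drift_cst th * p)).
  by move=> v v0; apply: continuous_tilt_drift; exact: ltW.
by move=> v v0; apply: norm_tilt_drift_le => //; exact: ltW.
Qed.

Lemma integrable_tilt_rate th : 0 <= th ->
  mu.-integrable `]0%R, +oo[ (EFin \o (fun x => tilt_rate th (x `^ (- alpha tau)))).
Proof.
move=> th0; apply: (@integrable_profile_bound _ (th * (2 + drift_cst th))).
  by move=> v v0; apply: continuous_tilt_rate; exact: ltW.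
by move=> v v0; apply: norm_tilt_rate_le => //; exact: ltW.
Qed.

(** The substitution v = x^(-alpha); the factor tau - 1 cancels the alpha of its
    Jacobian. *)
Lemma I_E_drift_int th p : 0 <= th -> 0 <= p <= 1 -> I_E tau th p = drift_int th p.
Proof.
move=> th0 p01; have a0 := alpha_gt0 htau; have aK := alphaK htau.
pose G v := (tilt_cdf th p v - p * v) / v `^ (tau - 1).
have cG v : 0 < v -> {for v, continuous G}.
  move=> v0; apply: cvgM.
    apply: cvgB; first by apply: continuous_tilt_cdf; exact: ltW.
    by apply: cvgM; [exact: cvg_cst|exact: cvg_id].
  apply: cvgV; first by rewrite gt_eqF// powR_gt0.
  exact: continuous_powR_gt0.
have -> : I_E tau th p = (tau - 1) * \int[mu]_(v in `]0, +oo[) G v by [].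
have -> : \int[mu]_(v in `]0, +oo[) G v = alpha tau * drift_int th p.
  rewrite /drift_int -RintegralZl//; last exact: integrable_tilt_drift.
  rewrite /Rintegral; congr fine.
  rewrite (integral_power_substitution a0 cG); apply: eq_integral => x.
  rewrite inE/= in_itv/= andbT => x0; congr EFin.
  rewrite /G /tilt_drift; set v := x `^ (- alpha tau).
  have v0 : 0 < v by exact: powR_gt0.
  have -> : v `^ (tau - 1) = x^-1.
    rewrite /v -powRrM mulNr mulrC aK; exact/powR_inv1/ltW.
  have -> : x `^ (- alpha tau - 1) = v * x^-1.
    by rewrite /v -(powR_inv1 (ltW x0)) powR_powD.
  by rewrite invrK; field; rewrite gt_eqF.
by rewrite mulrA aK mul1r.
Qed.

Lemma rate_int_tangent th lam : 0 <= th -> 0 <= th + lam ->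
  rate_int th + lam * drift_int th 1 <= rate_int (th + lam).
Proof.
move=> th0 thl0; have p01 : 0 <= (1 : R) <= 1 by rewrite ler01/=.
have i1 := integrable_tilt_rate th0; have i2 := integrable_tilt_drift th0 p01.
have i3 := integrable_tilt_rate thl0.
rewrite /rate_int /drift_int -RintegralZl// -RintegralD//; last first.
  exact: (integrable_scale lam i2).
apply: le_Rintegral => //.
  apply: (integrable_add i1).
  exact: (integrable_scale lam i2).
move=> x; rewrite /= in_itv/= andbT => x0.
by apply: tilt_rate_tangent; exact: powR_ge0.
Qed.

Lemma rate_int_quad th lam : 0 <= th -> 0 <= th + lam -> `|lam| <= 2^-1 ->
  rate_int (th + lam) <=
  rate_int th + lam * drift_int th 1 + 2 * expR th * lam ^+ 2 * profile_int.
Proof.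
move=> th0 thl0 lamh; have p01 : 0 <= (1 : R) <= 1 by rewrite ler01/=.
have i1 := integrable_tilt_rate th0; have i2 := integrable_tilt_drift th0 p01.
have i3 := integrable_tilt_rate thl0; have i4 := integrable_profile htau.
have j2 := integrable_scale lam i2.
have j4 := integrable_scale (2 * expR th * lam ^+ 2) i4.
rewrite /rate_int /drift_int /profile_int -!RintegralZl//.
rewrite -RintegralD// -RintegralD//; last exact: (integrable_add i1 j2).
apply: le_Rintegral => //.
  exact: (integrable_add (integrable_add i1 j2) j4).
move=> x; rewrite /= in_itv/= andbT => x0.
by apply: tilt_rate_quad => //; exact: powR_ge0.
Qed.

Lemma profile_int_ge0 : 0 <= profile_int.
Proof. by apply: Rintegral_ge0 => x _; exact: profile_ge0. Qed.

(** A strictly positive integrand has a strictly positive integral. *)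
Lemma drift_int_lt th th' : 0 <= th -> th < th' -> drift_int th 1 < drift_int th' 1.
Proof.
move=> th0 tt; have p01 : 0 <= (1 : R) <= 1 by rewrite ler01/=.
have th'0 : 0 <= th' by lra.
have i1 := integrable_tilt_drift th0 p01; have i2 := integrable_tilt_drift th'0 p01.
rewrite -subr_gt0 /drift_int -RintegralB//.
pose h x := tilt_drift th' 1 (x `^ (- alpha tau)) - tilt_drift th 1 (x `^ (- alpha tau)).
have h0 x : 0 < x -> 0 < h x.
  by move=> x0; rewrite subr_gt0 tilt_drift_lt// powR_gt0.
have ih : mu.-integrable `]0%R, +oo[ (EFin \o h).
  exact: (integrable_sub i2 i1).
rewrite lt_neqAle; apply/andP; split; last first.
  by apply: Rintegral_ge0 => x; rewrite /= in_itv/= andbT => /h0/ltW.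
apply/eqP => /esym hz.
have hz' : (\int[mu]_(x in `]0%R, +oo[) `|(EFin \o h) x| = 0)%E.
  transitivity (\int[mu]_(x in `]0%R, +oo[) (EFin \o h) x)%E.
    apply: eq_integral => x; rewrite inE/= in_itv/= andbT => /h0 hx.
    by rewrite ger0_norm// ltW.
  have fh : (\int[mu]_(x in `]0%R, +oo[) (EFin \o h) x)%E \is a fin_num.
    by apply: integrable_fin_num => //; exact: measurable_itv.
  by rewrite -(fineK fh); congr EFin; exact: hz.
have mh := measurable_int _ ih.
have /(ae_eq_integral_abs mu _ mh).1 := hz'; case; first exact: measurable_itv.
move=> A [mA A0 AS].
have : (mu `]0%R, +oo[%classic <= mu A)%E.
  apply: le_measure; rewrite ?inE//.
  move=> x x0; apply: AS => H; have := H x0 => -[hx].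
  by move: x0 => /=; rewrite in_itv/= andbT => /h0; rewrite hx ltxx.
by rewrite A0 lebesgue_measure_itv/= ltry leNgt ltry.
Qed.

Section minimiser.
Variable th : R.
Hypothesis hth : is_theta_star tau th.

Lemma theta_star_gt0 : 0 < th. Proof. by case: hth. Qed.

Lemma theta_star_min th' : rate_int th <= rate_int th'.
Proof. by rewrite -!Lambda_rate_int; case: hth. Qed.

(** The first-order condition at the minimiser, since [drift_int th 1] is the
    derivative of the rate.  In other words the limit path ends at 0: surviving
    costs nothing beyond what the tilt costs. *)
Lemma drift_int_theta_star : drift_int th 1 = 0.
Proof.
have t0 := theta_star_gt0; set D := drift_int th 1.
set C := 2 * expR th * profile_int.
have C0 : 0 <= C by rewrite mulr_ge0 ?profile_int_ge0// mulr_ge0// expR_ge0.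
pose m := Num.min 2^-1 th.
have m0 : 0 < m by rewrite lt_min t0 invr_gt0 ltr0n.
have key lam : `|lam| <= m -> 0 <= lam * D + C * lam ^+ 2.
  rewrite le_min => /andP[l1 l2].
  have thl0 : 0 <= th + lam by move: l2; rewrite ler_norml => /andP[]; lra.
  have := rate_int_quad (ltW t0) thl0 l1; have := theta_star_min (th + lam).
  rewrite -/D /C; lra.
apply: contrapT => /eqP D0.
have nD : 0 < `|D| by rewrite normr_gt0.
pose lam := Num.min m (`|D| / (2 * (C + 1))).
have lam0 : 0 < lam by rewrite lt_min m0 divr_gt0// mulr_gt0//; lra.
have laml : lam <= `|D| / (2 * (C + 1)) by rewrite ge_min lexx orbT.
(* the increment - sg D * lam of th makes the linear term negative *)
have h : 0 <= - (lam * `|D|) + C * lam ^+ 2.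
  have e1 : `|- Num.sg D * lam| = lam.
    by rewrite normrM normrN normr_sg D0 mul1r ger0_norm// ltW.
  have e2 : - Num.sg D * lam * D = - (lam * `|D|) by rewrite [in RHS]normrEsg; ring.
  have e3 : (- Num.sg D * lam) ^+ 2 = lam ^+ 2.
    by rewrite exprMn sqrrN sqr_sg D0 mul1r.
  have := key (- Num.sg D * lam); rewrite e1 e2 e3; apply.
  by rewrite ge_min lexx.
have h1 : lam * (2 * (C + 1)) <= `|D| by rewrite -ler_pdivlMr// mulr_gt0//; lra.
have : 0 < lam * (`|D| - C * lam).
  rewrite mulr_gt0//; have : 0 <= C * lam by rewrite mulr_ge0// ltW.
  lra.
lra.
Qed.

Lemma drift_int_gt0 th' : th < th' -> 0 < drift_int th' 1.
Proof. by move=> tt; rewrite -drift_int_theta_star drift_int_lt// ltW// theta_star_gt0. Qed.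

(** At th + h the derivative is at most the increment quotient on
    [th + h, th + 2 h]; the rate is at least its minimum at th + h, and is
    quadratically close to it at th + 2 h. *)
Lemma drift_int_le h : 0 < h <= 4^-1 ->
  drift_int (th + h) 1 <= 8 * expR th * profile_int * h.
Proof.
move=> /andP[h0 h1]; have t0 := theta_star_gt0.
have a1 : 0 <= th + h by lra.
have a2 : 0 <= th + h + h by lra.
have H1 := rate_int_tangent a1 a2.
have H2 := theta_star_min (th + h).
have a3 : 0 <= th + 2 * h by lra.
have a4 : `|2 * h| <= 2^-1 by rewrite ger0_norm; lra.
have H3 := rate_int_quad (ltW t0) a3 a4.
rewrite drift_int_theta_star mulr0 addr0 in H3.
have e : th + h + h = th + 2 * h by ring.
rewrite e in H1; rewrite -(ler_pM2l h0); lra.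
Qed.

End minimiser.

End limit_functionals.

(** * Sums over jumps, and paths without downward jumps *)

Section jump_riemann.
Context {R : realType}.
Variable tau : R.
Hypothesis htau : 3 < tau < 4.
Notation mu := (@lebesgue_measure R).
Implicit Types (th p u e : R) (N m : nat).

(** Here [jump tau u i] is the value of x |-> x^(-alpha) at i / scale. *)
Lemma riemann_jump (G : R -> R) (C e : R) : 0 <= C -> 0 < e ->
  (forall v, 0 < v -> {for v, continuous G}) ->
  (forall v, 0 < v -> `|G v| <= C * min23 v) ->
  exists2 M, 1 <= M & forall u N, 0 < u -> M <= scale tau u ->
    M * scale tau u <= N%:R ->
    `|\sum_(2 <= i < N) G (jump tau u i) -
      scale tau u * \int[mu]_(x in `]0, +oo[) G (x `^ (- alpha tau))|
    <= e * scale tau u.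
Proof.
move=> C0 e0 cG GC.
have [M M1 H] := @riemann_sum_cvg R tau htau (fun x => G (x `^ (- alpha tau))) C e C0 e0
  (fun x x0 => continuous_at_power x0 cG) (fun x x0 => GC _ (powR_gt0 _ x0)).
exists M => // u N u0 Mu MN; have r0 := scale_gt0 tau u0.
have := H (scale tau u) N Mu MN.
rewrite (eq_bigr (fun i => G (jump tau u i))); last by move=> i _; rewrite jumpE.
set S := \sum_(2 <= i < N) _; set I := Rintegral _ _ _ => h.
have -> : S - scale tau u * I = scale tau u * ((scale tau u)^-1 * S - I).
  by field; rewrite gt_eqF.
by rewrite normrM (ger0_norm (ltW r0)) mulrC ler_wpM2r// ltW.
Qed.

(** The sums increase with [N], so it is enough to bound them for large [N]. *)
Lemma sum_min23_le : exists2 u0 : R, 1 <= u0 & forall u N, u0 <= u ->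
  \sum_(2 <= i < N) min23 (jump tau u i) <= (profile_int tau + 1) * scale tau u.
Proof.
have cmin (v : R) : 0 < v -> {for v, continuous (min23 : R -> R)}.
  move=> v0; rewrite /min23; apply: continuous_min; exact: exprn_continuous.
have bmin (v : R) : 0 < v -> `|min23 v| <= 1 * min23 v.
  by move=> v0; rewrite mul1r ger0_norm// min23_ge0// ltW.
have [M M1 H] := riemann_jump ler01 ltr01 cmin bmin.
have [u0 u01 hu0] := scale_ge_eventually htau M.
exists u0 => // u N uu0; have u1 : 0 < u by apply: lt_le_trans uu0; exact: lt_le_trans u01.
have r0 := scale_gt0 tau u1.
pose N' := maxn (maxn N 2) (Num.truncn (M * scale tau u)).+1.
have hN' : M * scale tau u <= N'%:R.
  apply: (@le_trans _ _ (Num.truncn (M * scale tau u)).+1%:R).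
    exact/ltW/truncnS_gt.
  by rewrite ler_nat leq_maxr.
have := H u N' u1 (hu0 _ uu0) hN'; rewrite ler_norml => /andP[_ h].
apply: (@le_trans _ _ (\sum_(2 <= i < N') min23 (jump tau u i))).
  have [N2|N2] := leqP N 2.
    rewrite (big_geq N2); apply: sumr_ge0 => i _; rewrite min23_ge0//.
    exact/jump_ge0/ltW.
  have NN' : (N <= N')%N by rewrite !leq_max leqnn.
  rewrite [leRHS](big_cat_nat (ltnW N2) NN')/= lerDl; apply: sumr_ge0 => i _.
  by rewrite min23_ge0//; exact/jump_ge0/ltW.
move: h; rewrite -/(profile_int tau) lerBlDr => h.
by apply: le_trans h _; rewrite /profile_int /profile; lra.
Qed.

(** Concavity of the power, from the Bernoulli form of Jensen's inequality. *)
Lemma powR_tangent (x y q : R) : 0 <= q <= 1 -> 0 < x -> 0 < y ->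
  x `^ q <= y `^ q + q * y `^ (q - 1) * (x - y).
Proof.
move=> q01 x0 y0; have xy0 : 0 < x / y by rewrite divr_gt0.
have := expR_mul_le_mix (ln (x / y)) q01; rewrite lnK ?posrE// => h.
have h2 : (x / y) `^ q <= 1 + q * (x / y - 1) by rewrite /powR gt_eqF.
have yq0 : 0 < y `^ q by exact: powR_gt0.
have -> : x `^ q = y `^ q * (x / y) `^ q.
  by rewrite -powRM ?(ltW y0) ?(ltW xy0)//; congr (_ `^ _); field; rewrite gt_eqF.
apply: le_trans (ler_wpM2l (ltW yq0) h2) _.
have -> : y `^ (q - 1) = y `^ q / y by rewrite -powR_powD// powR_inv1// ltW.
by rewrite le_eqVlt; apply/orP; left; apply/eqP; field; rewrite gt_eqF.
Qed.

(** Comparison with the integral of x^(-b), in the form of the tangent inequality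
    for its primitive. *)
Lemma sum_powRN_le (b : R) m : 0 < b < 1 ->
  \sum_(1 <= i < m.+1) i%:R `^ (- b) <= m%:R `^ (1 - b) / (1 - b).
Proof.
move=> /andP[b0 b1]; have q0 : 0 < 1 - b by lra.
elim: m => [|m IH]; first by rewrite big_geq// divr_ge0 ?powR_ge0// ltW.
rewrite big_nat_recr//=; apply: le_trans (lerD IH (lexx _)) _.
case: m {IH} => [|m].
  by rewrite powR0 ?gt_eqF// mul0r add0r !powR1 mul1r invf_ge1//; lra.
have q01 : 0 <= 1 - b <= 1 by lra.
have := @powR_tangent m.+1%:R m.+2%:R (1 - b) q01; rewrite !ltr0n => /(_ isT isT).
have -> : m.+1%:R - m.+2%:R = -1 :> R by rewrite -[m.+2%:R]natr1; ring.
have -> : 1 - b - 1 = - b by ring.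
move=> h; rewrite -(ler_pM2r q0) mulrDl !divfK ?gt_eqF//; lra.
Qed.

Lemma sum_scaled_powRN_le (b u : R) m : 0 < b < 1 -> 0 < u ->
  \sum_(2 <= i < m) (i%:R / scale tau u) `^ (- b)
    <= scale tau u * ((m%:R / scale tau u) `^ (1 - b) / (1 - b)).
Proof.
move=> /[dup] b01 /andP[b0 b1] u0; have r0 := scale_gt0 tau u0; set r := scale tau u in r0 *.
have q0 : 0 < 1 - b by lra.
have rb : r `^ b = r * r `^ (- (1 - b)).
  by rewrite -[X in X * _](powRr1 (ltW r0)) powR_powD//; congr (_ `^ _); ring.
have E i : (i%:R / r) `^ (- b) = r `^ b * i%:R `^ (- b).
  rewrite powRM ?invr_ge0 ?(ltW r0)// mulrC; congr (_ * _).
  by rewrite powR_invN// ltW.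
under eq_bigr do rewrite E.
rewrite -mulr_sumr.
have h : \sum_(2 <= i < m) i%:R `^ (- b) <= m%:R `^ (1 - b) / (1 - b).
  have [m2|m2] := leqP m 2.
    by rewrite big_geq// divr_ge0 ?powR_ge0// ltW.
  apply: le_trans (sum_powRN_le m b01).
  have m1 : (1 <= m)%N by exact: ltn_trans m2.
  rewrite [leRHS]big_nat_recr//= [X in _ <= X + _]big_ltn//; last exact: ltn_trans m2.
  have : 0 <= (1%:R : R) `^ (- b) by exact: powR_ge0.
  have : 0 <= (m%:R : R) `^ (- b) by exact: powR_ge0.
  lra.
apply: le_trans (ler_wpM2l (powR_ge0 _ _) h) _.
rewrite rb powRM ?invr_ge0 ?(ltW r0)// -(powR_inv1 (ltW r0)) -powRrM mulN1r.
by rewrite le_eqVlt; apply/orP; left; apply/eqP; ring.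
Qed.

Lemma sum_jump_sq_init_le u m : 0 < u ->
  \sum_(2 <= i < m) jump tau u i ^+ 2 <=
  scale tau u * ((m%:R / scale tau u) `^ (1 - 2 * alpha tau) / (1 - 2 * alpha tau)).
Proof.
move=> u0; have b01 : 0 < 2 * alpha tau < 1.
  by have := alpha_gt0 htau; have := alpha_lt_half htau; lra.
apply: le_trans (sum_scaled_powRN_le m b01 u0).
apply: ler_sum => i _; rewrite jumpE// -powR_mulrn ?powR_ge0// -powRrM.
by rewrite le_eqVlt; apply/orP; left; apply/eqP; congr (_ `^ _); ring.
Qed.

Lemma drift_int_lipschitz th p p' : 0 <= th -> 0 <= p <= p' -> p' <= 1 ->
  `|drift_int tau th p' - drift_int tau th p|
    <= 2 * drift_cst th * (p' - p) * profile_int tau.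
Proof.
move=> th0 /[dup] pp' /andP[p0 pp] p1.
have p01 : 0 <= p <= 1 by rewrite p0 (le_trans pp).
have p'01 : 0 <= p' <= 1 by rewrite p1 (le_trans p0).
have i1 := integrable_tilt_drift htau th0 p01.
have i2 := integrable_tilt_drift htau th0 p'01.
rewrite /drift_int /profile_int -RintegralB//.
have i3 : mu.-integrable `]0%R, +oo[ (EFin \o (fun x =>
    tilt_drift th p' (x `^ (- alpha tau)) - tilt_drift th p (x `^ (- alpha tau)))).
  by have /= := integrableB _ i2 i1; apply; exact: measurable_itv.
have i4 : mu.-integrable `]0%R, +oo[ (EFin \o (fun x =>
    2 * drift_cst th * (p' - p) * profile tau x)).
  by have /= := integrableZl _ (2 * drift_cst th * (p' - p)) (integrable_profile htau);
    apply; exact: measurable_itv.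
apply: le_trans (le_normr_Rintegral _ i3) _ => //.
rewrite -RintegralZl//; last exact: integrable_profile.
apply: le_Rintegral => //; first exact: integrable_norm.
by move=> x _; apply: tilt_drift_lipschitz => //; exact: powR_ge0.
Qed.

Lemma sum_drift_lipschitz th p p' u m n : 0 <= th -> 0 <= p <= p' -> p' <= 1 ->
  0 <= u ->
  `|\sum_(m <= i < n) tilt_drift th p' (jump tau u i) -
    \sum_(m <= i < n) tilt_drift th p (jump tau u i)|
  <= 2 * drift_cst th * (p' - p) * \sum_(m <= i < n) min23 (jump tau u i).
Proof.
move=> th0 pp' p1 u0; rewrite -sumrB mulr_sumr.
apply: le_trans (ler_norm_sum _ _ _) _; apply: ler_sum => i _.
by apply: tilt_drift_lipschitz => //; exact: jump_ge0.
Qed.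

(** Uniformity in [p] comes from finitely many values of [p] and from the Lipschitz
    bounds on both sides. *)
Lemma riemann_drift th e : 0 <= th -> 0 < e ->
  exists2 M, 1 <= M & exists2 u0, 1 <= u0 & forall u N p, u0 <= u ->
    M * scale tau u <= N%:R -> 0 <= p <= 1 ->
    `|\sum_(2 <= i < N) tilt_drift th p (jump tau u i) -
      scale tau u * drift_int tau th p| <= e * scale tau u.
Proof.
move=> th0 e0; have C1 := drift_cst_ge1 th0; have B0 := profile_int_ge0 tau.
set B := profile_int tau in B0.
pose Lc := 2 * drift_cst th * (B + B + 1).
have Lc0 : 0 < Lc by rewrite mulr_gt0//; lra.
pose G := (Num.truncn (4 * Lc / e)).+1.
have G0 : (0 < G)%N by [].
have g0 : 0 < G%:R :> R by rewrite ltr0n.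
have hG : Lc * G%:R^-1 <= e / 4.
  have : 4 * Lc / e < G%:R by exact: truncnS_gt.
  rewrite ltr_pdivrMr// => h; rewrite ler_pdivrMr//; lra.
have e20 : 0 < e / 2 by rewrite divr_gt0.
have /choice[Mf HM] : forall j : nat, exists M : R, 1 <= M /\ ((j <= G)%N ->
   forall u N, 0 < u -> M <= scale tau u -> M * scale tau u <= N%:R ->
    `|\sum_(2 <= i < N) tilt_drift th (j%:R / G%:R) (jump tau u i) -
      scale tau u * drift_int tau th (j%:R / G%:R)| <= e / 2 * scale tau u).
  move=> j; have [jG|jG] := leqP j G; last by exists 1; split.
  have p01 : 0 <= (j%:R / G%:R : R) <= 1.
    by rewrite divr_ge0//= ler_pdivrMr// mul1r ler_nat.
  have C0 : 0 <= drift_cst th * (j%:R / G%:R).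
    by case/andP: p01 => ? _; rewrite mulr_ge0//; lra.
  have [M M1 H] := riemann_jump C0 e20
    (fun v v0 => @continuous_tilt_drift R th (j%:R / G%:R) v (ltW v0))
    (fun v v0 => norm_tilt_drift_le th0 p01 (ltW v0)).
  by exists M; split => // _; exact: H.
pose M := \big[Num.max/1]_(j < G.+1) Mf j.
have MfM j : (j <= G)%N -> Mf j <= M.
  rewrite -ltnS => jG; rewrite /M.
  exact: (le_bigmax 1 (fun k : 'I_G.+1 => Mf k) (Ordinal jG)).
have M1 : 1 <= M by apply: le_trans (MfM 0%N _) => //; case: (HM 0%N).
have [u1 u11 hu1] := scale_ge_eventually htau M.
have [u2 u21 hu2] := sum_min23_le.
exists M => //; exists (Num.max u1 u2); first by rewrite le_max u11.
move=> u N p; rewrite ge_max => /andP[uu1 uu2] MN p01.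
have u0 : 0 < u by apply: lt_le_trans uu1; exact: lt_le_trans u11.
have r0 := scale_gt0 tau u0.
have [j jG /andP[h1 h2]] := grid_cell G0 p01.
set q := j%:R / G%:R in h1.
have q0 : 0 <= q by rewrite divr_ge0.
have [_ /(_ (ltnW jG) u N u0)] := HM j; rewrite -/q => Hj.
have {}Hj := Hj (le_trans (MfM j (ltnW jG)) (hu1 u uu1)) (le_trans (ler_wpM2r (ltW r0) (MfM j (ltnW jG))) MN).
have qp : 0 <= q <= p by rewrite q0.
have p1 : p <= 1 by case/andP: p01.
have k1 := drift_int_lipschitz th0 qp p1.
have k2 := @sum_drift_lipschitz th q p u 2 N th0 qp p1 (ltW u0).
have hpq : p - q <= G%:R^-1.
  move: h2; rewrite -natr1 mulrDl mul1r -/q; lra.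
have hpq0 : 0 <= p - q by rewrite subr_ge0.
set S1 := \sum_(2 <= i < N) tilt_drift th p _ in k2 *.
set S2 := \sum_(2 <= i < N) tilt_drift th q _ in k2 Hj.
set I1 := drift_int tau th p in k1 *; set I2 := drift_int tau th q in k1 Hj.
set r := scale tau u in r0 Hj *.
have c0 : 0 <= 2 * drift_cst th * (p - q) by rewrite mulr_ge0//; lra.
have k3 : 2 * drift_cst th * (p - q) * (\sum_(2 <= i < N) min23 (jump tau u i))
    <= 2 * drift_cst th * (p - q) * ((B + 1) * r).
  by rewrite ler_wpM2l// hu2.
have k4 : `|r * I1 - r * I2| <= 2 * drift_cst th * (p - q) * B * r.
  by rewrite -mulrBr normrM (ger0_norm (ltW r0)) mulrC ler_wpM2r// ltW.
have k5 : (p - q) * (2 * drift_cst th * (B + B + 1) * r) <= e / 4 * r.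
  apply: (@le_trans _ _ (G%:R^-1 * (Lc * r))).
    by rewrite ler_wpM2r// mulr_ge0// ltW.
  by rewrite mulrA ler_wpM2r ?(ltW r0)// mulrC.
have er : 0 <= e * r by rewrite mulr_ge0// ltW.
move: k2 k4 Hj; rewrite !ler_norml => /andP[a1 a2] /andP[b1 b2] /andP[d1 d2].
by apply/andP; split; lra.
Qed.

End jump_riemann.

Section paths.
Context {R : realType}.

(** A path whose jumps are all upward cannot pass from positive to negative values
    without a zero.  At the infimum of the negative times the value is <= 0,
    because a drop just after it is small, and >= 0, because a drop just before
    it is small.  The constant [L] may depend on the tolerance [dl]: the path will
    be the uniform limit of partial sums whose constants are unbounded. *)
Lemma zero_crossing (f : R -> R) : 0 < f 0 -> f 1 < 0 ->
  (forall dl, 0 < dl -> exists2 L, 0 <= L &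
     forall s t, 0 <= s <= t -> t <= 1 -> f s - dl - L * (t - s) <= f t) ->
  exists2 p, 0 <= p <= 1 & f p = 0.
Proof.
move=> f0 f1 low; pose A := [set p | 0 <= p <= 1 /\ f p < 0].
have A1 : A 1 by split => //; rewrite ler01 lexx.
have lbA : has_lbound A by exists 0 => p [/andP[]].
have hA : has_inf A by split => //; exists 1.
pose p0 := inf A.
have p00 : 0 <= p0 by apply: lb_le_inf; [exists 1|move=> p [/andP[]]].
have p01 : p0 <= 1 by exact: ge_inf.
have fp0 : f p0 <= 0.
  apply/ler_addgt0Pr => e e0; rewrite add0r.
  have e20 : 0 < e / 2 by rewrite divr_gt0.
  have [L L0 HL] := low _ e20.
  have d0 : 0 < e / 2 / (L + 1) by rewrite divr_gt0//; lra.
  have [a [/andP[a0 a1] fa] aA] := inf_adherent d0 hA.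
  have p0a : p0 <= a by apply: ge_inf => //; split => //; rewrite a0.
  have := HL p0 a; rewrite p00 p0a => /(_ isT a1).
  have : (a - p0) * (L + 1) <= e / 2.
    by rewrite -ler_pdivlMr; [rewrite -/p0 in aA; lra|lra].
  lra.
have p0_gt0 : 0 < p0.
  by rewrite lt_neqAle p00 andbT; apply/eqP => p0E; move: fp0; rewrite -p0E leNgt f0.
exists p0; first by rewrite p00.
apply/eqP; rewrite eq_le fp0/=; apply/ler_addgt0Pr => e e0.
have e20 : 0 < e / 2 by rewrite divr_gt0.
have [L L0 HL] := low _ e20.
have d0 : 0 < e / 2 / (L + 1) by rewrite divr_gt0//; lra.
pose s := Num.max 0 (p0 - e / 2 / (L + 1)).
have s0 : 0 <= s by rewrite le_max lexx.
have sp : s < p0 by rewrite gt_max p0_gt0/=; lra.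
have fs : 0 <= f s.
  rewrite leNgt; apply/negP => fs; have : p0 <= s.
    by apply: ge_inf => //; split => //; rewrite s0/= (le_trans (ltW sp)).
  by rewrite leNgt sp.
have := HL s p0; rewrite s0 (ltW sp) => /(_ isT p01).
have sl : p0 - e / 2 / (L + 1) <= s by rewrite le_max lexx orbT.
have : (p0 - s) * (L + 1) <= e / 2.
  by rewrite -ler_pdivlMr; lra.
lra.
Qed.

End paths.

Section process_decomposition.
Context {d : measure_display} {Omega : measurableType d} {R : realType}.
Variable P : probability Omega R.
Variables (tau beta : R) (T : nat -> {RV P >-> R}).

Lemma S_proc_jump_sum (u p : R) (N : nat) (w : Omega) : (2 <= N)%N ->
  cvgn (fun n => jump_sum tau T u N n p w) ->
  u * S_proc tau beta T (p * u) w =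
  u + beta * p * u ^+ 2 + jump_sum tau T u 2 N p w +
  limn (fun n => jump_sum tau T u N n p w).
Proof.
move=> N2 cv; have [->|u0] := eqVneq u 0.
  have z m n : jump_sum tau T 0 m n p w = 0.
    by rewrite /jump_sum big1// => i _; rewrite /jump !mul0r.
  rewrite z mul0r expr0n/= mulr0 !add0r; apply/esym.
  under eq_fun do rewrite z.
  exact: lim_cst.
rewrite /S_proc; set s := (X in limn X).
have sE n : s n = u^-1 * jump_sum tau T u 2 n p w.
  rewrite /s /jump_sum mulr_sumr; apply: eq_bigr => i _; rewrite /jump.
  by rewrite !mulrA mulVf// mul1r -!mulrA; congr (_ * (_ - _)); ring.
have lims : s n @[n --> \oo] --> u^-1 * (jump_sum tau T u 2 N p w +
    limn (fun n => jump_sum tau T u N n p w)).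
  have h : u^-1 * (jump_sum tau T u 2 N p w + jump_sum tau T u N n p w) @[n --> \oo]
    --> u^-1 * (jump_sum tau T u 2 N p w + limn (fun n => jump_sum tau T u N n p w)).
    apply: cvgM; first exact: cvg_cst.
    by apply: cvgD => //; exact: cvg_cst.
  apply: cvg_trans h; apply: near_eq_cvg; near=> n.
  rewrite sE (@jump_sum_cat _ _ _ _ tau T u 2 N n)// N2/=.
  by near: n; exact: nbhs_infty_ge.
rewrite (cvg_lim _ lims)//; field.
Unshelve. all: by end_near. Qed.

End process_decomposition.

(** * Concentration under the tilt *)

Section tilted_concentration.
Context {d : measure_display} {Omega : measurableType d} {R : realType}.
Variable P : probability Omega R.
Variables (tau : R) (T : nat -> {RV P >-> R}).
Hypothesis htau : 3 < tau < 4.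
Hypothesis hexp : forall i : nat, (2 <= i)%N -> exponential_rv (T i).
Hypothesis hmean : forall i : nat, (2 <= i)%N ->
  ('E_P[T i] = (i%:R `^ alpha tau)%:E)%E.
Hypothesis hindep : independent_rvs [set i : nat | (2 <= i)%N] T.

Definition drift_sum (th u : R) (m0 N : nat) (p : R) : R :=
  \sum_(m0 <= i < N) tilt_drift th p (jump tau u i).

Definition grid_index (G : nat) : seq (nat * bool) :=
  allpairs pair (iota 0 G.+1) [:: true; false].

(** The Chernoff bound for the deviation, at one time of a grid and in one
    direction, of the sum from its tilted mean. *)
Definition grid_term (th u lam e : R) (m0 N G : nat) (x : nat * bool) (w : Omega) : R :=
  expR ((-1) ^+ x.2 * lam * jump_sum tau T u m0 N (x.1%:R / G%:R) w) *
  expR (- ((-1) ^+ x.2 * lam * drift_sum th u m0 N (x.1%:R / G%:R))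
        - lam * (e * scale tau u)).

Definition grid_excess th u lam e m0 N G w : R :=
  \sum_(x <- grid_index G) grid_term th u lam e m0 N G x w.

Lemma size_grid_index G : size (grid_index G) = (G.+1 * 2)%N.
Proof. by rewrite size_allpairs size_iota. Qed.

Lemma grid_term_ge0 th u lam e m0 N G x w : 0 <= grid_term th u lam e m0 N G x w.
Proof. by rewrite mulr_ge0 ?expR_ge0. Qed.

Lemma grid_excess_ge0 th u lam e m0 N G w : 0 <= grid_excess th u lam e m0 N G w.
Proof. by apply: sumr_ge0 => x _; exact: grid_term_ge0. Qed.

Lemma measurable_grid_term th u lam e m0 N G x :
  measurable_fun setT (grid_term th u lam e m0 N G x).
Proof.
apply: measurable_funM => //; apply: measurableT_comp => //.
by apply: measurable_funM => //; exact: measurable_jump_sum.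
Qed.

Lemma measurable_grid_excess th u lam e m0 N G :
  measurable_fun setT (grid_excess th u lam e m0 N G).
Proof. by apply: measurable_sum => x; exact: measurable_grid_term. Qed.

(** Under the tilt the second-order term of each exponential moment is at most
    2 exp th lam^2 min23 v, and these terms add up to O(lam^2 scale). *)
Lemma integral_grid_excess_le (th u lam e B : R) (sig : nat -> R) (m0 N G : nat) :
  0 <= th -> 0 < u -> 0 < lam <= 2^-1 -> (2 <= m0 <= N)%N -> (0 < G)%N ->
  (forall i, 0 <= sig i <= 1) ->
  \sum_(m0 <= i < N) min23 (jump tau u i) <= B * scale tau u ->
  (\int[P]_w (weight tau T th u sig m0 N w * grid_excess th u lam e m0 N G w)%:E <=
    ((G.+1 * 2)%:R * (weight_mass tau th u sig m0 N *
      expR (scale tau u * (2 * expR th * B * lam ^+ 2 - lam * e))))%:E)%E.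
Proof.
move=> th0 u0 /andP[lam0 lamh] m02 G0 sig01 hB.
rewrite -size_grid_index.
rewrite (eq_integral (fun w => (\sum_(x <- grid_index G)
    (weight tau T th u sig m0 N w * grid_term th u lam e m0 N G x w))%:E)); last first.
  by move=> w _; rewrite /grid_excess mulr_sumr.
apply: integral_sum_seq_le.
- by move=> x; apply: measurable_funM;
    [exact: measurable_weight|exact: measurable_grid_term].
- by move=> x w; rewrite mulr_ge0 ?weight_ge0// grid_term_ge0.
move=> [j s] js; have jG : (j <= G)%N.
  by case/allpairsP: js => -[j' s'] [+ _ [-> _]]; rewrite mem_iota add0n ltnS.
set p := j%:R / G%:R : R; set l := (-1) ^+ s * lam.
have p01 : 0 <= p <= 1.
  by rewrite /p divr_ge0//= ler_pdivrMr ?ltr0n// mul1r ler_nat.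
have lN : `|l| = lam.
  by rewrite /l normrM normrX normrN1 expr1n mul1r gtr0_norm.
have l2 : l ^+ 2 = lam ^+ 2 by rewrite -[LHS]ger0_norm ?sqr_ge0// normrX lN.
under eq_integral do rewrite /grid_term/= mulrA EFinM muleC.
rewrite ge0_integralZl//=; last 2 first.
- apply/measurable_EFinP/measurable_funM; first exact: measurable_weight.
  by apply: measurableT_comp => //; apply: measurable_funM => //;
    exact: measurable_jump_sum.
- by move=> w _; rewrite lee_fin mulr_ge0 ?weight_ge0 ?expR_ge0.
have z01 : 0 <= (0 : R) <= 1 by rewrite lexx ler01.
have /= H := integral_weight_exp hexp hmean hindep th N l 0 m02 (leqnn N) u0 sig01 p01 z01.
rewrite (eq_integral (fun w => (weight tau T th u sig m0 N w *
    expR (l * jump_sum tau T u m0 N p w) *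
    expR (0 * jump_sum tau T u N N 0 w))%:E)); last first.
  by move=> w _; rewrite mul0r expR0 mulr1.
rewrite H [\prod_(N <= i < N) _]big_geq// mulr1.
rewrite -EFinM lee_fin mulrCA ler_wpM2l//.
  by apply: weight_mass_ge0; [exact: ltW|move=> i; case/andP: (sig01 i)].
have h1 : \prod_(m0 <= i < N) ((1 + tilt_cdf th p (jump tau u i) *
      (expR (l * jump tau u i) - 1)) * expR (- (l * (p * jump tau u i ^+ 2))))
   <= expR (l * drift_sum th u m0 N p +
        2 * expR th * l ^+ 2 * \sum_(m0 <= i < N) min23 (jump tau u i)).
  rewrite /drift_sum !mulr_sumr -big_split/= expR_sum; apply: ler_prod => i _.
  have v0 := jump_ge0 tau i (ltW u0).
  rewrite tilt_factor_le ?lN// andbT mulr_ge0 ?expR_ge0//.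
  have q01 := tilt_cdf_range th p01 v0.
  by apply: le_trans (expR_mul_le_mix (l * jump tau u i) q01); exact: expR_ge0.
apply: le_trans (ler_wpM2l (expR_ge0 _) h1) _.
rewrite -expRD ler_expR l2.
have h2 : 2 * expR th * lam ^+ 2 * (\sum_(m0 <= i < N) min23 (jump tau u i)) <=
   2 * expR th * lam ^+ 2 * (B * scale tau u).
  by rewrite ler_wpM2l// mulr_ge0 ?sqr_ge0// mulr_ge0 ?expR_ge0.
by rewrite /l; lra.
Qed.

Lemma grid_excess_lt1 (th u lam e : R) (m0 N G j : nat) (w : Omega) :
  0 < lam -> grid_excess th u lam e m0 N G w < 1 -> (j <= G)%N ->
  `|jump_sum tau T u m0 N (j%:R / G%:R) w - drift_sum th u m0 N (j%:R / G%:R)|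
    <= e * scale tau u.
Proof.
move=> lam0 ex jG.
have key (s : bool) : (-1) ^+ s * (jump_sum tau T u m0 N (j%:R / G%:R) w -
    drift_sum th u m0 N (j%:R / G%:R)) <= e * scale tau u.
  have xb : (j, s) \in grid_index G.
    apply: (@allpairs_f _ _ _ pair); last by case: s; rewrite !inE.
    by rewrite mem_iota add0n ltnS.
  have := le_sum_seq (fun y => grid_term_ge0 th u lam e m0 N G y w) xb.
  move=> /le_lt_trans/(_ ex); rewrite /grid_term/= -expRD -expR0 ltr_expR => h.
  rewrite -(ler_pM2l lam0); lra.
have := key false; have := key true; rewrite expr0 expr1 mul1r mulN1r => h1 h2.
by rewrite ler_norml; apply/andP; split; lra.
Qed.

(** Between two times of the grid the sum decreases by at most its compensator, and
    the mean varies little; monotonicity of the indicators does the rest. *)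
Lemma jump_sum_near_drift (th u lam e : R) (m0 N G : nat) (w : Omega) (p : R) :
  0 <= th -> 0 < u -> 0 < lam -> (0 < G)%N ->
  grid_excess th u lam e m0 N G w < 1 -> 0 <= p <= 1 ->
  `|jump_sum tau T u m0 N p w - drift_sum th u m0 N p| <= e * scale tau u +
    G%:R^-1 * (\sum_(m0 <= i < N) jump tau u i ^+ 2 +
      2 * drift_cst th * \sum_(m0 <= i < N) min23 (jump tau u i)).
Proof.
move=> th0 u0 lam0 G0 ex p01; have [j jG /andP[h1 h2]] := grid_cell G0 p01.
have g0 : 0 < G%:R :> R by rewrite ltr0n.
have H1 := grid_excess_lt1 lam0 ex (ltnW jG); have H2 := grid_excess_lt1 lam0 ex jG.
set q1 := j%:R / G%:R in h1 H1; set q2 := j.+1%:R / G%:R in h2 H2.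
have q10 : 0 <= q1 by rewrite divr_ge0.
have q21 : q2 <= 1 by rewrite ler_pdivrMr// mul1r ler_nat.
have q12 : q2 - q1 = G%:R^-1 by rewrite /q2 -natr1 mulrDl mul1r addrC addKr.
have [p0 p1] := andP p01.
have c1 := jump_sum_lipschitz tau T m0 N w (ltW u0) h1.
have c2 := jump_sum_lipschitz tau T m0 N w (ltW u0) h2.
have q1p : 0 <= q1 <= p by rewrite q10.
have pq2 : 0 <= p <= q2 by rewrite p0.
have d1 := @sum_drift_lipschitz _ tau th q1 p u m0 N th0 q1p p1 (ltW u0).
have d2 := @sum_drift_lipschitz _ tau th p q2 u m0 N th0 pq2 q21 (ltW u0).
set S := \sum_(m0 <= i < N) jump tau u i ^+ 2 in c1 c2 *.
set Z := \sum_(m0 <= i < N) min23 _ in d1 d2 *.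
have S0 : 0 <= S by apply: sumr_ge0 => i _; exact: sqr_ge0.
have Z0 : 0 <= Z by apply: sumr_ge0 => i _; rewrite min23_ge0// jump_ge0// ltW.
have D1 := drift_cst_ge1 th0.
have e1 : 0 <= (q2 - p) * S by rewrite mulr_ge0// subr_ge0.
have e2 : 0 <= (p - q1) * S by rewrite mulr_ge0// subr_ge0.
have DZ : 0 <= 2 * drift_cst th * Z by rewrite mulr_ge0//; lra.
have e3 : 0 <= (q2 - p) * (2 * drift_cst th * Z) by rewrite mulr_ge0// subr_ge0.
have e4 : 0 <= (p - q1) * (2 * drift_cst th * Z) by rewrite mulr_ge0// subr_ge0.
rewrite -q12; move: H1 H2 d1 d2; rewrite /drift_sum.
set A := \sum_(m0 <= i < N) tilt_drift th p _.
set A1 := \sum_(m0 <= i < N) tilt_drift th q1 _.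
set A2 := \sum_(m0 <= i < N) tilt_drift th q2 _.
rewrite !ler_norml => /andP[a1 a2] /andP[b1 b2] /andP[d1 d1'] /andP[d2 d2'].
by apply/andP; split; lra.
Qed.

Lemma integral_weight (th u : R) (sig : nat -> R) (m0 N : nat) :
  0 < u -> (2 <= m0 <= N)%N -> (forall i, 0 <= sig i <= 1) ->
  (\int[P]_w (weight tau T th u sig m0 N w)%:E =
    (weight_mass tau th u sig m0 N)%:E)%E.
Proof.
move=> u0 m02 sig01; have z01 : 0 <= (0 : R) <= 1 by rewrite lexx ler01.
have /= H := integral_weight_exp hexp hmean hindep th N 0 0 m02 (leqnn N) u0 sig01 z01 z01.
transitivity (\int[P]_w (weight tau T th u sig m0 N w *
    expR (0 * jump_sum tau T u m0 N 0 w) * expR (0 * jump_sum tau T u N N 0 w))%:E)%E.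
  by apply: eq_integral => w _; rewrite !mul0r expR0 !mulr1.
rewrite H [\prod_(N <= i < N) _]big_geq// mulr1 big1 ?mulr1// => i _.
by rewrite !mul0r expR0 subrr mulr0 addr0 oppr0 expR0 mul1r.
Qed.

End tilted_concentration.

(** * Straying from the limit path while surviving *)

Section choices.
Context {R : realType}.
Implicit Types (C e A K r x y : R).

(** The quadratic cost of the tilt is beaten by its linear gain. *)
Lemma exists_small_tilt C e : 0 < C -> 0 < e ->
  exists2 lam, 0 < lam <= 2^-1 & exists2 c, 0 < c &
    C * lam ^+ 2 - lam * e <= - c.
Proof.
move=> C0 e0; have C20 : 0 < 2 * C by rewrite mulr_gt0.
pose lam := Num.min 2^-1 (e / (2 * C)).
have lam0 : 0 < lam by rewrite lt_min invr_gt0 ltr0n/= divr_gt0.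
have lamC : lam * (2 * C) <= e by rewrite -ler_pdivlMr// ge_min lexx orbT.
exists lam; first by rewrite lam0 ge_min lexx.
exists (lam * e / 2); first by rewrite divr_gt0// mulr_gt0.
have : lam * (lam * (2 * C)) <= lam * e by rewrite ler_wpM2l// ltW.
lra.
Qed.

Lemma exists_fine_grid A e : 0 <= A -> 0 < e ->
  exists2 G : nat, (0 < G)%N & G%:R^-1 * A <= e.
Proof.
move=> A0 e0; exists (Num.truncn (A / e)).+1 => //.
have : A / e < (Num.truncn (A / e)).+1%:R by exact: truncnS_gt.
by rewrite ltr_pdivrMr// => h; rewrite mulrC ler_pdivrMr// mulrC ltW.
Qed.

Lemma exists_cutoff K r : 1 <= K -> 1 <= r ->
  exists N : nat, [/\ (2 <= N)%N, K * r < N%:R & N%:R / r <= K + 1].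
Proof.
move=> K1 r1; have r0 : 0 < r by exact: lt_le_trans r1.
have Kr1 : 1 <= K * r by have := ler_pM ler01 ler01 K1 r1; rewrite mulr1.
exists (Num.truncn (K * r)).+1; split; [by rewrite ltnS truncn_gt0|exact: truncnS_gt|].
rewrite ler_pdivrMr// -natr1; have := truncn_le (K * r).
rewrite (le_trans ler01 Kr1); lra.
Qed.

End choices.

Section upper_bound_tools.
Context {d : measure_display} {Omega : measurableType d} {R : realType}.
Variable P : probability Omega R.
Variables (tau beta : R) (T : nat -> {RV P >-> R}).

Lemma measure_le_integral (A : set Omega) (f : Omega -> \bar R) :
  measurable A -> measurable_fun setT f -> (forall w, (0 <= f w)%E) ->
  (forall w, A w -> (1 <= f w)%E) -> (P A <= \int[P]_w f w)%E.
Proof.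
move=> mA mf f0 f1; rewrite -[in leLHS](setIT A) -integral_indic//.
apply: ge0_le_integral => //.
  by apply/measurable_EFinP; exact: measurable_indic.
move=> w _; rewrite indicE; case: (boolP (w \in A)) => [|_]; last exact: f0.
by rewrite inE => /f1.
Qed.

(** Only an infimum of zeros is known to exceed u.  Were the process negative at
    time u, it would have a zero before u, as it has no downward jumps. *)
Lemma survival_end_ge0 (u : R) (N : nat) (w : Omega) : 0 < u -> (2 <= N)%N ->
  (forall p, 0 <= p <= 1 -> cvgn (fun n => jump_sum tau T u N n p w)) ->
  (forall dl, 0 < dl -> exists2 n, (N <= n)%N & forall p, 0 <= p <= 1 ->
    `|limn (fun n => jump_sum tau T u N n p w) - jump_sum tau T u N n p w| <= dl) ->
  (u%:E < H1 tau beta T w)%E -> 0 <= u * S_proc tau beta T (1 * u) w.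
Proof.
move=> u0 N2 cv unif hH; rewrite leNgt; apply/negP => f1.
pose f p := u * S_proc tau beta T (p * u) w.
have fE p : 0 <= p <= 1 -> f p = u + beta * p * u ^+ 2 + jump_sum tau T u 2 N p w +
    limn (fun n => jump_sum tau T u N n p w).
  by move=> p01; rewrite /f (S_proc_jump_sum beta N2)//; exact: cv.
have z01 : 0 <= (0 : R) <= 1 by rewrite lexx ler01.
have J0 m n : 0 <= jump_sum tau T u m n 0 w.
  apply: sumr_ge0 => i _; rewrite !mul0r subr0 mulr_ge0//; exact/jump_ge0/ltW.
have f0 : 0 < f 0.
  rewrite fE// mulr0 mul0r addr0 -addrA ltr_pwDl// addr_ge0//.
  by apply: limr_ge; [exact: cv|exact: nearW].
have [|p /andP[p0 p1] fp] := zero_crossing f0 f1.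
  move=> dl dl0; have dl20 : 0 < dl / 2 by rewrite divr_gt0.
  have [n Nn hn] := unif _ dl20.
  exists (`|beta| * u ^+ 2 + \sum_(2 <= i < n) jump tau u i ^+ 2).
    apply: addr_ge0; first by apply: mulr_ge0 => //; exact: sqr_ge0.
    by apply: sumr_ge0 => i _; exact: sqr_ge0.
  move=> s t /andP[s0 st] t1.
  have s01 : 0 <= s <= 1 by rewrite s0 (le_trans st).
  have t01 : 0 <= t <= 1 by rewrite t1 (le_trans s0).
  have N2n : (2 <= N <= n)%N by rewrite N2.
  have c1 := jump_sum_cat tau T u s w N2n; have c2 := jump_sum_cat tau T u t w N2n.
  have h1 := hn s s01; have h2 := hn t t01.
  have h3 := jump_sum_lipschitz tau T 2 n w (ltW u0) st.
  rewrite !fE//; move: h1 h2; rewrite !ler_norml => /andP[a1 a2] /andP[b1 b2].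
  have h4 : - (`|beta| * u ^+ 2 * (t - s)) <= beta * t * u ^+ 2 - beta * s * u ^+ 2.
    have -> : beta * t * u ^+ 2 - beta * s * u ^+ 2 = beta * (u ^+ 2 * (t - s)) by ring.
    have us : 0 <= u ^+ 2 * (t - s) by rewrite mulr_ge0 ?sqr_ge0// subr_ge0.
    have : - `|beta| * (u ^+ 2 * (t - s)) <= beta * (u ^+ 2 * (t - s)).
      by rewrite ler_wpM2r// lerNl -normrN ler_norm.
    lra.
  move: h3; rewrite c1 c2 mulrDl; lra.
have Sp : S_proc tau beta T (p * u) w = 0.
  by apply/eqP; move/eqP: fp; rewrite /f mulf_eq0 gt_eqF.
have : (H1 tau beta T w <= (p * u)%:E)%E.
  apply: ereal_inf_lbound; exists (p * u) => //; split => //.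
  by rewrite mulr_ge0// ltW.
by move=> /(lt_le_trans hH); rewrite lte_fin ltNge ler_piMl ?(ltW u0).
Qed.

Lemma weight_massE (th u : R) (sig : nat -> R) (m0 N : nat) : 0 <= u ->
  weight_mass tau th u sig m0 N =
  \prod_(2 <= i < m0) (1 - expR (- (sig i * jump tau u i))) *
  expR (\sum_(m0 <= i < N) tilt_rate th (jump tau u i) +
        th * \sum_(m0 <= i < N) jump tau u i ^+ 2).
Proof.
move=> u0; rewrite /weight_mass mulr_sumr -big_split/= expR_sum; congr (_ * _).
apply: eq_bigr => i _; rewrite /tilt_rate subrK lnK// posrE.
by apply: tilt_mass_gt0; exact: jump_ge0.
Qed.

Lemma weightE (th u : R) (sig : nat -> R) (m0 N : nat) (w : Omega) :
  weight tau T th u sig m0 N w =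
  \prod_(2 <= i < m0) (T i w <= sig i * u)%R%:R *
  expR (th * (jump_sum tau T u m0 N 1 w + \sum_(m0 <= i < N) jump tau u i ^+ 2)).
Proof.
rewrite /weight -big_split/= mulr_sumr expR_sum; congr (_ * _).
by apply: eq_bigr => i _; congr expR; rewrite mul1r; ring.
Qed.

End upper_bound_tools.

(** On survival the rescaled process is nonnegative at time u, hence the sum over
    the tilted indices is at least - rho * scale there.  So the density of the
    tilt is at least exp (- th rho scale), while its mean is about
    exp (scale Lambda), both up to the same compensators.  A deviation at some
    time has tilted probability at most about exp (- c scale), and rho is so small
    that this gain prevails.  The other way to fail is a deviation of the tail,
    whose price is as large as wanted. *)
Lemma upper_bound {d : measure_display} {Omega : measurableType d} {R : realType}
    (P : probability Omega R) (tau beta : R) (T : nat -> {RV P >-> R})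
    (htau : 3 < tau < 4)
    (hexp : forall i : nat, (2 <= i)%N -> exponential_rv (T i))
    (hmean : forall i : nat, (2 <= i)%N ->
      ('E_P[T i] = (i%:R `^ alpha tau)%:E)%E)
    (hindep : independent_rvs [set i : nat | (2 <= i)%N] T)
    (th : R) (hth : is_theta_star tau th) (eps : R) : 0 < eps ->
  exists2 dl, 0 < dl & exists2 u0, 1 <= u0 & forall u, u0 <= u ->
  exists E : set Omega, [/\ measurable E,
    (P E <= (expR (scale tau u * (rate_int tau th - dl)))%:E)%E &
    forall w, ~ E w -> (u%:E < H1 tau beta T w)%E ->
      (ereal_sup [set (`|S_proc tau beta T (p * u) w
           - u `^ (tau - 2) * I_E tau th p|)%:E | p in `[0%R, 1%R]]
         <= (u `^ (tau - 2) * eps)%:E)%E].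
Proof.
move=> eps0; have t0 := theta_star_gt0 hth; have tge0 := ltW t0.
set B := profile_int tau; have B0 : 0 <= B := profile_int_ge0 tau.
set Lam := rate_int tau th.
have D1 := drift_cst_ge1 tge0.
pose C1 := 2 * expR th * (B + 1).
have C10 : 0 < C1 by rewrite mulr_gt0 ?mulr_gt0 ?expR_gt0//; move: B0; clear; lra.
have C1E : 2 * expR th * (B + 1) = C1 by [].
(* the errors below add up to at most 4 * eta * scale *)
pose eta := eps / 8; have eta0 : 0 < eta by rewrite divr_gt0.
have eE : eps = 8 * eta by rewrite /eta; field.
clearbody C1 eta.
have [lam lamh [c c0 hc]] := exists_small_tilt C10 eta0.
have lam0 : 0 < lam by case/andP: lamh.
(* rho measures the loss of the density on survival: its price th * rho has to
   stay below the gain c *)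
pose rho := Num.min eta (c / (8 * (th + 1))).
have th80 : 0 < 8 * (th + 1) by rewrite mulr_gt0// ltr_wpDl.
have rho0 : 0 < rho by rewrite lt_min eta0/= divr_gt0.
have rho_eta : rho <= eta by rewrite ge_min lexx.
have rho_c : th * rho <= c / 8.
  have : rho * (8 * (th + 1)) <= c.
    by rewrite -ler_pdivlMr// ge_min lexx orbT.
  by move: rho0; clear; lra.
clearbody rho; have rho20 : 0 < rho / 2 by rewrite divr_gt0.
have c80 : 0 < c / 8 by rewrite divr_gt0.
have [Kt Kt1 [ut ut1 Ht]] := tail_control htau hexp hmean hindep (`|Lam| + c) rho20.
have Cr : 0 <= th * (2 + drift_cst th) by rewrite mulr_ge0// addr_ge0// (le_trans ler01).
have [Mr Mr1 Hr] := riemann_jump htau Cr c80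
  (fun v v0 => @continuous_tilt_rate R th v (ltW v0))
  (fun v v0 => norm_tilt_rate_le tge0 (ltW v0)).
have [Md Md1 [ud ud1 Hd]] := riemann_drift htau tge0 eta0.
have [um um1 Hm] := sum_min23_le htau; rewrite -/B in Hm; clearbody B.
pose K := Num.max Kt (Num.max Mr Md).
have K1 : 1 <= K by rewrite le_max Kt1.
have KKt : Kt <= K by rewrite le_max lexx.
have KMr : Mr <= K by rewrite !le_max lexx orbT.
have KMd : Md <= K by rewrite !le_max lexx !orbT.
clearbody K.
have a2 : 0 < 1 - 2 * alpha tau by have := alpha_lt_half htau; clear; lra.
pose L := (K + 1) `^ (1 - 2 * alpha tau) / (1 - 2 * alpha tau).
have L0 : 0 <= L by rewrite divr_ge0 ?powR_ge0// ltW.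
have LE : (K + 1) `^ (1 - 2 * alpha tau) / (1 - 2 * alpha tau) = L by [].
clearbody L.
pose Gc := L + 2 * drift_cst th * (B + 1).
have Gc0 : 0 <= Gc by rewrite addr_ge0// mulr_ge0//; move: B0 D1; clear; lra.
have [G G0 hG] := exists_fine_grid Gc0 eta0.
have g0 : 0 < G%:R :> R by rewrite ltr0n.
have t3 : 0 < tau - 3 by rewrite subr_gt0; case/andP: htau.
have [ub ub1 Hb] := powR_ge_eventually (2 * (`|beta| + 1) / rho) t3.
have [us us1 Hs] := scale_ge_eventually htau (Num.max Mr (16 * G.+1%:R / c)).
exists (c / 4); first by rewrite divr_gt0.
exists (Num.max (Num.max ut ud) (Num.max um (Num.max ub us))).
  by rewrite !le_max ut1.
move=> u; rewrite !ge_max => /andP[/andP[utu udu] /andP[umu /andP[ubu usu]]].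
have u1 : 1 <= u by exact: le_trans utu.
have u0 : 0 < u by exact: lt_le_trans u1.
have r1 := scale_ge1 htau u1; have r0 := scale_gt0 tau u0.
have up0 : u <= 1 * scale tau u.
  by rewrite mul1r /scale le1r_powR//; case/andP: htau; clear; lra.
have := Hs u usu; rewrite ge_max => /andP[rMr rG].
set r := scale tau u in r1 r0 up0 rMr rG *.
have [N [N2 /ltW KN NK]] := exists_cutoff K1 r1.
have hKt : Kt * r <= N%:R by apply: le_trans KN; rewrite ler_wpM2r ?(ltW r0).
have hMr : Mr * r <= N%:R by apply: le_trans KN; rewrite ler_wpM2r ?(ltW r0).
have hMd : Md * r <= N%:R by apply: le_trans KN; rewrite ler_wpM2r ?(ltW r0).
have p001 : 0 < (1 : R) <= 1 by rewrite ltr01 lexx.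
have [Phi [mPhi Phi0 intPhi goodPhi]] := Ht u 1 N utu p001 up0 hKt.
rewrite -/r mul1r in intPhi goodPhi.
have hrate := Hr u N u0 rMr hMr; rewrite -/(rate_int tau th) -/Lam -/r in hrate.
have sq_le : \sum_(2 <= i < N) jump tau u i ^+ 2 <= r * L.
  apply: le_trans (sum_jump_sq_init_le htau N u0) _.
  rewrite -/r -LE ler_wpM2l ?(ltW r0)// ler_wpM2r ?invr_ge0 ?(ltW a2)//.
  by rewrite ge0_ler_powR ?nnegrE ?(ltW a2)// ?divr_ge0 ?(ltW r0)// addr_ge0// (le_trans ler01).
have m_le : \sum_(2 <= i < N) min23 (jump tau u i) <= (B + 1) * r by exact: Hm.
set Sq := \sum_(2 <= i < N) jump tau u i ^+ 2 in sq_le.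
set Mn := \sum_(2 <= i < N) min23 _ in m_le.
have ub_le : u + `|beta| * u ^+ 2 <= rho / 2 * r.
  have h := Hb u ubu; rewrite ler_pdivrMr// in h.
  have uu : u <= u ^+ 2 by rewrite expr2 ler_peMr// ltW.
  have : u ^+ 2 * (2 * (`|beta| + 1)) <= u ^+ 2 * (u `^ (tau - 3) * rho).
    by rewrite ler_wpM2l ?sqr_ge0.
  by rewrite /r scale_sqE//; move: uu; clear; lra.
pose mid := grid_excess tau T th u lam eta 2 N G.
have mid0 w : 0 <= mid w by exact: grid_excess_ge0.
have mmid : measurable_fun setT mid by exact: measurable_grid_excess.
pose sig0 : nat -> R := fun=> 0.
have sig01 i : 0 <= sig0 i <= 1 by rewrite /sig0 lexx ler01.
have m02 : (2 <= 2 <= N)%N by rewrite N2.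
pose Y1 := jump_sum tau T u 2 N 1.
have mY1 : measurable_fun setT Y1 by exact: measurable_jump_sum.
(* either a test of the tail fails, or one of the tilted sums does although their
   end value is compatible with survival *)
pose E1 := [set w | (1 <= Phi w)%E].
pose E2 := [set w | 1 <= mid w] `&` [set w | - (rho * r) <= Y1 w].
have mE1 : measurable E1.
  by rewrite /E1 -[X in measurable X]setTI; exact: emeasurable_fun_c_infty.
have mE2 : measurable E2.
  apply: measurableI.
    rewrite (_ : [set w | _] = mid @^-1` `[1, +oo[).
      by rewrite -[X in measurable X]setTI; apply: mmid.
    by apply/seteqP; split => w /=; rewrite in_itv/= andbT.
  rewrite (_ : [set w | _] = Y1 @^-1` `[- (rho * r), +oo[).
    by rewrite -[X in measurable X]setTI; apply: mY1.
  by apply/seteqP; split => w /=; rewrite in_itv/= andbT.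
exists (E1 `|` E2); split; first exact: measurableU.
- have PE1 : (P E1 <= (expR (r * (Lam - c / 2)))%:E)%E.
    apply: le_trans (measure_le_integral P mE1 mPhi Phi0 _) _ => //.
    (* for th = 0 and no forced clock the weight is the constant 1 *)
    have := intPhi 0 sig0 2%N (lexx 0) m02 sig01.
    rewrite /weight_mass big_geq// mul1r big1; last first.
      by move=> i _; rewrite /tilt_mass mul0r expR0 mul1r subrK.
    rewrite mul1r => h.
    apply: le_trans (le_trans _ h) _.
      rewrite le_eqVlt; apply/orP; left; apply/eqP; apply: eq_integral => w _.
      rewrite /weight big_geq// mul1r big1 ?mul1e// => i _.
      by rewrite !mul0r expR0.
    rewrite lee_fin ler_expR.
    have : r * (- (`|Lam| + c)) <= r * (Lam - c / 2).
      by rewrite ler_wpM2l ?(ltW r0)//; have := ler_norm (- Lam); rewrite normrN; move: c0; clear; lra.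
    by clear; lra.
  have PE2 : (P E2 <= (expR (r * (Lam - c / 2)))%:E)%E.
    pose Q := expR (th * (rho * r) - th * Sq).
    have mf : measurable_fun setT (fun w => (Q * (weight tau T th u sig0 2 N w * mid w))%:E).
      apply/measurable_EFinP; apply: measurable_funM => //; apply: measurable_funM => //.
      exact: measurable_weight.
    have wm0 w : 0 <= weight tau T th u sig0 2 N w * mid w.
      by rewrite mulr_ge0// weight_ge0.
    apply: le_trans (measure_le_integral P mE2 mf _ _) _.
    + by move=> w; rewrite lee_fin mulr_ge0 ?expR_ge0.
    + move=> w [/= w1 w2]; rewrite lee_fin mulrA.
      have h : 1 <= Q * weight tau T th u sig0 2 N w.
        rewrite weightE big_geq// mul1r -expRD -[leLHS]expR0 ler_expR -/Sq -/(Y1 w).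
        have : th * - (rho * r) <= th * Y1 w by rewrite ler_wpM2l.
        by clear; lra.
      by have := ler_pM ler01 ler01 h w1; rewrite mulr1.
    under eq_integral do rewrite EFinM.
    rewrite ge0_integralZl//=; last 3 first.
    + apply/measurable_EFinP; apply: measurable_funM => //; exact: measurable_weight.
    + by move=> w _; rewrite lee_fin.
    + by rewrite lee_fin expR_ge0.
    have h := integral_grid_excess_le hexp hmean hindep eta tge0 u0 lamh m02
      G0 sig01 m_le.
    apply: le_trans (lee_wpmul2l _ h) _; first by rewrite lee_fin expR_ge0.
    rewrite -EFinM lee_fin weight_massE ?(ltW u0)// big_geq// mul1r -/r -/Sq C1E.
    set Sr := \sum_(2 <= i < N) tilt_rate th _ in hrate *.
    have -> : Q * ((G.+1 * 2)%:R * (expR (Sr + th * Sq) *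
        expR (r * (C1 * lam ^+ 2 - lam * eta)))) =
      (G.+1 * 2)%:R * expR (th * (rho * r) + Sr + r * (C1 * lam ^+ 2 - lam * eta)).
      rewrite /Q mulrCA; congr (_ * _); rewrite -!expRD; congr expR; ring.
    have g1 : (G.+1 * 2)%:R <= expR (r * (c / 8)).
      apply: (@le_trans _ _ (r * (c / 8))).
        rewrite ler_pdivrMr// in rG; by rewrite natrM; move: rG c0; clear; lra.
      by have := expR_ge1Dx (r * (c / 8)); clear; lra.
    apply: le_trans (ler_wpM2r (expR_ge0 _) g1) _.
    rewrite -expRD ler_expR.
    have k1 : r * (C1 * lam ^+ 2 - lam * eta) <= r * - c by rewrite ler_wpM2l// ltW.
    have k2 : r * (th * rho) <= r * (c / 8) by rewrite ler_wpM2l// ltW.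
    move: hrate; rewrite ler_norml => /andP[_ k3].
    have rc : 0 <= r * c by rewrite mulr_ge0// ltW.
    by move: k1 k2 k3 rc; clear; lra.
  have PU : (P (E1 `|` E2) <= P E1 + P E2)%E by exact: measureU2.
  apply: (le_trans PU); apply: (le_trans (leeD PE1 PE2)).
  set X := expR (r * (Lam - c / 2)).
  rewrite -EFinD lee_fin (_ : X + X = 2 * X); last by ring.
  have h2 : 2 <= expR (r * (c / 4)).
    apply: (@le_trans _ _ (r * (c / 4))).
      rewrite ler_pdivrMr// in rG; have : 1 <= G.+1%:R :> R by rewrite ler1n.
      by move: rG; clear; lra.
    by have := expR_ge1Dx (r * (c / 4)); clear; lra.
  apply: le_trans (ler_wpM2r (expR_ge0 _) h2) _.
  by rewrite /X -expRD ler_expR; clear; lra.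
move=> w nE hH.
have Phi1 : (Phi w < 1)%E by rewrite ltNge; apply/negP => h; apply: nE; left.
have [cv lim_le unif] := goodPhi w Phi1.
have p11 : 0 <= (1 : R) <= 1 by rewrite ler01 lexx.
have f1 := survival_end_ge0 u0 N2 cv unif hH.
rewrite (S_proc_jump_sum beta N2) in f1; last exact: cv.
have babs p : 0 <= p <= 1 -> `|u + beta * p * u ^+ 2| <= rho / 2 * r.
  move=> /andP[p0 p1]; apply: le_trans ub_le; apply: le_trans (ler_normD _ _) _.
  rewrite ger0_norm ?(ltW u0)// lerD2l normrM (ger0_norm (sqr_ge0 u)) normrM (ger0_norm p0).
  by rewrite ler_wpM2r ?sqr_ge0// ler_piMr.
have Y1ge : - (rho * r) <= Y1 w.
  have h1 := babs 1 p11; have h2 := lim_le 1 p11.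
  move: f1 h1 h2; rewrite !ler_norml => f1 /andP[_ h1] /andP[_ h2].
  by rewrite /Y1; move: f1 h1 h2; clear; lra.
have mid1 : mid w < 1 by rewrite ltNge; apply/negP => h; apply: nE; right.
apply: ge_ereal_sup => _ [p p01' <-]; move: p01'; rewrite /= in_itv/= => p01.
rewrite lee_fin -(ler_pM2l u0).
have rE : r = u * u `^ (tau - 2) := scaleE tau u0.
set Sp := S_proc _ _ _ _ _; set Ip := I_E _ _ _.
have -> : u * (u `^ (tau - 2) * eps) = r * eps by rewrite mulrA -rE.
have -> : u * `|Sp - u `^ (tau - 2) * Ip| = `|u * Sp - r * Ip|.
  by rewrite -[X in X * _](gtr0_norm u0) -normrM mulrBr [u * (_ * Ip)]mulrA -rE.
rewrite /Sp /Ip (S_proc_jump_sum beta N2); last exact: cv.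
rewrite (I_E_drift_int htau tge0 p01).
have h1 := babs p p01; have h2 := lim_le p p01.
have h3 := jump_sum_near_drift tge0 u0 lam0 G0 mid1 p01.
have h4 := Hd u N p udu hMd p01.
rewrite -/r -/Sq -/Mn in h3; rewrite -/r in h4.
have h5 : G%:R^-1 * (Sq + 2 * drift_cst th * Mn) <= eta * r.
  apply: (@le_trans _ _ (G%:R^-1 * (Gc * r))).
    rewrite ler_wpM2l ?invr_ge0 ?(ltW g0)// /Gc.
    have : 2 * drift_cst th * Mn <= 2 * drift_cst th * ((B + 1) * r).
      by rewrite ler_wpM2l// mulr_ge0// (le_trans ler01).
    by move: sq_le; clear; lra.
  by rewrite mulrA ler_wpM2r// ltW.
have er : rho * r <= eta * r by rewrite ler_wpM2r// ltW.
have er0 : 0 <= eta * r by rewrite mulr_ge0// ltW.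
rewrite eE; move: h1 h2 h3 h4; rewrite /drift_sum.
set A := \sum_(2 <= i < N) tilt_drift th p _.
rewrite !ler_norml => /andP[b1 b2] /andP[l1 l2] /andP[j1 j2] /andP[k1 k2].
by apply/andP; split; move: b1 b2 l1 l2 j1 j2 k1 k2 h5 er er0; clear; lra.
Qed.

(** * Forcing the process to survive *)

Section lower_bound.
Context {d : measure_display} {Omega : measurableType d} {R : realType}.
Variable P : probability Omega R.
Variables (tau beta : R) (T : nat -> {RV P >-> R}).
Hypothesis htau : 3 < tau < 4.
Hypothesis hexp : forall i : nat, (2 <= i)%N -> exponential_rv (T i).
Hypothesis hmean : forall i : nat, (2 <= i)%N ->
  ('E_P[T i] = (i%:R `^ alpha tau)%:E)%E.
Hypothesis hindep : independent_rvs [set i : nat | (2 <= i)%N] T.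

Lemma onem_expRN_ge_expR (y : R) : 0 < y -> expR (- y^-1) <= 1 - expR (- y).
Proof.
move=> y0; have h1 := expR_ge1Dx y; have h2 := expR_ge1Dx y^-1.
have e1 : expR y * expR (- y) = 1 by rewrite -expRD subrr expR0.
have e2 : expR y^-1 * expR (- y^-1) = 1 by rewrite -expRD subrr expR0.
have k1 : (1 + y) * expR (- y) <= 1 by rewrite -[leRHS]e1 ler_wpM2r ?expR_ge0.
have k2 : (1 + y^-1) * expR (- y^-1) <= 1 by rewrite -[leRHS]e2 ler_wpM2r ?expR_ge0.
have k3 : (1 + y) * expR (- y^-1) <= y.
  have -> : 1 + y = y * (1 + y^-1) by field; rewrite gt_eqF.
  by rewrite -mulrA ler_piMr// ltW.
have y1 : 0 < 1 + y by lra.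
rewrite -(ler_pM2l y1); lra.
Qed.

Lemma powR_le_eventually (b e : R) : 0 < b -> 0 < e ->
  exists2 x0 : R, 0 < x0 <= 1 & forall x, 0 < x <= x0 -> x `^ b <= e.
Proof.
move=> b0 e0; exists (Num.min 1 (e `^ b^-1)).
  by rewrite lt_min ltr01 powR_gt0//= ge_min lexx.
move=> x /andP[x0]; rewrite le_min => /andP[_ xe].
have -> : e = (e `^ b^-1) `^ b by rewrite -powRrM mulVf ?gt_eqF// powRr1// ltW.
by rewrite ge0_ler_powR ?nnegrE ?powR_ge0 ?(ltW b0) ?(ltW x0).
Qed.

(** The forced clock [i] rings before [deadline kap u i * u].  The power 1 - alpha
    makes the jumps forced before any time p amount to about p scale / kap,
    more than the compensator can consume by then. *)
Definition deadline (kap u : R) (i : nat) : R :=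
  kap * (i%:R / scale tau u) `^ (1 - alpha tau).

Lemma deadline_jump kap u i : 0 < u -> (0 < i)%N ->
  deadline kap u i * jump tau u i = kap * (i%:R / scale tau u) `^ (1 - 2 * alpha tau).
Proof.
move=> u0 i0; have r0 := scale_gt0 tau u0.
rewrite /deadline jumpE// -mulrA powR_powD; last by rewrite divr_gt0// ltr0n.
by congr (_ * _ `^ _); ring.
Qed.

(** The witness is k and its jump k^(-alpha), for the first index k whose deadline
    is after p: the k - 2 clocks before it have rung, with jumps at least as
    large as that of k. *)
Lemma forced_early_path (kap u p : R) (m0 N : nat) (w : Omega) :
  0 < u -> (2 <= m0 <= N)%N -> 0 <= p < deadline kap u m0 ->
  (forall i, (2 <= i < m0)%N -> T i w <= deadline kap u i * u) ->
  exists kx : R * R, [/\ 2 <= kx.1, 0 < kx.2 <= 1,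
    p * scale tau u <= kap * u * (kx.1 * kx.2) &
    u * ((kx.1 - 2) * kx.2) - p * (\sum_(2 <= i < N) jump tau u i ^+ 2)
      <= jump_sum tau T u 2 N p w].
Proof.
move=> u0 /andP[m02 m0N] /andP[p0 pm0] forced.
have r0 := scale_gt0 tau u0; have a0 := alpha_gt0 htau.
have ex : exists k, (2 <= k)%N && (p < deadline kap u k) by exists m0; rewrite m02.
case: (ex_minnP ex) => k /andP[k2 pk] kmin.
have km0 : (k <= m0)%N by apply: kmin; rewrite m02.
have k0 : 0 < k%:R :> R by rewrite ltr0n; exact: leq_trans k2.
have x0 : 0 < k%:R `^ (- alpha tau) :> R by exact: powR_gt0.
have x1 : k%:R `^ (- alpha tau) <= 1 :> R.
  by apply: powRN_le1 (ltW a0); rewrite ler1n; exact: leq_trans k2.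
exists (k%:R, k%:R `^ (- alpha tau)); split => /=.
- by rewrite ler_nat.
- by rewrite x0.
- rewrite -ler_pdivlMr//; apply: ltW; apply: (lt_le_trans pk).
  have E1 : k%:R * k%:R `^ (- alpha tau) = k%:R `^ (1 - alpha tau) :> R.
    by rewrite -[X in X * _](powRr1 (ltW k0)) powR_powD.
  have E2 : (k%:R / scale tau u) `^ (1 - alpha tau) * scale tau u =
      k%:R `^ (1 - alpha tau) * u.
    rewrite powRM ?invr_ge0 ?(ltW k0) ?(ltW r0)// -mulrA; congr (_ * _).
    rewrite -(powR_inv1 (ltW r0)) -powRrM mulN1r -[X in _ * X](powRr1 (ltW r0)).
    by rewrite powR_powD// opprB subrK scale_alpha// ltW.
  rewrite ler_pdivlMr// E1 /deadline -[leLHS]mulrA E2.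
  by have -> : kap * u * k%:R `^ (1 - alpha tau) = kap * (k%:R `^ (1 - alpha tau) * u) by ring.
- have kN : (k <= N)%N by exact: leq_trans m0N.
  have h1 : jump_sum tau T u 2 N p w =
      \sum_(2 <= i < N) jump tau u i * (T i w <= p * u)%R%:R -
      p * (\sum_(2 <= i < N) jump tau u i ^+ 2).
    rewrite /jump_sum mulr_sumr -sumrB; apply: eq_bigr => i _; ring.
  rewrite h1 lerD2r (big_cat_nat k2 kN)/=.
  have h2 : 0 <= \sum_(k <= i < N) jump tau u i * (T i w <= p * u)%R%:R.
    by apply: sumr_ge0 => i _; rewrite mulr_ge0// jump_ge0// ltW.
  suff h3 : u * ((k%:R - 2) * k%:R `^ (- alpha tau)) <=
      \sum_(2 <= i < k) jump tau u i * (T i w <= p * u)%R%:R by lra.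
  have -> : u * ((k%:R - 2) * k%:R `^ (- alpha tau)) =
      \sum_(2 <= i < k) u * k%:R `^ (- alpha tau).
    by rewrite big_const_nat iter_addr_0 -[RHS]mulr_natl natrB//; ring.
  rewrite big_nat [leRHS]big_nat; apply: ler_sum => i /andP[i2 ik].
  have Ti : T i w <= p * u.
    apply: le_trans (forced i _) _; first by rewrite i2 (leq_trans ik).
    rewrite ler_wpM2r ?(ltW u0)// leNgt; apply/negP => pi.
    by have := kmin i; rewrite i2 pi => /(_ isT); rewrite leqNgt ik.
  rewrite Ti mulr1 /jump /c_ ler_wpM2l ?(ltW u0)//.
  apply: powRN_le; [exact: ltW|by rewrite ltr0n; exact: leq_trans i2|].
  by rewrite ler_nat ltnW.
Qed.

(** The i-th forced clock rings in time with probability 1 - exp (- y), where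
    y = kap (i / scale)^(1 - 2 alpha), and this is at least exp (- 1 / y). *)
Lemma forced_mass_ge (kap u : R) (m0 : nat) (sig : nat -> R) : 0 < u -> 0 < kap ->
  (forall i, (2 <= i < m0)%N -> sig i = deadline kap u i) ->
  expR (- (kap^-1 * (\sum_(2 <= i < m0)
     (i%:R / scale tau u) `^ (- (1 - 2 * alpha tau))))) <=
  \prod_(2 <= i < m0) (1 - expR (- (sig i * jump tau u i))).
Proof.
move=> u0 kap0 sigE; have r0 := scale_gt0 tau u0.
rewrite mulr_sumr -sumrN expR_sum big_nat [leRHS]big_nat.
apply: ler_prod => i /andP[i2 im0]; have i0 : (0 < i)%N by exact: leq_trans i2.
rewrite expR_ge0/= sigE ?i2// deadline_jump//.
have x0 : 0 < i%:R / scale tau u by rewrite divr_gt0// ltr0n.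
have y0 : 0 < kap * (i%:R / scale tau u) `^ (1 - 2 * alpha tau).
  by rewrite mulr_gt0// powR_gt0.
apply: le_trans (onem_expRN_ge_expR y0).
by rewrite ler_expR lerN2 invfM powRN.
Qed.

Lemma min23_le_sq (v : R) : min23 v <= v ^+ 2.
Proof. by rewrite /min23 ge_min lexx. Qed.

(** Before the last deadline the forced jumps outweigh all the compensators; after
    it the positive drift of the tilted clocks, which grows like p, outweighs the
    errors, which are small compared with p1 or with p. *)
Lemma forced_path_positive (kap zeta L D p1 u : R) (m0 N : nat) (w : Omega) :
  0 < u -> (2 <= m0 <= N)%N -> 0 < kap -> 0 <= L -> 0 < zeta ->
  kap * (L + 2 * zeta) <= 6^-1 -> zeta <= 8^-1 -> 16 * zeta <= D ->
  `|beta| * u ^+ 2 <= zeta * scale tau u ->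
  \sum_(2 <= i < N) jump tau u i ^+ 2 <= scale tau u * L ->
  \sum_(2 <= i < m0) jump tau u i ^+ 2 <= zeta * scale tau u ->
  0 < p1 <= deadline kap u m0 ->
  (forall i, (2 <= i < m0)%N -> T i w <= deadline kap u i * u) ->
  (forall p, 0 <= p <= 1 -> cvgn (fun n => jump_sum tau T u N n p w) /\
     `|limn (fun n => jump_sum tau T u N n p w)| <= zeta * (p * scale tau u + 2 * u)) ->
  (forall p, 0 <= p <= 1 -> p * (scale tau u * (D - 2 * zeta)) - p1 * (D / 8) * scale tau u
     <= jump_sum tau T u m0 N p w) ->
  forall p, 0 <= p <= 1 -> 0 < u * S_proc tau beta T (p * u) w.
Proof.
move=> u0 m0N kap0 L0 z0 kapL z8 zD bz SqN Sqm /andP[p10 p1d] forced tl mid p p01.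
have [cv lim_le] := tl p p01; have r0 := scale_gt0 tau u0.
have N2 : (2 <= N)%N by case/andP: m0N => h1 h2; exact: leq_trans h2.
rewrite (S_proc_jump_sum beta N2 cv).
set r := scale tau u in r0 bz SqN Sqm lim_le mid *.
set lim_p := limn _ in lim_le *.
have [p0 p1'] := andP p01.
have pr0 : 0 <= p * r by rewrite mulr_ge0// ltW.
have bp : - (zeta * (p * r)) <= beta * p * u ^+ 2.
  have : - `|beta| * (p * u ^+ 2) <= beta * (p * u ^+ 2).
    have pu2 : 0 <= p * u ^+ 2 := mulr_ge0 p0 (sqr_ge0 u).
    by rewrite ler_wpM2r// lerNl -normrN ler_norm.
  have : p * (`|beta| * u ^+ 2) <= p * (zeta * r) by rewrite ler_wpM2l.
  lra.
have zu : zeta * u <= 8^-1 * u by rewrite ler_wpM2r// ltW.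
move: lim_le; rewrite ler_norml => /andP[l1 _].
have [early|late] := ltP p (deadline kap u m0).
- have pd : 0 <= p < deadline kap u m0 by rewrite p0.
  have [[k x] [/= k2 /andP[x0 x1] prk Yge]] := forced_early_path u0 m0N pd forced.
  rewrite -/r in prk.
  have h1 : p * (\sum_(2 <= i < N) jump tau u i ^+ 2) <= p * (r * L) by rewrite ler_wpM2l.
  have L2 : 0 <= L + 2 * zeta by lra.
  have h2 : p * r * (L + 2 * zeta) <= kap * u * (k * x) * (L + 2 * zeta).
    by rewrite ler_wpM2r.
  have ukx : 0 <= u * (k * x) by rewrite mulr_ge0 ?(ltW u0)// mulr_ge0 ?(ltW x0)//; lra.
  have h3 : u * (k * x) * (kap * (L + 2 * zeta)) <= u * (k * x) * 6^-1 by rewrite ler_wpM2l.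
  have h4 : 0 <= u * (x * (k - 2)).
    by rewrite mulr_ge0 ?(ltW u0)// mulr_ge0 ?(ltW x0)//; lra.
  have h5 : u * x <= u * 1 by rewrite ler_wpM2l// ltW.
  lra.
- have p1p : p1 <= p by exact: le_trans late.
  have N2c : (2 <= m0 <= N)%N by [].
  rewrite (jump_sum_cat tau T u p w N2c).
  have h1 : - (p * (zeta * r)) <= jump_sum tau T u 2 m0 p w.
    apply: (@le_trans _ _ (- (p * \sum_(2 <= i < m0) jump tau u i ^+ 2))).
      by rewrite lerN2 ler_wpM2l.
    rewrite /jump_sum mulr_sumr -sumrN; apply: ler_sum => i _.
    have v0 := jump_ge0 tau i (ltW u0).
    have : 0 <= jump tau u i * (T i w <= p * u)%R%:R by rewrite mulr_ge0.
    lra.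
  have h2 := mid p p01.
  have D0 : 0 < D by lra.
  have h3 : p1 * (D / 8 * r) <= p * (D / 8 * r).
    by rewrite ler_wpM2r// mulr_ge0 ?(ltW r0)//; lra.
  have p0' : 0 < p by exact: lt_le_trans p1p.
  have h4 : 0 <= p * r * (D - 16 * zeta) by rewrite mulr_ge0// subr_ge0.
  have h5 : 0 < p * r * D by rewrite !mulr_gt0.
  lra.
Qed.

(** Near time 0 the tail has to be small compared with p scale + u, not with
    scale.  The control on [0, p0] is used for all p0 on a grid of mesh about
    u / scale; there are at most exp (u / 2) of them, and each fails with
    probability exp (- u). *)
Lemma multiscale_tail (zeta : R) : 0 < zeta ->
  exists2 K, 1 <= K & exists2 u0, 1 <= u0 & forall u N, u0 <= u ->
  K * scale tau u <= N%:R ->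
  exists Psi : Omega -> \bar R, [/\ measurable_fun setT Psi,
    forall w, (0 <= Psi w)%E,
    forall th sig m0, 0 <= th -> (2 <= m0 <= N)%N -> (forall i, 0 <= sig i <= 1) ->
      (\int[P]_w ((weight tau T th u sig m0 N w)%:E * Psi w) <=
        (weight_mass tau th u sig m0 N * 4^-1)%:E)%E &
    forall w, (Psi w < 1)%E -> forall p, 0 <= p <= 1 ->
      cvgn (fun n => jump_sum tau T u N n p w) /\
      `|limn (fun n => jump_sum tau T u N n p w)| <= zeta * (p * scale tau u + 2 * u)].
Proof.
move=> z0; have [K K1 [u1 u11 H]] := tail_control htau hexp hmean hindep 1 z0.
have h20 : 0 < 2^-1 :> R by rewrite invr_gt0.
have [u2 u21 H2] := @powR_le_expR_eventually R (tau - 1) 1 2^-1 ltr01 h20.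
exists K => //; exists (Num.max u1 (Num.max u2 6)); first by rewrite le_max u11.
move=> u N; rewrite !ge_max => /andP[uu1 /andP[uu2 u6]] KN.
have u0 : 0 < u by lra.
have r0 := scale_gt0 tau u0; set r := scale tau u in r0 KN *.
have ur : u <= r by rewrite /r /scale le1r_powR//; case/andP: htau; lra.
pose G := Num.truncn (r / u).
have ru0 : 0 <= r / u by rewrite divr_ge0// ltW.
have ru1 : 1 <= r / u by rewrite ler_pdivlMr// mul1r.
have G0 : (0 < G)%N by rewrite truncn_gt0.
have g0 : 0 < G%:R :> R by rewrite ltr0n.
have g1 : 1 <= G%:R :> R by rewrite ler1n.
have Gle : G%:R <= r / u by have := truncn_le (r / u); rewrite ru0.
have Gge : r / u <= 2 * G%:R.
  have := truncnS_gt (r / u); rewrite -/G -natr1; lra.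
have p0P j : (j < G)%N -> 0 < (j.+1%:R / G%:R : R) <= 1 /\ u <= j.+1%:R / G%:R * r.
  move=> jG; split.
    by rewrite divr_gt0 ?ltr0n//= ler_pdivrMr// mul1r ler_nat.
  apply: (@le_trans _ _ (G%:R^-1 * r)).
    by rewrite mulrC ler_pdivlMr// mulrC -ler_pdivlMr.
  by rewrite ler_wpM2r ?(ltW r0)// ler_peMl ?invr_ge0 ?(ltW g0)// ler1n.
have /choice[Phi HPhi] : forall j : nat, exists Phi : Omega -> \bar R,
    [/\ measurable_fun setT Phi, forall w, (0 <= Phi w)%E &
     (j < G)%N -> (forall th sig m0, 0 <= th -> (2 <= m0 <= N)%N ->
       (forall i, 0 <= sig i <= 1) ->
      (\int[P]_w ((weight tau T th u sig m0 N w)%:E * Phi w) <=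
        (weight_mass tau th u sig m0 N * expR (- u))%:E)%E) /\
      forall w, (Phi w < 1)%E -> forall p, 0 <= p <= j.+1%:R / G%:R ->
      cvgn (fun n => jump_sum tau T u N n p w) /\
      `|limn (fun n => jump_sum tau T u N n p w)| <= zeta * (j.+1%:R / G%:R * r)].
  move=> j; have [jG|jG] := ltnP j G; last by exists (cst 0%E); split.
  have [p01 up0] := p0P j jG.
  have [Phi [mPhi Phi0 int_le good]] := H u _ N uu1 p01 up0 KN.
  exists Phi; split => // _; split.
    move=> th sig m0 th0 m0N sig01; apply: le_trans (int_le th sig m0 th0 m0N sig01) _.
    rewrite lee_fin ler_wpM2l//; last by rewrite ler_expR mulN1r lerN2.
    by apply: weight_mass_ge0; [exact: ltW|move=> i; case/andP: (sig01 i)].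
  move=> w /good[cv le_lim _] p pp0; split; [exact: cv|exact: le_lim].
have mPhi j : measurable_fun setT (Phi j) by case: (HPhi j).
have Phi0 j w : (0 <= Phi j w)%E by case: (HPhi j).
exists (fun w => \sum_(0 <= j < G) Phi j w)%E; split.
- exact: emeasurable_sum.
- by move=> w; apply: sume_ge0.
- move=> th sig m0 th0 m0N sig01.
  have W0 : 0 <= weight_mass tau th u sig m0 N.
    by apply: weight_mass_ge0; [exact: ltW|move=> i; case/andP: (sig01 i)].
  rewrite (eq_integral (fun w => \sum_(0 <= j < G)
      ((weight tau T th u sig m0 N w)%:E * Phi j w))%E); last first.
    by move=> w _; rewrite ge0_sume_distrr.
  rewrite ge0_integral_sum//; last 2 first.
  + move=> j; apply: emeasurable_funM => //; apply/measurable_EFinP.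
    exact: measurable_weight.
  + by move=> j w _; rewrite mule_ge0// lee_fin weight_ge0.
  apply: (@le_trans _ _ (\sum_(0 <= j < G)
     (weight_mass tau th u sig m0 N * expR (- u))%:E)%E).
    rewrite big_nat [leRHS]big_nat; apply: lee_sum => j /andP[_ jG].
    by have [_ _ /(_ jG)[+ _]] := HPhi j; apply.
  rewrite sumEFin lee_fin big_const_nat iter_addr_0 subn0 -[leLHS]mulr_natr -[leLHS]mulrA.
  rewrite ler_wpM2l//.
  have h1 : r <= expR (2^-1 * u) by have := H2 u uu2; rewrite powRr1// ltW.
  have h2 : G%:R <= r.
    by apply: (le_trans Gle); rewrite ler_pdivrMr// ler_peMr ?(ltW r0)//; lra.
  have h3 : expR (- u) * expR (2^-1 * u) * expR (2^-1 * u) = 1.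
    by rewrite -!expRD -[RHS]expR0; congr expR; field.
  have h4 : 4 <= expR (2^-1 * u) by have := expR_ge1Dx (2^-1 * u); lra.
  have E0 := expR_ge0 (- u).
  have h5 : expR (- u) * G%:R <= expR (- u) * expR (2^-1 * u).
    by rewrite ler_wpM2l//; exact: le_trans h1.
  apply: le_trans h5 _; set X := expR (- u) * expR (2^-1 * u) in h3 *.
  have X0 : 0 <= X by rewrite mulr_ge0// expR_ge0.
  have : X * 4 <= X * expR (2^-1 * u) by rewrite ler_wpM2l.
  lra.
move=> w Psi1 p p01; have [j jG /andP[h1 h2]] := grid_cell G0 p01.
have Phi1 : (Phi j w < 1)%E.
  apply: le_lt_trans Psi1.
  rewrite (big_cat_nat (n := j.+1))//= big_nat_recr//=.
  apply: (@le_trans _ _ (\sum_(0 <= i < j) Phi i w + Phi j w)%E).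
    by rewrite leeDr// sume_ge0.
  by rewrite leeDl// sume_ge0.
have [_ _ /(_ jG)[_ /(_ w Phi1 p)]] := HPhi j.
have pp : 0 <= p <= j.+1%:R / G%:R by rewrite h2; case/andP: p01 => ->.
move=> /(_ pp)[cv le_lim]; split => //; apply: le_trans le_lim _.
rewrite ler_wpM2l ?(ltW z0)//.
have : r / G%:R <= 2 * u.
  by rewrite ler_pdivrMr// mulrAC -ler_pdivrMr.
have : j%:R / G%:R * r <= p * r by rewrite ler_wpM2r// ltW.
rewrite -natr1 mulrDl mul1r; lra.
Qed.

End lower_bound.

Section lower_bound_assembly.
Context {d : measure_display} {Omega : measurableType d} {R : realType}.
Variable P : probability Omega R.
Variables (tau : R) (T : nat -> {RV P >-> R}).

Lemma weight_gt0_deadline (t u : R) (sig : nat -> R) (m0 N : nat) (w : Omega) :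
  0 < weight tau T t u sig m0 N w ->
  forall i, (2 <= i < m0)%N -> T i w <= sig i * u.
Proof.
rewrite /weight => W0 i im0; rewrite leNgt; apply/negP => Ti.
suff : \prod_(2 <= j < m0) ((T j w <= sig j * u)%R%:R : R) = 0.
  by move=> E; move: W0; rewrite E mul0r ltxx.
apply/eqP; rewrite prodf_seq_eq0; apply/hasP; exists i.
  by rewrite mem_index_iota.
by rewrite leNgt Ti/= eqxx.
Qed.

Lemma weight_le_tilt (t u : R) (sig : nat -> R) (m0 N : nat) (w : Omega) :
  weight tau T t u sig m0 N w <=
  expR (t * (jump_sum tau T u m0 N 1 w + \sum_(m0 <= i < N) jump tau u i ^+ 2)).
Proof.
rewrite weightE ler_piMl ?expR_ge0//.
by apply: prodr_ile1 => i _; case: (T i w <= _); rewrite ?lexx ?ler01.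
Qed.

End lower_bound_assembly.

(** The tilt is slightly larger than th, so that the tilted path is positive at the
    end, hence everywhere by concavity, except that near time 0 its drift does not
    yet exceed the fluctuations; there the first eta * scale clocks are forced to
    ring early.  On the event of no deviation the density is at most
    exp (scale (t D + small)) with D the drift at the end, which is of the order of
    h; so the probability of the event is at least its mass divided by that. *)
Lemma lower_bound {d : measure_display} {Omega : measurableType d} {R : realType}
    (P : probability Omega R) (tau beta : R) (T : nat -> {RV P >-> R})
    (htau : 3 < tau < 4)
    (hexp : forall i : nat, (2 <= i)%N -> exponential_rv (T i))
    (hmean : forall i : nat, (2 <= i)%N ->
      ('E_P[T i] = (i%:R `^ alpha tau)%:E)%E)
    (hindep : independent_rvs [set i : nat | (2 <= i)%N] T)
    (th : R) (hth : is_theta_star tau th) (dl : R) : 0 < dl ->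
  exists2 u0, 1 <= u0 & forall u, u0 <= u ->
  exists E : set Omega, [/\ measurable E,
    ((expR (scale tau u * (rate_int tau th - dl)))%:E <= P E)%E &
    forall w, E w -> forall p, 0 <= p <= 1 -> 0 < u * S_proc tau beta T (p * u) w].
Proof.
move=> dl0; have th0 := theta_star_gt0 hth; have th00 := ltW th0.
set B := profile_int tau; have B0 : 0 <= B := profile_int_ge0 tau.
set Lam := rate_int tau th.
pose Q0 := 8 * expR th * B.
have Q00 : 0 <= Q0 by rewrite mulr_ge0// mulr_ge0// expR_ge0.
(* the drift at the end is at most Q0 * h, and its price t * Q0 * h has to stay
   below dl / 8 *)
pose h := Num.min 4^-1 (dl / (8 * (th + 1) * (Q0 + 1))).
have den0 : 0 < 8 * (th + 1) * (Q0 + 1) by rewrite !mulr_gt0//; lra.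
have h0 : 0 < h by rewrite lt_min invr_gt0 ltr0n/= divr_gt0.
have h4 : 0 < h <= 4^-1 by rewrite h0 ge_min lexx.
have hden : h * (8 * (th + 1) * (Q0 + 1)) <= dl.
  by rewrite -ler_pdivlMr// ge_min lexx orbT.
pose t := th + h.
have t0 : 0 < t by rewrite addr_gt0.
have tge0 := ltW t0.
have t1 : t <= th + 1 by rewrite /t; case/andP: h4; lra.
set D := drift_int tau t 1.
have D0 : 0 < D by apply: (drift_int_gt0 htau hth); rewrite ltrDl.
have DQ : D <= Q0 * h by exact: drift_int_le.
have tD : t * D <= dl / 8.
  have : t * D <= (th + 1) * (Q0 * h) by apply: ler_pM => //; exact: ltW.
  have : 0 <= (th + 1) * h by rewrite mulr_ge0 ?(ltW h0)//; lra.
  move: hden; lra.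
have LamT : Lam <= rate_int tau t by exact: theta_star_min.
have DE : drift_int tau t 1 = D by [].
clearbody D t Lam; clear den0 hden h4 h0 DQ Q00 h Q0.
set cst := drift_cst t; have C1 : 1 <= cst := drift_cst_ge1 tge0.
have t10 : 0 < 16 * (t + 1) by rewrite mulr_gt0//; lra.
pose zeta := Num.min (Num.min 8^-1 (D / 16)) (dl / (16 * (t + 1))).
have z0 : 0 < zeta by rewrite !lt_min invr_gt0 ltr0n/= !divr_gt0.
have z8 : zeta <= 8^-1 by rewrite !ge_min lexx.
have zD : 16 * zeta <= D.
  have : zeta <= D / 16 by rewrite !ge_min lexx orbT.
  lra.
have ztl : zeta * (16 * (t + 1)) <= dl by rewrite -ler_pdivlMr// !ge_min lexx !orbT.
have tz : t * zeta <= dl / 16 by lra.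
have dl16 : 0 < dl / 16 by rewrite divr_gt0.
have [Kt Kt1 [ut ut1 Ht]] := multiscale_tail htau hexp hmean hindep z0.
have Cr : 0 <= t * (2 + cst) by rewrite mulr_ge0//; lra.
have [Mr Mr1 Hr] := riemann_jump htau Cr dl16
  (fun v v0 => @continuous_tilt_rate R t v (ltW v0))
  (fun v v0 => norm_tilt_rate_le tge0 (ltW v0)).
have cstE : drift_cst t = cst by [].
clearbody cst zeta; clear ztl.
have [Md Md1 [ud ud1 Hd]] := riemann_drift htau tge0 z0.
have [um um1 Hm] := sum_min23_le htau.
rewrite -/B in Hm; clearbody B.
pose K := Num.max Kt (Num.max Mr Md).
have K1 : 1 <= K by rewrite le_max Kt1.
have KKt : Kt <= K by rewrite le_max lexx.
have KMr : Mr <= K by rewrite !le_max lexx orbT.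
have KMd : Md <= K by rewrite !le_max lexx !orbT.
clearbody K.
have a0 := alpha_gt0 htau; have ah := alpha_lt_half htau.
have a2 : 0 < 1 - 2 * alpha tau by lra.
have a20 : 0 < 2 * alpha tau by lra.
have a10 : 0 <= 1 - alpha tau by lra.
pose L := (K + 1) `^ (1 - 2 * alpha tau) / (1 - 2 * alpha tau).
have L0 : 0 <= L by rewrite divr_ge0 ?powR_ge0// ltW.
have LE : (K + 1) `^ (1 - 2 * alpha tau) / (1 - 2 * alpha tau) = L by [].
clearbody L.
have L10 : 0 < L + 1 by lra.
pose kap := 6^-1 / (L + 1).
have kap0 : 0 < kap by rewrite divr_gt0.
have kapL1 : kap * (L + 1) = 6^-1 by rewrite /kap divfK// gt_eqF.
have kapL : kap * (L + 2 * zeta) <= 6^-1.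
  rewrite -kapL1 ler_wpM2l ?(ltW kap0)//; move: z8; clear; lra.
have kap1 : kap <= 1.
  by have : 0 <= kap * L by [rewrite mulr_ge0// ltW]; lra.
clearbody kap; clear kapL1 L10.
(* eta is the share of forced clocks: eta^(1 - 2 alpha) bounds what the forced
   indices remove from every sum, and eta^(2 alpha) / kap the price of forcing *)
pose A := (1 - 2 * alpha tau)^-1; have A0 : 0 < A by rewrite invr_gt0.
pose Q1 := A * (1 + cst + t * (2 + cst)).
have Q10 : 0 < Q1 by rewrite mulr_gt0//; move: C1 Cr; clear; lra.
pose z1 := Num.min zeta (dl / 16).
have z10 : 0 < z1 by rewrite lt_min z0.
have e10 : 0 < z1 / Q1 by rewrite divr_gt0.
have e20 : 0 < dl / 16 * kap * (2 * alpha tau) :=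
  mulr_gt0 (mulr_gt0 dl16 kap0) a20.
have [x1 /andP[x10 x11] Hx1] := powR_le_eventually a2 e10.
have [x2 /andP[x20 x21] Hx2] := powR_le_eventually a20 e20.
pose x := Num.min x1 x2.
have x0 : 0 < x by rewrite lt_min x10.
have x1' : 0 < x <= x1 by rewrite x0 ge_min lexx.
have x2' : 0 < x <= x2 by rewrite x0 ge_min lexx orbT.
have xle1 : x <= 1 by rewrite ge_min x11.
pose y := x `^ (1 - 2 * alpha tau) * A.
have y0 : 0 <= y by rewrite mulr_ge0 ?powR_ge0// ltW.
have yQ : y * (1 + cst + t * (2 + cst)) <= z1.
  have := Hx1 x x1'; rewrite ler_pdivlMr// /y /Q1; clear; lra.
have z1z : z1 <= zeta by rewrite ge_min lexx.
have z1d : z1 <= dl / 16 by rewrite ge_min lexx orbT.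
have yc : 0 <= y * cst by rewrite mulr_ge0// (le_trans ler01).
have yt : 0 <= y * (t * (2 + cst)) by rewrite mulr_ge0.
have xkap : kap^-1 * (x `^ (2 * alpha tau) / (2 * alpha tau)) <= dl / 16.
  rewrite mulrC ler_pdivrMr// ler_pdivrMr//; exact: Hx2.
have yz : y <= zeta by move: yQ z1z yc yt; clear; lra.
have ycz : y * cst <= zeta by move: yQ z1z yc yt y0; clear; lra.
have ytd : y * (t * (2 + cst)) <= dl / 16 by move: yQ z1d yc yt y0; clear; lra.
have yE : x `^ (1 - 2 * alpha tau) / (1 - 2 * alpha tau) = y by [].
clearbody y x; clear x1' x2' Hx1 Hx2 x11 x21 x10 x20 x1 x2 e10 e20.
clearbody z1 Q1; clear z10 yQ Q10 Q1 z1z z1d z1.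
pose eta := x / 2; have eta0 : 0 < eta by rewrite divr_gt0.
have xE : x = 2 * eta by rewrite /eta; field.
have etax : eta <= x by rewrite xE ler_peMl ?ler1n// ltW.
clearbody eta.
pose p1 := kap * eta `^ (1 - alpha tau).
have p10 : 0 < p1 by rewrite mulr_gt0// powR_gt0.
have p1E : kap * eta `^ (1 - alpha tau) = p1 by [].
clearbody p1.
pose eta2 := Num.min (p1 * (D / 16)) (dl / (16 * (t + 1))).
have eta20 : 0 < eta2 by rewrite lt_min mulr_gt0 ?divr_gt0.
have eta2p : eta2 <= p1 * (D / 16) by rewrite ge_min lexx.
have eta2d : t * eta2 <= dl / 16.
  have : eta2 * (16 * (t + 1)) <= dl by rewrite -ler_pdivlMr// ge_min lexx orbT.
  by move: eta20; clear; lra.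
clearbody eta2.
pose C2 := 2 * expR t * (B + 1).
have C20 : 0 < C2 by rewrite mulr_gt0 ?mulr_gt0 ?expR_gt0//; move: B0; clear; lra.
have C2E : 2 * expR t * (B + 1) = C2 by [].
clearbody C2.
have [lam lamh [c c0 hc]] := exists_small_tilt C20 eta20.
have lam0 : 0 < lam by case/andP: lamh.
pose Gc := L + 2 * cst * (B + 1).
have Gc0 : 0 <= Gc by rewrite addr_ge0// mulr_ge0//; move: B0 C1; clear; lra.
have GcE : L + 2 * cst * (B + 1) = Gc by [].
clearbody Gc; have [G G0 hG] := exists_fine_grid Gc0 eta20.
have g0 : 0 < G%:R :> R by rewrite ltr0n.
have t3 : 0 < tau - 3 by rewrite subr_gt0; case/andP: htau.
have [ub ub1 Hb] := powR_ge_eventually (`|beta| / zeta) t3.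
have [us us1 Hs] := scale_ge_eventually htau
  (Num.max (Num.max Mr eta^-1) (Num.max (8 * G.+1%:R / c) (32 / dl))).
exists (Num.max (Num.max ut ud) (Num.max um (Num.max ub us))).
  by rewrite !le_max ut1.
move=> u; rewrite !ge_max => /andP[/andP[utu udu] /andP[umu /andP[ubu usu]]].
have u1 : 1 <= u by exact: le_trans utu.
have u0 : 0 < u by exact: lt_le_trans u1.
have r1 := scale_ge1 htau u1; have r0 := scale_gt0 tau u0.
have := Hs u usu; rewrite !ge_max => /andP[/andP[rMr reta] /andP[rG rdl]].
set r := scale tau u in r1 r0 rMr reta rG rdl *.
have [N [_ KrN NK]] := exists_cutoff K1 r1; have KN := ltW KrN.
have hKt : Kt * r <= N%:R by apply: le_trans KN; rewrite ler_wpM2r ?(ltW r0).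
have hMr : Mr * r <= N%:R by apply: le_trans KN; rewrite ler_wpM2r ?(ltW r0).
have hMd : Md * r <= N%:R by apply: le_trans KN; rewrite ler_wpM2r ?(ltW r0).
clear KN.
have er1 : 1 <= eta * r by rewrite mulrC -ler_pdivrMr// mul1r.
have er0 : 0 <= eta * r := le_trans ler01 er1.
pose m0 := (Num.truncn (eta * r)).+1.
have m02 : (2 <= m0)%N by rewrite ltnS truncn_gt0.
have m0le : (Num.truncn (eta * r))%:R <= eta * r by have := truncn_le (eta * r); rewrite er0.
have m0N : (2 <= m0 <= N)%N.
  rewrite m02 -(ltr_nat R); apply: le_lt_trans m0le _.
  apply: (@le_lt_trans _ _ (K * r)) => //.
  by rewrite ler_wpM2r ?(ltW r0)//; apply: le_trans K1; apply: le_trans etax _.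
have m0x : m0%:R / r <= x.
  rewrite ler_pdivrMr// -natr1 xE; move: m0le er1; clear; lra.
have etam0 : eta <= m0%:R / r by rewrite ler_pdivlMr//; apply/ltW; exact: truncnS_gt.
clearbody m0.
have m0r0 : 0 <= m0%:R / r by rewrite divr_ge0// ltW.
have [Psi [mPsi Psi0 intPsi goodPsi]] := Ht u N utu hKt.
have hrate := Hr u N u0 rMr hMr; rewrite -/(rate_int tau t) -/r in hrate.
have hdrift := Hd u N 1 udu hMd; rewrite ler01 lexx DE -/r in hdrift.
have {}hdrift := hdrift isT.
have SqN : \sum_(2 <= i < N) jump tau u i ^+ 2 <= r * L.
  apply: le_trans (sum_jump_sq_init_le htau N u0) _.
  rewrite -/r -LE ler_wpM2l ?(ltW r0)// ler_wpM2r ?invr_ge0 ?(ltW a2)//.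
  by rewrite ge0_ler_powR ?nnegrE ?(ltW a2)// ?divr_ge0 ?(ltW r0)// addr_ge0// (le_trans ler01).
have Sqm : \sum_(2 <= i < m0) jump tau u i ^+ 2 <= y * r.
  apply: le_trans (sum_jump_sq_init_le htau m0 u0) _.
  rewrite -/r -yE mulrC ler_wpM2r ?(ltW r0)// ler_wpM2r ?(ltW A0)//.
  by rewrite ge0_ler_powR ?nnegrE ?(ltW a2)// ltW.
have v0 i := jump_ge0 tau i (ltW u0).
have minm : \sum_(2 <= i < m0) min23 (jump tau u i) <= y * r.
  by apply: le_trans Sqm; apply: ler_sum => i _; exact: min23_le_sq.
have yr0 : 0 <= y * r by rewrite mulr_ge0// ltW.
have yrz : y * r <= zeta * r by rewrite ler_wpM2r ?(ltW r0).
have min_le : \sum_(m0 <= i < N) min23 (jump tau u i) <= (B + 1) * r.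
  apply: le_trans (Hm u N umu).
  case/andP: m0N => m2 mN; rewrite [leRHS](big_cat_nat m2 mN)/= lerDr.
  by apply: sumr_ge0 => i _; exact: min23_ge0.
have mid_split (F : nat -> R) : \sum_(m0 <= i < N) F i =
    \sum_(2 <= i < N) F i - \sum_(2 <= i < m0) F i.
  by case/andP: m0N => m2 mN; rewrite [X in _ = X - _](big_cat_nat m2 mN)/= [RHS]addrC addKr.
have p11 : 0 <= (1 : R) <= 1 by rewrite ler01 lexx.
have drift_m : `|\sum_(2 <= i < m0) tilt_drift t 1 (jump tau u i)| <= zeta * r.
  apply: (@le_trans _ _ (cst * (\sum_(2 <= i < m0) min23 (jump tau u i)))).
    apply: le_trans (ler_norm_sum _ _ _) _; rewrite mulr_sumr; apply: ler_sum => i _.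
    by have := norm_tilt_drift_le tge0 p11 (v0 i); rewrite mulr1 cstE.
  have : cst * (\sum_(2 <= i < m0) min23 (jump tau u i)) <= cst * (y * r).
    by rewrite ler_wpM2l// (le_trans ler01).
  have : (y * cst) * r <= zeta * r by rewrite ler_wpM2r ?(ltW r0).
  by clear; lra.
have rate_m : `|\sum_(2 <= i < m0) tilt_rate t (jump tau u i)| <= dl / 16 * r.
  apply: (@le_trans _ _ (t * (2 + cst) * (\sum_(2 <= i < m0) min23 (jump tau u i)))).
    apply: le_trans (ler_norm_sum _ _ _) _; rewrite mulr_sumr; apply: ler_sum => i _.
    by rewrite -cstE; exact: norm_tilt_rate_le.
  have : t * (2 + cst) * (\sum_(2 <= i < m0) min23 (jump tau u i))
      <= t * (2 + cst) * (y * r) by rewrite ler_wpM2l.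
  have : (y * (t * (2 + cst))) * r <= dl / 16 * r by rewrite ler_wpM2r ?(ltW r0).
  by clear; lra.
pose sig i := if (2 <= i < m0)%N then deadline tau kap u i else 0.
have sigE i : (2 <= i < m0)%N -> sig i = deadline tau kap u i by rewrite /sig => ->.
have sig01 i : 0 <= sig i <= 1.
  rewrite /sig; case: ifP => [/andP[i2 im0]|_]; last by rewrite lexx ler01.
  have ir1 : i%:R / r <= 1.
    apply: le_trans xle1; apply: le_trans m0x.
    by rewrite ler_wpM2r ?invr_ge0 ?(ltW r0)// ler_nat ltnW.
  have pw1 : (i%:R / r) `^ (1 - alpha tau) <= 1.
    apply: le_trans (ge0_ler_powR a10 _ _ ir1) _; rewrite ?nnegrE ?powR1//.
    by rewrite divr_ge0// ltW.
  rewrite /deadline -/r mulr_ge0 ?powR_ge0 ?(ltW kap0)//=.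
  by apply: mulr_ile1; rewrite ?powR_ge0 ?(ltW kap0).
pose mid := grid_excess tau T t u lam eta2 m0 N G.
have mid0 w : 0 <= mid w by exact: grid_excess_ge0.
have mmid : measurable_fun setT mid by exact: measurable_grid_excess.
pose W := weight tau T t u sig m0 N.
have W0 w : 0 <= W w by exact: weight_ge0.
have mW : measurable_fun setT W by exact: measurable_weight.
pose mass := weight_mass tau t u sig m0 N.
have mass0 : 0 <= mass.
  by apply: weight_mass_ge0; [exact: ltW|move=> i; case/andP: (sig01 i)].
pose DS := drift_sum tau t u m0 N 1.
pose Smid := \sum_(m0 <= i < N) jump tau u i ^+ 2.
pose Wmax := expR (t * (DS + 2 * eta2 * r + Smid)).
(* no test fails, and the forced clocks have rung in time, which is what a positive
   weight says *)
pose E := [set w | (Psi w + (mid w)%:E < 1)%E] `&` [set w | 0 < W w].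
have mE : measurable E.
  apply: measurableI.
    rewrite -[X in measurable X]setTI; apply: emeasurable_fun_infty_o => //.
    by apply: emeasurable_funD => //; exact/measurable_EFinP.
  rewrite (_ : [set w | _] = W @^-1` `]0, +oo[).
    by rewrite -[X in measurable X]setTI; apply: mW.
  by apply/seteqP; split => w /=; rewrite in_itv/= andbT.
have EPsi w : E w -> (Psi w < 1)%E /\ mid w < 1.
  move=> [/= lt1 _]; split.
    by apply: le_lt_trans lt1; rewrite leeDl// lee_fin.
  by rewrite -lte_fin; apply: le_lt_trans lt1; rewrite leeDr.
have near w p : E w -> 0 <= p <= 1 ->
    `|jump_sum tau T u m0 N p w - drift_sum tau t u m0 N p| <= 2 * eta2 * r.
  move=> /EPsi[_ mid1] p01.
  apply: le_trans (jump_sum_near_drift tge0 u0 lam0 G0 mid1 p01) _.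
  rewrite -/r cstE.
  have Smid_le : \sum_(m0 <= i < N) jump tau u i ^+ 2 <= r * L.
    apply: le_trans SqN; rewrite mid_split lerBlDr lerDl.
    by apply: sumr_ge0 => i _; exact: sqr_ge0.
  have : G%:R^-1 * (\sum_(m0 <= i < N) jump tau u i ^+ 2 +
      2 * cst * \sum_(m0 <= i < N) min23 (jump tau u i)) <= G%:R^-1 * (Gc * r).
    rewrite ler_wpM2l ?invr_ge0 ?(ltW g0)// -GcE.
    have : 2 * cst * (\sum_(m0 <= i < N) min23 (jump tau u i))
        <= 2 * cst * ((B + 1) * r).
      by rewrite ler_wpM2l// mulr_ge0// (le_trans ler01).
    by move: Smid_le; clear; lra.
  have : G%:R^-1 * Gc * r <= eta2 * r by rewrite ler_wpM2r// ltW.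
  by clear; lra.
exists E; split => //; last first.
  move=> w Ew p p01; have [Psi1 mid1] := EPsi w Ew.
  have forced := weight_gt0_deadline (proj2 Ew : 0 < W w).
  have forced' i : (2 <= i < m0)%N -> T i w <= deadline tau kap u i * u.
    by move=> im; rewrite -sigE//; exact: forced.
  have bz : `|beta| * u ^+ 2 <= zeta * scale tau u.
    have hh := Hb u ubu; rewrite ler_pdivrMr// in hh.
    have : u ^+ 2 * `|beta| <= u ^+ 2 * (u `^ (tau - 3) * zeta).
      by rewrite ler_wpM2l ?sqr_ge0.
    by rewrite scale_sqE//; clear; lra.
  have Sqm' : \sum_(2 <= i < m0) jump tau u i ^+ 2 <= zeta * scale tau u.
    by apply: le_trans Sqm _.
  have p1d : 0 < p1 <= deadline tau kap u m0.
    rewrite p10 -p1E /deadline -/r ler_wpM2l ?(ltW kap0)//.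
    by rewrite ge0_ler_powR ?nnegrE// ltW.
  apply: (forced_path_positive htau u0 m0N kap0 L0 z0 kapL z8 zD bz SqN Sqm' p1d
    forced' (goodPsi w Psi1) _ p01).
  move=> q q01; rewrite -/r; have := near w q Ew q01; rewrite ler_norml => /andP[n1 _].
  have conc : q * DS <= drift_sum tau t u m0 N q.
    rewrite /DS /drift_sum mulr_sumr; apply: ler_sum => i _.
    exact: tilt_drift_concave.
  have DSge : r * (D - 2 * zeta) <= DS.
    rewrite /DS /drift_sum mid_split; move: hdrift drift_m.
    rewrite !ler_norml => /andP[k1 _] /andP[_ k2]; move: k1 k2; clear; lra.
  have : q * (r * (D - 2 * zeta)) <= q * DS.
    by rewrite ler_wpM2l//; case/andP: q01.
  have : eta2 * r <= p1 * (D / 16) * r by rewrite ler_wpM2r// ltW.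
  by move: n1 conc; clear; lra.
(* on E the weight is at most Wmax; off E it vanishes or some test fails *)
have WE w : ((W w)%:E <= Wmax%:E * (\1_E w)%:E + (W w)%:E * (Psi w + (mid w)%:E))%E.
  have R0 : (0 <= (W w)%:E * (Psi w + (mid w)%:E))%E.
    by rewrite mule_ge0 ?lee_fin// adde_ge0// lee_fin.
  have [Ew|nE] := pselect (E w).
    rewrite indicE mem_set// mule1; apply: le_trans (leeDl _ R0).
    rewrite lee_fin; apply: le_trans (weight_le_tilt _ _ _ _ _ _ _ _) _.
    rewrite ler_expR ler_wpM2l// lerD2r.
    by have := near w 1 Ew p11; rewrite ler_norml -/DS => /andP[_]; clear; lra.
  rewrite indicE memNset// mule0 add0e.
  have [W1|W1] := ltP 0 (W w); last first.
    have -> : W w = 0 by apply/eqP; rewrite eq_le W1 W0.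
    by rewrite mul0e.
  have P1 : (1 <= Psi w + (mid w)%:E)%E.
    by rewrite leNgt; apply/negP => lt1; apply: nE.
  by rewrite -[leLHS]mule1 lee_wpmul2l// lee_fin.
have int_le : (mass%:E <= Wmax%:E * P E + (mass / 2)%:E)%E.
  rewrite -(integral_weight hexp hmean hindep t u0 m0N sig01).
  apply: (@le_trans _ _ (\int[P]_w (Wmax%:E * (\1_E w)%:E +
      ((W w)%:E * Psi w + (W w * mid w)%:E)))%E).
    apply: ge0_le_integral => //.
    - by move=> w _; rewrite lee_fin.
    - exact/measurable_EFinP.
    - apply: emeasurable_funD.
        by apply/measurable_EFinP; apply: measurable_funM => //; exact: measurable_indic.
      apply: emeasurable_funD.
        by apply: emeasurable_funM => //; exact/measurable_EFinP.
      by apply/measurable_EFinP; exact: measurable_funM.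
    - move=> w _; have := WE w; rewrite ge0_muleDr// lee_fin; exact: mid0.
  rewrite ge0_integralD//=; last 4 first.
  - by move=> w _; rewrite mule_ge0// lee_fin// expR_ge0.
  - by apply/measurable_EFinP; apply: measurable_funM => //; exact: measurable_indic.
  - by move=> w _; rewrite adde_ge0// ?mule_ge0// lee_fin// mulr_ge0.
  - apply: emeasurable_funD.
      by apply: emeasurable_funM => //; exact/measurable_EFinP.
    by apply/measurable_EFinP; exact: measurable_funM.
  apply: leeD.
    rewrite ge0_integralZl//=.
    - by rewrite integral_indic// setIT.
    - by apply/measurable_EFinP; exact: measurable_indic.
    - by rewrite lee_fin expR_ge0.
  rewrite ge0_integralD//=; last 4 first.
  - by move=> w _; rewrite mule_ge0// lee_fin.
  - by apply: emeasurable_funM => //; exact/measurable_EFinP.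
  - by move=> w _; rewrite lee_fin mulr_ge0.
  - by apply/measurable_EFinP; exact: measurable_funM.
  have -> : mass / 2 = mass * 4^-1 + mass * 4^-1 by field.
  rewrite EFinD; apply: leeD; first exact: intPsi.
  apply: le_trans (integral_grid_excess_le hexp hmean hindep eta2 tge0 u0 lamh m0N
    G0 sig01 min_le) _.
  rewrite lee_fin mulrCA ler_wpM2l// -/r C2E.
  have k1 : r * (C2 * lam ^+ 2 - lam * eta2) <= - (r * c).
    by rewrite -[leRHS]mulrN ler_wpM2l// ltW.
  have k2 : 8 * G.+1%:R <= expR (r * c).
    rewrite ler_pdivrMr// in rG; apply: (le_trans rG).
    by have := expR_ge1Dx (r * c); clear; lra.
  have k3 : expR (r * c) * expR (- (r * c)) = 1 by rewrite -expRD subrr expR0.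
  apply: (@le_trans _ _ ((G.+1 * 2)%:R * expR (- (r * c)))).
    by rewrite ler_wpM2l// ler_expR.
  have : 8 * G.+1%:R * expR (- (r * c)) <= expR (r * c) * expR (- (r * c)).
    by rewrite ler_wpM2r// expR_ge0.
  by rewrite natrM k3; clear; lra.
have finE : P E \is a fin_num by rewrite fin_num_measure.
rewrite -(fineK finE) -EFinM -EFinD lee_fin in int_le.
rewrite -(fineK finE) lee_fin.
have Wmax0 : 0 < Wmax by exact: expR_gt0.
rewrite -(ler_pM2l Wmax0); apply: (@le_trans _ _ (mass / 2)); last first.
  by move: int_le; clear; lra.
have massE := weight_massE tau t sig m0 N (ltW u0); rewrite -/mass -/Smid in massE.
have FP := forced_mass_ge htau u0 kap0 sigE.
have FPe : kap^-1 * (\sum_(2 <= i < m0) (i%:R / scale tau u) `^ (- (1 - 2 * alpha tau)))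
    <= dl / 16 * r.
  have b01 : 0 < 1 - 2 * alpha tau < 1 by rewrite a2/= gtrBl.
  have s1 := sum_scaled_powRN_le tau m0 b01 u0; rewrite -/r in s1.
  have e1 : 1 - (1 - 2 * alpha tau) = 2 * alpha tau by ring.
  rewrite e1 in s1.
  have s2 : (m0%:R / r) `^ (2 * alpha tau) / (2 * alpha tau) <=
      x `^ (2 * alpha tau) / (2 * alpha tau).
    rewrite ler_wpM2r ?invr_ge0 ?(ltW a20)//.
    by rewrite ge0_ler_powR ?nnegrE ?(ltW a20)// ltW.
  have k0 : 0 <= kap^-1 by rewrite invr_ge0 ltW.
  apply: le_trans (ler_wpM2l k0 s1) _.
  rewrite mulrCA [leRHS]mulrC ler_wpM2l ?(ltW r0)//; apply: le_trans xkap.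
  by rewrite ler_wpM2l.
have half : expR (- (dl / 16 * r)) <= 2^-1.
  have k1 : 2 <= expR (dl / 16 * r).
    rewrite ler_pdivrMr// in rdl; have := expR_ge1Dx (dl / 16 * r); move: rdl; clear; lra.
  have k3 : expR (dl / 16 * r) * expR (- (dl / 16 * r)) = 1 by rewrite -expRD subrr expR0.
  have : 2 * expR (- (dl / 16 * r)) <= expR (dl / 16 * r) * expR (- (dl / 16 * r)).
    by rewrite ler_wpM2r// expR_ge0.
  by rewrite k3; clear; lra.
rewrite massE mulrAC.
apply: (@le_trans _ _ (expR (- (dl / 16 * r)) * expR (- (dl / 16 * r)) *
    expR (\sum_(m0 <= i < N) tilt_rate t (jump tau u i) + t * Smid))); last first.
  rewrite ler_wpM2r ?expR_ge0//; apply: ler_pM; rewrite ?expR_ge0//.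
  by apply: le_trans FP; rewrite ler_expR lerN2.
rewrite /Wmax -!expRD ler_expR.
have rL : r * Lam <= r * rate_int tau t by rewrite ler_wpM2l// ltW.
have rate_ge : r * Lam - dl / 8 * r <= \sum_(m0 <= i < N) tilt_rate t (jump tau u i).
  rewrite mid_split; move: hrate rate_m.
  by rewrite !ler_norml => /andP[k1 _] /andP[_ k2]; move: k1 k2 rL; clear; lra.
have DSle : t * DS <= t * (r * (D + 2 * zeta)).
  rewrite ler_wpM2l// /DS /drift_sum mid_split; move: hdrift drift_m.
  by rewrite !ler_norml => /andP[_ k1] /andP[k2 _]; move: k1 k2; clear; lra.
have q1 : r * (t * D) <= r * (dl / 8) by rewrite ler_wpM2l// ltW.
have q2 : r * (t * zeta) <= r * (dl / 16) by rewrite ler_wpM2l// ltW.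
have q3 : r * (t * eta2) <= r * (dl / 16) by rewrite ler_wpM2l// ltW.
have rdl0 : 0 <= r * dl by rewrite mulr_ge0// ltW.
by move: rate_ge DSle q1 q2 q3 rdl0; clear; lra.
Qed.

(** * Conditioning on survival *)

Section conditioning.
Context {d : measure_display} {Omega : measurableType d} {R : realType}.
Variable P : probability Omega R.

(** Outer measure is monotone, so a measurable subset bounds the survival
    probability from below and a measurable superset bounds its bad part from
    above; subadditivity links the two. *)
Lemma cond_prob_near1 (A B L U : set Omega) (l e : R) :
  measurable L -> measurable U -> 0 < l ->
  L `<=` B -> B `\` A `<=` U -> (l%:E <= P L)%E -> (P U <= (e * l)%:E)%E ->
  `|1 - cond_prob P A B| <= e.
Proof.
move=> mL mU l0 LB BAU PL PU.
have ext_le1 X : (P^*%mu X <= 1)%E.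
  apply: le_trans (le_mu_ext P (@subsetT _ X)) _.
  by rewrite measurable_mu_extE//; exact: probability_le1.
have ext0 X : (0 <= P^*%mu X)%E by exact: outer_measure_ge0.
have fin X : P^*%mu X \is a fin_num.
  by rewrite ge0_fin_numE// (le_lt_trans (ext_le1 X)) ?ltry.
have B_ge : (l%:E <= P^*%mu B)%E.
  by apply: (le_trans PL); rewrite -(measurable_mu_extE P mL); exact: le_mu_ext.
have AB_le : (P^*%mu (A `&` B) <= P^*%mu B)%E by apply: le_mu_ext => w [].
have B_le : (P^*%mu B <= P^*%mu (A `&` B) + (e * l)%:E)%E.
  apply: le_trans (le_outer_measureIC P^*%mu A B) _; rewrite setIC leeD2l//.
  apply: le_trans (le_mu_ext P (_ : _ `<=` U)) _.
    by move=> w [Bw nAw]; apply: BAU.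
  by rewrite measurable_mu_extE.
rewrite /cond_prob; move: B_ge AB_le B_le.
rewrite -(fineK (fin B)) -(fineK (fin (A `&` B))) -EFinD !lee_fin.
set b := fine _; set a := fine _ => lb ab ba.
have b0 : 0 < b by exact: lt_le_trans lb.
have -> : 1 - a / b = (b - a) / b by rewrite mulrBl divff// gt_eqF.
rewrite ger0_norm; last by rewrite divr_ge0 ?(ltW b0)// subr_ge0.
rewrite ler_pdivrMr//.
have e0 : 0 <= e * l by move: ab ba; lra.
have : e * l <= e * b by rewrite ler_wpM2l// -(pmulr_lge0 _ l0).
lra.
Qed.

End conditioning.

Section conclusion.
Context {R : realType}.

(** The additional unit of time changes the scale by a factor 1 + O(1 / u) only. *)
Lemma scale_shift_eventually (tau a b : R) : 3 < tau < 4 -> b < a ->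
  exists2 u0 : R, 1 <= u0 & forall u, u0 <= u ->
  scale tau u * b <= scale tau (u + 1) * a.
Proof.
move=> htau ba; pose u0 := Num.max 1 (7 * `|a| / (a - b)).
exists u0; first by rewrite le_max lexx.
move=> u; rewrite ge_max => /andP[u1 ua].
have u0' : 0 < u by exact: lt_le_trans u1.
have r0 := scale_gt0 tau u0'; have v0 : 0 < u^-1 by rewrite invr_gt0.
have v1 : u^-1 <= 1 by rewrite invf_le1.
(* tau - 1 <= 3, and (1 + y)^3 <= 1 + 7 y for 0 <= y <= 1 *)
have q : (1 + u^-1) `^ (tau - 1) <= 1 + 7 * u^-1.
  apply: (@le_trans _ _ ((1 + u^-1) `^ 3%:R)).
    by rewrite ler_powR//; [rewrite lerDl ltW|case/andP: htau; lra].
  rewrite powR_mulrn; last by lra.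
  have h1 : u^-1 * u^-1 <= u^-1 * 1 by rewrite ler_wpM2l// ltW.
  have h2 : u^-1 * (u^-1 * u^-1) <= u^-1 * 1.
    by rewrite ler_wpM2l ?(ltW v0)//; move: h1 v1; clear; lra.
  rewrite !exprS expr0; move: h1 h2; clear; lra.
have q1 : 1 <= (1 + u^-1) `^ (tau - 1).
  by rewrite -[leLHS](powRr0 (1 + u^-1)) ler_powR//; [rewrite lerDl ltW|case/andP: htau; lra].
have -> : scale tau (u + 1) = scale tau u * (1 + u^-1) `^ (tau - 1).
  rewrite /scale -powRM ?(ltW u0')//; last by lra.
  by congr (_ `^ _); rewrite mulrDr mulr1 divff// gt_eqF.
rewrite -mulrA ler_wpM2l ?(ltW r0)//.
have ab0 : 0 < a - b by rewrite subr_gt0.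
have h7 : 7 * `|a| * u^-1 <= a - b.
  by rewrite ler_pdivrMr// [leRHS]mulrC -ler_pdivrMr.
set Q := _ `^ _ in q q1 *.
have : - `|a| * (Q - 1) <= a * (Q - 1).
  by rewrite ler_wpM2r ?subr_ge0// lerNl -normrN ler_norm.
have : `|a| * (Q - 1) <= `|a| * (7 * u^-1) by rewrite ler_wpM2l// lerBlDl.
move: h7; clear; lra.
Qed.

(** Positivity up to time u alone would leave room for an infimum of zeros equal
    to u; hence the additional unit of time. *)
Lemma hitting_gt (tau beta u : R) (Omega : Type) (T : nat -> Omega -> R) (w : Omega) :
  0 <= u ->
  (forall p, 0 <= p <= 1 -> 0 < (u + 1) * S_proc tau beta T (p * (u + 1)) w) ->
  (u%:E < H1 tau beta T w)%E.
Proof.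
move=> u0 Spos; have v0 : 0 < u + 1 by rewrite ltr_wpDl.
apply: (@lt_le_trans _ _ (u + 1)%:E); first by rewrite lte_fin ltrDl.
apply: le_ereal_inf_tmp => _ [t [t0 St] <-]; rewrite lee_fin leNgt; apply/negP => tu.
have p01 : 0 <= t / (u + 1) <= 1.
  by rewrite divr_ge0 ?(ltW v0)//= ler_pdivrMr// mul1r ltW.
by have := Spos _ p01; rewrite divfK ?gt_eqF// St mulr0 ltxx.
Qed.

End conclusion.

Theorem theorem1p5 (R : realType) (d : measure_display)
    (Omega : measurableType d) (P : probability Omega R)
    (tau beta theta : R) (T : nat -> {RV P >-> R})
    (htau : 3 < tau < 4)
    (htheta : is_theta_star tau theta)
    (hexp : forall i : nat, (2 <= i)%N -> exponential_rv (T i))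
    (hmean : forall i : nat, (2 <= i)%N ->
       ('E_P[T i] = (i%:R `^ alpha tau)%:E)%E)
    (hindep : independent_rvs [set i : nat | (2 <= i)%N] T) :
  let S := S_proc tau beta T in
  forall eps : R, 0 < eps ->
    cond_prob P
      [set w | (ereal_sup
         [set (`|S (p * u) w - u `^ (tau - 2) * I_E tau theta p|)%:E
            | p in `[0%R, 1%R]]
         <= (u `^ (tau - 2) * eps)%:E)%E]
      [set w | (u%:E < H1 tau beta T w)%E]
    @[u --> +oo%R] --> (1 : R).

Proof.
move=> S eps eps0.
have [dl dl0 [u1 u11 Hup]] := upper_bound beta htau hexp hmean hindep htheta eps0.
(* the lower bound and the shift of time each take a quarter of dl; half of dl is
   left for the ratio *)
have dl4 : 0 < dl / 4 by rewrite divr_gt0.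
have [u2 u21 Hlo] := lower_bound beta htau hexp hmean hindep htheta dl4.
set Lam := rate_int tau theta in Hup Hlo.
have gap : Lam - dl / 2 < Lam - dl / 4 by lra.
have [u3 u31 Hsh] := scale_shift_eventually htau gap.
apply/cvgrPdist_le => e e0.
have [u4 u41 Hsc] := scale_ge_eventually htau (2 / (dl * e)).
pose u5 := Num.max (Num.max u1 u2) (Num.max u3 u4).
apply: (filterS _ (nbhs_pinfty_ge (num_real u5))) => u.
rewrite /u5 /= !ge_max => /andP[/andP[uu1 uu2] /andP[uu3 uu4]].
have u0 : 0 < u by lra.
have [Eup [mEup PEup goodup]] := Hup u uu1.
have u12 : u2 <= u + 1 by lra.
have [Elo [mElo PElo goodlo]] := Hlo _ u12.
set r := scale tau u in PEup.
have r0 : 0 < r := scale_gt0 tau u0.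
apply: (cond_prob_near1 mElo mEup (expR_gt0 (r * (Lam - dl / 2)))).
- by move=> w Ew; apply: hitting_gt; [exact: ltW|exact: goodlo].
- move=> w [/= hH nA]; apply: contrapT => nE; apply: nA; exact: goodup.
- by apply: le_trans PElo; rewrite lee_fin ler_expR; exact: Hsh.
- apply: (le_trans PEup); rewrite lee_fin.
  have -> : r * (Lam - dl) = - (r * (dl / 2)) + r * (Lam - dl / 2) by lra.
  rewrite expRD ler_wpM2r ?expR_ge0//.
  have hr : 1 <= e * (r * (dl / 2)).
    have := Hsc u uu4; rewrite ler_pdivrMr ?mulr_gt0//; rewrite -/r; lra.
  have k1 := expR_ge1Dx (r * (dl / 2)).
  have k2 : expR (r * (dl / 2)) * expR (- (r * (dl / 2))) = 1.
    by rewrite -expRD subrr expR0.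
  have k3 : e * (1 + r * (dl / 2)) <= e * expR (r * (dl / 2)) by rewrite ler_wpM2l// ltW.
  have k4 : 1 <= e * expR (r * (dl / 2)) by move: hr k3 e0; clear; lra.
  have := ler_wpM2r (expR_ge0 (- (r * (dl / 2)))) k4.
  by rewrite mul1r -mulrA k2 mulr1.
Qed.
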